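(* Let $N\ge 1$ and let $F:\mathbb{C}^N\to\mathbb{C}^N$ be a homogeneous regular polynomial map of degree $d\ge 2$. Let $K_F=\{z\in\mathbb{C}^N:\sup_n\|F^n(z)\|<\infty\}$ be its filled Julia set, where $F^n$ denotes the $n$-th iterate of $F$. Then $$d_\infty(K_F)=|\operatorname{Res}(F)|^{-1/(Nd^{N-1}(d-1))}.$$
   Context: $\|\cdot\|$ is the Euclidean norm on $\mathbb{C}^N$. Regular maps: a polynomial map $F:\mathbb{C}^N\to\mathbb{C}^N$ is regular of degree $d$ if it extends to a holomorphic endomorphism of $\mathbb{P}^N$ and its coordinate functions have (necessarily common) degree $d$. A homogeneous polynomial map (all components homogeneous of the same degree $d\ge1$) is regular if and only if $F^{-1}\{0\}=\{0\}$. Resultant: for an $N$-tuple $H=(H_1,\dots,H_N)$ of homogeneous polynomials of degree $d$ in $N$ variables, $\operatorname{Res}(H)$ is the multiresultant (Gelfand–Kapranov–Zelevinsky): the unique absolutely irreducible polynomial with integer coefficients in the coefficients of $H$ such that (i) $\operatorname{Res}(H)\ne0$ if and only if $H$ is regular, and (ii) $\operatorname{Res}(z_1^d,\dots,z_N^d)=1$. It is homogeneous of degree $d^{N-1}$ in the coefficients of each $H_i$. Transfinite diameter (Fekete–Leja): for $n\ge 1$ let $e_1,\dots,e_{M(n)}$ be the monomials in $N$ variables of degree $\le n$, where $M(n)=\binom{N+n}{N}$, and let $D(n)=N\binom{N+n}{N+1}$. For bounded $E\subset\mathbb{C}^N$ put $$d_n(E)=\Big(\sup_{\zeta_1,\dots,\zeta_{M(n)}\in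 E}|\det(e_i(\zeta_j))_{i,j}|\Big)^{1/D(n)},\qquad d_\infty(E)=\lim_{n\to\infty}d_n(E);$$ the limit exists (Zaharjuta). *)

(* Defs.v *)
From HB Require Import structures.
From mathcomp Require Import all_boot all_order all_algebra.
(* The notations of mpoly clash with those of mathcomp-analysis: only its
   definitions, coercions and canonical instances are imported. *)
From mathcomp Require Import -(notations) mpoly.
From mathcomp Require Import all_classical all_reals all_analysis.
From mathcomp Require Import complex.

Set Implicit Arguments.
Unset Strict Implicit.
Unset Printing Implicit Defensive.

Import Order.TTheory GRing.Theory Num.Theory.
Import numFieldNormedType.Exports.

Local Open Scope classical_set_scope.
Local Open Scope ring_scope.

Notation "{ 'mpoly' T [ n ] }" := (mpoly n T)
  (T at level 2, n at level 200, format "{ 'mpoly'  T [ n ] }") : type_scope.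

(* [R[i]] packed as a [numClosedFieldType], so that [C R] and ['rV[C R]_n]
   inherit the topology that mathcomp-analysis puts on any [numFieldType]. *)
Definition C (R : realType) : numClosedFieldType := R[i].

(* The modulus, with values in [R] ([`|z|] has values in [C R]). *)
Definition modulus (R : realType) (z : C R) : R := ComplexField.Normc.normc z.

Definition enorm (R : realType) (N : nat) (z : 'rV[C R]_N) : R :=
  Num.sqrt (\sum_(i < N) modulus (z 0 i) ^+ 2).

Definition polymap (R : realType) (N : nat) : Type := 'I_N -> {mpoly (C R)[N]}.

Definition pmeval (R : realType) (N : nat) (F : polymap R N)
    (z : 'rV[C R]_N) : 'rV[C R]_N :=
  \row_(i < N) meval (fun j => z 0 j) (F i).

Definition homogeneous_map (R : realType) (N d : nat) (F : polymap R N) : Prop :=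
  forall i, F i \is ishomog1 d mdeg.

(* P^N as the set of lines of C^(N+1). *)
Definition proj_space (R : realType) (N : nat) : Type :=
  {L : {vspace 'rV[C R]_N.+1} | \dim L == 1%N}.

(* Near every point of C^(N+1) \ {0}, a holomorphic self-map of P^N is induced
   by a C-differentiable map [h] of homogeneous coordinates. Such an [h] does
   not vanish where this holds, since [<[h u]>] is then a line. *)
Definition holomorphic_endo (R : realType) (N : nat)
    (g : proj_space R N -> proj_space R N) : Prop :=
  forall v : 'rV[C R]_N.+1, v != 0 ->
  exists h : 'rV[C R]_N.+1 -> 'rV[C R]_N.+1,
    \forall u \near v, differentiable h u /\
      (forall L : proj_space R N,
         val L = <[u]>%VS -> val (g L) = <[h u]>%VS).

(* The affine chart z |-> [1 : z]. *)
Definition affine_chart (R : realType) (N : nat) (z : 'rV[C R]_N) :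
    'rV[C R]_N.+1 :=
  row_mx (const_mx 1 : 'rV[C R]_1) z.

Definition extends_to_proj (R : realType) (N : nat)
    (f : 'rV[C R]_N -> 'rV[C R]_N) (g : proj_space R N -> proj_space R N) :
    Prop :=
  forall (z : 'rV[C R]_N) (L : proj_space R N),
    val L = <[affine_chart z]>%VS -> val (g L) = <[affine_chart (f z)]>%VS.

(* [mmeasure mdeg p] is 1 + the degree of [p], and 0 if [p = 0]. *)
Definition regular (R : realType) (N d : nat) (F : polymap R N) : Prop :=
  (forall i, mmeasure mdeg (F i) = d.+1) /\
  (exists g : proj_space R N -> proj_space R N,
     holomorphic_endo g /\ extends_to_proj (pmeval F) g).

(* The coefficients of an N-tuple of homogeneous polynomials of degree d in N
   variables are indexed by the pairs (i, m), with m a monomial of degree d. *)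
Definition coef_index (N d : nat) : predArgType :=
  {im : 'I_N * bmultinom N d.+1 | mdeg im.2 == d}.

HB.instance Definition _ (N d : nat) := Finite.on (coef_index N d).

Definition coefs (R : realType) (N d : nat) (H : polymap R N)
    (k : 'I_#|coef_index N d|) : C R :=
  let im := val (enum_val k) in mcoeff im.2 (H im.1).

Definition eval_coefs (R : realType) (N d : nat)
    (P : {mpoly int[#|coef_index N d|]}) (H : polymap R N) : C R :=
  meval (@coefs R N d H) (map_mpoly intr P).

Definition absolutely_irreducible (R : realType) (n : nat)
    (P : {mpoly int[n]}) : Prop :=
  let Q : {mpoly (C R)[n]} := map_mpoly intr P in
  Q \isn't a GRing.unit /\
  (forall p q : {mpoly (C R)[n]},
     Q = p * q -> p \is a GRing.unit \/ q \is a GRing.unit).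

(* The characterization of Gelfand, Kapranov and Zelevinsky, satisfied by
   exactly one [P]. *)
Definition is_resultant (R : realType) (N d : nat)
    (P : {mpoly int[#|coef_index N d|]}) : Prop :=
  [/\ absolutely_irreducible R P,
      forall H : polymap R N, homogeneous_map d H ->
        (eval_coefs P H != 0 <-> regular d H)
    & eval_coefs P (fun i => mpolyX (C R) (mnm1 i) ^+ d : {mpoly (C R)[N]}) = 1].

Definition filled_julia (R : realType) (N : nat) (F : polymap R N) :
    set 'rV[C R]_N :=
  [set z | (ereal_sup (range (fun n => (enorm (iter n (pmeval F) z))%:E))
            < +oo)%E].

(* The monomials of degree <= n are enumerated by [enum_val]; there are
   'C(N + n, N) of them. *)
Definition fekete_det (R : realType) (N n : nat)
    (zeta : 'I_#|{: bmultinom N n.+1}| -> 'rV[C R]_N) : C R :=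
  \det (\matrix_(i, j)
    meval (fun k => zeta j 0 k) (mpolyX (C R) (bmnm (enum_val i)))).

Definition diameter (R : realType) (N : nat) (E : set 'rV[C R]_N) (n : nat) : R :=
  sup [set modulus (fekete_det zeta) |
       zeta in [set zeta : 'I_#|{: bmultinom N n.+1}| -> 'rV[C R]_N |
                forall j, E (zeta j)]]
  `^ ((N * 'C(N + n, N.+1))%N%:R^-1).

Definition transfinite_diameter (R : realType) (N : nat)
    (E : set 'rV[C R]_N) : R :=
  limn (diameter E).

(* Main.v *)
Require Import Defs.
From HB Require Import structures.
From mathcomp Require Import all_boot all_order all_algebra.
From mathcomp Require Import -(notations) mpoly.
From mathcomp Require Import all_classical all_reals all_analysis.
From mathcomp Require Import complex.
Import Order.TTheory GRing.Theory Num.Theory.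
Import numFieldNormedType.Exports.
Local Open Scope classical_set_scope.
Local Open Scope ring_scope.
From mathcomp Require Import perm cyclic separable cyclotomic mxred spectral zify ring lra.

(* Write q_g for the product of the monomials F^j(z)^(b_j) over the base-d digits b_j
   of an exponent g, and Q_m for the determinant expressing the q_g with |g| <= m in
   terms of the monomials. As the q_g grow subexponentially on K_F, the Fekete
   determinants of K_F are, up to subexponential factors, at most 1 / |Q_m|; the
   opposite inequality comes from evaluating at the points of F^-n(W), with W contained
   in a small torus: the determinant then splits as a product over fibres, which are
   controlled by the discriminant of the extension C[z] / C[F^n].

   By self-similarity Q_m is a product of determinants A_k of the families F^a z^b
   (b < d componentwise). Res divides A_k to an order determined by the vanishing of A_k
   along lines through degenerate maps, and a degree count on the line joining F to
   (z_i^d) shows that nothing else contributes to log |A_k| at leading order.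

   This requires the F^a z^b to be a basis, which holds for F outside a proper Zariski
   closed set; the general case follows by perturbation, using that the filled Julia
   sets of two nearby maps are nested up to a dilation. *)

(** Origin of the exponent. Write D(m) for the total degree and M(m) for the number of the monomials
    of degree at most m. The count on the line gives N d^N log |A_m| = D(m) log |Res F| + O(M(m)),
    and Q_m is A_m times the determinants Q of d^N smaller boxes, whose total degree is about D(m) /
    d. So log |Q_m| is about s D(m) with s (1 - 1/d) = log |Res F| / (N d^N), that is s = log |Res
    F| / (N d^(N-1) (d-1)). The degree of Res is not part of its characterization; the lower bound N
    d^(N-1) comes from an explicit one-parameter system on which Res has many roots. Against deg A_m
    <= D(m) / d and the order of Res in A_m, this leaves a cofactor B of degree O(M(m)). A small
    degree alone does not bound log |B(F)|: the roots of B on the line could approach F as m grows.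
    They cannot, because nonvanishing of A in the single degree N (d-1) + 1 implies nonvanishing in
    all degrees, so that all these roots lie in one finite set which avoids F. This is the reason
    for the genericity condition on F. *)

Set Implicit Arguments.
Unset Strict Implicit.
Unset Printing Implicit Defensive.

(** * Determinants indexed by finite types *)

Section FinDet.
Variable S : comNzRingType.

(** Rows and columns are listed by the same enumeration of [I], so its sign cancels and the value
    depends on [f] alone; [det_reindex] makes this precise. *)
Definition fdet (I : finType) (f : I -> I -> S) : S :=
  \det (\matrix_(i < #|I|, j < #|I|) f (enum_val i) (enum_val j)).

Lemma eq_fdet (I : finType) (f g : I -> I -> S) :
  (forall i j, f i j = g i j) -> fdet f = fdet g.
Proof. by move=> fg; congr (\det _); apply/matrixP=> i j; rewrite !mxE fg. Qed.

Lemma fdet_mul (I : finType) (f g : I -> I -> S) :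
  fdet (fun i j => \sum_k f i k * g k j) = fdet f * fdet g.
Proof.
rewrite -det_mulmx; congr (\det _); apply/matrixP=> i j; rewrite !mxE.
rewrite (reindex _ (onW_bij _ (enum_val_bij I))) /=.
by apply: eq_bigr => k _; rewrite !mxE.
Qed.

Lemma fdet_delta (I : finType) : fdet (fun i j : I => (i == j)%:R) = 1.
Proof.
rewrite /fdet -[RHS](det1 S #|I|); congr (\det _); apply/matrixP=> i j.
by rewrite !mxE (inj_eq enum_val_inj).
Qed.

Lemma det_reindex (I : finType) n (e : 'I_n -> I) (f : I -> I -> S) :
  bijective e -> \det (\matrix_(i, j) f (e i) (e j)) = fdet f.
Proof.
move=> be; have eqn : #|I| = n by rewrite -(bij_eq_card be) card_ord.
case: n / eqn e be => e be.
have inj_s : injective (fun i => enum_rank (e i)).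
  by move=> i j /enum_rank_inj /(bij_inj be).
pose s := perm inj_s.
set A := \matrix_(i, j) _.
have -> : A = row_perm s (col_perm s
   (\matrix_(i < #|I|, j < #|I|) f (enum_val i) (enum_val j))).
  by apply/matrixP=> i j; rewrite !mxE !permE !enum_rankK.
rewrite row_permE col_permE !det_mulmx !det_perm odd_permV.
by rewrite mulrCA -expr2 sqrr_sign mulr1.
Qed.

(** With the image of [phi] listed first, the matrix is block upper triangular and its second
    diagonal block is the identity. *)
Lemma fdet_inj (J I : finType) (phi : J -> I) (f : I -> I -> S) :
  injective phi ->
  (forall i j, (forall a, phi a != i) -> f i j = (i == j)%:R) ->
  fdet f = fdet (fun a b => f (phi a) (phi b)).
Proof.
move=> inj_phi f_id.
pose K := {i : I | [forall a, phi a != i]}.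
have Kn (k : K) a : (phi a == val k) = false.
  by apply/negbTE; case: k => i /= Hi; apply: (forallP Hi).
pose e (k : 'I_(#|J| + #|{: K}|)) : I :=
  match fintype.split k with
  | inl a => phi (enum_val a)
  | inr b => val (enum_val b)
  end.
have be : bijective e.
  apply: inj_card_bij.
    move=> i j; rewrite /e; case: fintype.splitP => a ia; case: fintype.splitP => b jb.
    + by move=> /inj_phi /enum_val_inj ab; apply: val_inj; rewrite /= ia jb ab.
    + by move/eqP; rewrite Kn.
    + by move/esym/eqP; rewrite Kn.
    + by move=> /val_inj /enum_val_inj ab; apply: val_inj; rewrite /= ia jb ab.
  rewrite card_ord card_sig -(card_codom inj_phi) -(cardC (mem (codom phi))) leq_add2l.
  apply/eq_leq/eq_card => i; rewrite !inE; apply/idP/idP => [H|/forallP H].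
    by apply/forallP=> a; apply: contraNneq H => <-; apply: codom_f.
  by apply/codomP=> -[a E]; have := H a; rewrite E eqxx.
rewrite -(det_reindex f be).
have -> : \matrix_(i, j) f (e i) (e j) = block_mx
   (\matrix_(i, j) f (phi (enum_val i)) (phi (enum_val j)))
   (\matrix_(i, j) f (phi (enum_val i)) (val (enum_val j))) 0 1%:M.
  apply/matrixP=> i j; rewrite !mxE /e.
  case: fintype.splitP => a ia; rewrite mxE; case: fintype.splitP => b jb; rewrite ?mxE //.
    rewrite f_id; last by move=> a'; rewrite Kn.
    by rewrite eq_sym Kn.
  rewrite f_id; last by move=> a'; rewrite Kn.
  by rewrite (inj_eq val_inj) (inj_eq enum_val_inj).
by rewrite det_ublock det1 mulr1.
Qed.

(** Keeping [f] on one class and putting identity rows elsewhere gives factors whose product is [f];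
    each factor reduces to its block by [fdet_inj]. The types [J b] may vary with [b], as do the
    boxes of [qdet_recursion]. *)
Lemma fdet_block (I B : finType) (c : I -> B) (J : B -> finType)
    (phi : forall b, J b -> I) (f : I -> I -> S) :
  (forall b, injective (phi b)) ->
  (forall b a, c (phi b a) = b) ->
  (forall i, exists a, phi (c i) a = i) ->
  (forall i j, c i != c j -> f i j = 0) ->
  fdet f = \prod_b fdet (fun a a' => f (phi b a) (phi b a')).
Proof.
move=> inj_phi c_phi phi_c f0.
pose W (s : seq B) i j := if c i \in s then f i j else (i == j)%:R.
have W1 b : fdet (fun a a' => f (phi b a) (phi b a')) = fdet (W [:: b]).
  rewrite (fdet_inj (inj_phi b)).
    by apply: eq_fdet => a a'; rewrite /W inE c_phi eqxx.
  move=> i j Hi; rewrite /W inE; case: eqP => // cib.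
  have [a] := phi_c i; move: a; rewrite cib => a E.
  by have := Hi a; rewrite E eqxx.
have WU s : uniq s -> fdet (W s) = \prod_(b <- s) fdet (W [:: b]).
  elim: s => [_|b s IH /= /andP[bs us]].
    by rewrite big_nil -[RHS](fdet_delta I); apply: eq_fdet.
  rewrite big_cons -IH // -fdet_mul; apply: eq_fdet => i j.
  have -> : W (b :: s) i j = if (c i == b) || (c i \in s) then f i j else (i == j)%:R by rewrite /W inE.
  have [cib|cib] := eqVneq (c i) b; rewrite /=.
    rewrite (bigD1 j) //= big1 ?addr0.
      rewrite /W inE cib eqxx.
      have [cj|cj] := eqVneq (c i) (c j).
        by rewrite -cj cib (negbTE bs) eqxx mulr1.
      by rewrite f0 // mul0r.
    move=> k kj; rewrite /W inE cib eqxx.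
    have [ck|ck] := eqVneq (c i) (c k).
      by rewrite -ck cib (negbTE bs) (negbTE kj) mulr0.
    by rewrite f0 // mul0r.
  rewrite (bigD1 i) //= big1 ?addr0.
    by rewrite [W [:: b] i i]/W inE (negbTE cib) eqxx mul1r.
  by move=> k; rewrite eq_sym [W [:: b] i k]/W inE (negbTE cib) => /negbTE ->; rewrite mul0r.
transitivity (fdet (W (index_enum B))).
  by apply: eq_fdet => i j; rewrite /W mem_index_enum.
by rewrite WU ?index_enum_uniq //; apply: eq_bigr => b _; rewrite W1.
Qed.

Lemma fdet_scale_col (I : finType) (u : I -> S) (f : I -> I -> S) :
  fdet (fun i j => f i j * u j) = (\prod_i u i) * fdet f.
Proof.
pose U : I -> I -> S := fun k j => if k == j then u j else 0.
transitivity (fdet f * fdet U).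
  rewrite -fdet_mul; apply: eq_fdet => i j; rewrite (bigD1 j) //= big1 ?addr0.
    by rewrite /U eqxx.
  by move=> k /negbTE kj; rewrite /U kj mulr0.
rewrite mulrC; congr (_ * _).
rewrite /fdet; transitivity (\det (diag_mx (\row_(i < #|I|) u (enum_val i)))).
  congr (\det _); apply/matrixP => i j; rewrite !mxE /U (inj_eq enum_val_inj).
  by case: eqP => [->|]; rewrite ?mulr1n ?mulr0n.
rewrite det_diag (reindex _ (onW_bij _ (enum_val_bij I))) /=.
by apply: eq_bigr => i _; rewrite mxE.
Qed.

Lemma fdet_tr (I : finType) (f : I -> I -> S) : fdet (fun i j => f j i) = fdet f.
Proof.
by rewrite /fdet -det_tr; congr (\det _); apply/matrixP=> i j; rewrite !mxE.
Qed.

Lemma fdet_scale_row (I : finType) (u : I -> S) (f : I -> I -> S) :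
  fdet (fun i j => u i * f i j) = (\prod_i u i) * fdet f.
Proof.
rewrite -fdet_tr -[in RHS]fdet_tr -fdet_scale_col.
by apply: eq_fdet => i j; rewrite mulrC.
Qed.

(* Leibniz formula, as an induction principle. *)
Lemma fdet_ind (I : finType) (f : I -> I -> S) (P : S -> Prop) :
  P 0 -> (forall x y, P x -> P y -> P (x + y)) ->
  (forall s : {perm I}, forall b : bool, P ((-1) ^+ b * \prod_i f i (s i))) ->
  P (fdet f).
Proof.
move=> P0 PD Pprod; rewrite /fdet; apply: big_ind => // s _.
pose g := fun i : I => enum_val (s (enum_rank i)).
have inj_g : injective g by move=> i j /enum_val_inj /perm_inj /enum_rank_inj.
have := Pprod (perm inj_g) (odd_perm s); congr (P (_ * _)).
rewrite (reindex _ (onW_bij _ (enum_val_bij I))) /=.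
by apply: eq_bigr => i _; rewrite mxE permE /g enum_valK.
Qed.

End FinDet.

Lemma rmorph_fdet (S T : comNzRingType) (h : {rmorphism S -> T}) (I : finType)
    (f : I -> I -> S) : h (fdet f) = fdet (fun i j => h (f i j)).
Proof.
by rewrite /fdet -det_map_mx; congr (\det _); apply/matrixP=> i j; rewrite !mxE.
Qed.

Lemma fdet_unit_inverse (F : fieldType) (I : finType) (f : I -> I -> F) :
  fdet f != 0 ->
  exists g : I -> I -> F,
    (forall i j, \sum_k f i k * g k j = (i == j)%:R) /\
    (forall i j, \sum_k g i k * f k j = (i == j)%:R).
Proof.
rewrite /fdet; set A := \matrix_(_, _) _ => A0.
have uA : A \in unitmx by rewrite unitmxE unitfE.
exists (fun i j => invmx A (enum_rank i) (enum_rank j)); split=> i j.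
  have := mulmxV uA => /matrixP/(_ (enum_rank i) (enum_rank j)).
  rewrite !mxE (inj_eq enum_rank_inj) => <-.
  rewrite (reindex _ (onW_bij _ (enum_val_bij I))) /=.
  by apply: eq_bigr => k _; rewrite enum_valK mxE !enum_rankK.
have := mulVmx uA => /matrixP/(_ (enum_rank i) (enum_rank j)).
rewrite !mxE (inj_eq enum_rank_inj) => <-.
rewrite (reindex _ (onW_bij _ (enum_val_bij I))) /=.
by apply: eq_bigr => k _; rewrite enum_valK mxE !enum_rankK.
Qed.

Lemma fdet_inverse (S : comNzRingType) (I : finType) (f g : I -> I -> S) :
  (forall i j, \sum_k f i k * g k j = (i == j)%:R) -> fdet f * fdet g = 1.
Proof.
by move=> fg; rewrite -fdet_mul -[RHS](fdet_delta S I); apply: eq_fdet => i j.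
Qed.

(** * Factoriality of polynomial rings and the Nullstellensatz for a hypersurface *)

Definition divides (R : comUnitRingType) (a b : R) : Prop := exists c, b = a * c.

Definition irreducible_elt (R : comUnitRingType) (p : R) : Prop :=
  p \isn't a GRing.unit /\
  forall a b, p = a * b -> a \is a GRing.unit \/ b \is a GRing.unit.

Definition prime_elt (R : comUnitRingType) (p : R) : Prop :=
  forall a b, divides p (a * b) -> divides p a \/ divides p b.

Definition atomic (R : comUnitRingType) : Prop :=
  forall c : R, c != 0 -> exists u s,
    [/\ u \is a GRing.unit, forall p, p \in s -> irreducible_elt p
      & c = u * \prod_(p <- s) p].

Definition factorial (R : comUnitRingType) : Prop :=
  atomic R /\ forall p : R, irreducible_elt p -> prime_elt p.

Section GaussLemma.
Variable R : idomainType.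
Hypothesis UFD : factorial R.
Implicit Types f g q w : {poly R}.

Lemma dividesPC (a : R) f : (forall i, divides a f`_i) -> divides a%:P f.
Proof.
move=> /choice[c Hc]; exists (\poly_(i < size f) c i); apply/polyP => i.
rewrite coefCM coef_poly; case: ltnP => Hi; first exact: Hc.
by rewrite mulr0 nth_default.
Qed.

Lemma divides0 (a : R) : divides a 0.
Proof. by exists 0; rewrite mulr0. Qed.

Lemma dividesD (S : comUnitRingType) (a b c : S) : divides a b -> divides a c -> divides a (b + c).
Proof. by move=> [x ->] [y ->]; exists (x + y); rewrite mulrDr. Qed.

Lemma dividesM (S : comUnitRingType) (a b c : S) : divides a b -> divides a (b * c).
Proof. by move=> [x ->]; exists (x * c); rewrite mulrA. Qed.

Lemma divides_sum (I : Type) (r : seq I) (P : pred I) (F : I -> R) a :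
  (forall i, P i -> divides a (F i)) -> divides a (\sum_(i <- r | P i) F i).
Proof. by move=> H; apply: big_ind => //; [exact: divides0 | exact: dividesD]. Qed.

Lemma min_nondivisible a f : ~ divides a%:P f ->
  exists i, ~ divides a f`_i /\ forall j, (j < i)%N -> divides a f`_j.
Proof.
move=> H; have [i Hi] : exists i, ~ divides a f`_i.
  by apply/existsNP => H'; apply: H; apply: dividesPC.
have ex : exists i, `[< ~ divides a f`_i >] by exists i; apply/asboolP.
have [m /asboolP Pm Hmin] := ex_minnP ex.
exists m; split=> // j jm; apply: contrapT => /asboolP /Hmin.
by rewrite leqNgt jm.
Qed.

(** Gauss: if [i] and [j] are the first indices at which [a] fails to divide a coefficient of [f]
    and of [g], the coefficient [i + j] of the product is f_i g_j modulo [a]. *)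
Lemma prime_polyC (a : R) : prime_elt a -> prime_elt a%:P.
Proof.
move=> pa f g afg; apply: contrapT => /not_orP[Hf Hg].
have [i [Hi mini]] := min_nondivisible Hf.
have [j [Hj minj]] := min_nondivisible Hg.
suff : divides a (f`_i * g`_j) by move=> /pa[].
have [h Eh] := afg.
have Ec : (f * g)`_(i + j) = a * h`_(i + j) by rewrite Eh coefCM.
rewrite coefM (bigD1 (Ordinal (leq_addr j i : i < (i + j).+1)%N)) //= addKn in Ec.
have -> : f`_i * g`_j = a * h`_(i + j) - \sum_(k < (i + j).+1 | k != Ordinal (leq_addr j i : i < (i + j).+1)%N) f`_k * g`_(i + j - k).
  by rewrite -Ec addrK.
apply: dividesD; first by exists h`_(i + j).
rewrite -sumrN; apply: divides_sum => k; rewrite -val_eqE /= neq_ltn => /orP[ki|ik].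
  by rewrite -mulrN; apply: dividesM; apply: mini.
rewrite -mulNr mulrC; apply: dividesM; apply: minj.
by have := ltn_ord k; lia.
Qed.

(** The prime factors of [c] are removed one at a time, each dividing [q] or [w] by [prime_polyC].
    This stands in for clearing denominators in the fraction field. *)
Lemma strip_constant (c : R) f q w : c != 0 -> c%:P * f = q * w ->
  exists c1 c2 q' w', [/\ c = c1 * c2, q = c1%:P * q', w = c2%:P * w' & f = q' * w'].
Proof.
move=> /(proj1 UFD)[u [s [uu irr_s ->]]].
elim: s => [|p s IH] in f q w irr_s *.
  rewrite big_nil mulr1 => E; exists u, 1, (u^-1%:P * q), w.
  rewrite mulr1 mul1r; split=> //; first by rewrite mulrA -polyCM mulrV // mul1r.
  by rewrite -mulrA -E mulrA -polyCM mulVr // mul1r.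
have irrp := irr_s p (mem_head p s).
have p0 : p%:P != 0 :> {poly R}.
  rewrite polyC_eq0; apply/eqP => p0; have [+ /(_ 0 0)] := irrp.
  by rewrite p0 mulr0 => /negP H /(_ erefl)[].
have irr_s' : forall p', p' \in s -> irreducible_elt p'.
  by move=> p' p's; apply: irr_s; rewrite inE p's orbT.
rewrite big_cons mulrCA polyCM -mulrA => E.
have : divides p%:P (q * w) by rewrite -E; exists ((u * \prod_(j <- s) j)%:P * f).
case/(prime_polyC (proj2 UFD p irrp)) => -[h Eh].
  have /(IH _ _ _ irr_s')[c1 [c2 [q' [w' [E1 E2 E3 E4]]]]] :
      (u * \prod_(p <- s) p)%:P * f = h * w.
    by apply: (mulfI p0); rewrite E Eh mulrA.
  exists (p * c1), c2, q', w'; split=> //; first by rewrite E1 mulrA.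
  by rewrite Eh E2 polyCM mulrA.
have /(IH _ _ _ irr_s')[c1 [c2 [q' [w' [E1 E2 E3 E4]]]]] :
    (u * \prod_(p <- s) p)%:P * f = q * h.
  by apply: (mulfI p0); rewrite E Eh mulrCA.
exists c1, (p * c2), q', w'; split=> //; first by rewrite E1 mulrCA.
by rewrite Eh E3 polyCM mulrA.
Qed.

Lemma polyC_unit (a : R) : (a%:P \is a GRing.unit) = (a \is a GRing.unit).
Proof. by rewrite poly_unitE size_polyC coefC eqxx; case: (eqVneq a 0) => [->|]; rewrite ?unitr0. Qed.

Lemma irreducible_polyC (a : R) : irreducible_elt a%:P -> irreducible_elt a.
Proof.
move=> [ua irr]; split; first by rewrite -polyC_unit.
by move=> x y E; rewrite -!polyC_unit; apply: irr; rewrite -polyCM -E.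
Qed.

(** The constants stripped from [f] are units, because an irreducible polynomial of positive degree
    has no other constant factor. *)
Lemma strip_divides (c : R) f g t : irreducible_elt f -> (1 < size f)%N ->
  c != 0 -> c%:P * g = f * t -> divides f g.
Proof.
move=> [_ irr_f] sf c0 /(strip_constant c0)[d1 [d2 [f' [t' [E1 E2 E3 ->]]]]].
have [] := irr_f _ _ E2; last first.
  rewrite poly_unitE => /andP[/eqP sf' _]; move: sf; rewrite E2 mul_polyC.
  by rewrite ltnNge (leq_trans (size_scale_leq _ _)) ?sf'.
rewrite polyC_unit => ud; exists (d1^-1%:P * t').
by rewrite E2 mulrACA -polyCM mulrV // mul1r.
Qed.

(** Take [w] of least degree in the ideal of [f] and [g]: by pseudo-division it divides constant
    multiples of both. If the factor that it shares with [f] were not a unit, it would be associated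
    to [f], and [f] would divide [g]; so [w] is the constant sought. *)
Lemma bezout_constant f g : irreducible_elt f -> (1 < size f)%N -> ~ divides f g ->
  exists c u v, c != 0 /\ c%:P = u * f + v * g.
Proof.
move=> irrf sf fg.
pose I w := exists u v, w = u * f + v * g.
have f0 : f != 0 by rewrite -size_poly_gt0 (ltn_trans _ sf).
have ex : exists n, `[< exists w, [/\ I w, w != 0 & size w = n] >].
  exists (size f); apply/asboolP; exists f; split=> //.
  by exists 1, 0; rewrite mul1r mul0r addr0.
have [m /asboolP[w [[u [v Ew]] w0 sw]] Hmin] := ex_minnP ex.
have rem0 h : I h -> modp h w = 0.
  move=> [u' [v' Eh]]; apply/eqP; apply: contraT => r0.
  have /Hmin : `[< exists w', [/\ I w', w' != 0 & size w' = size (modp h w)] >].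
    apply/asboolP; exists (modp h w); split=> //.
    have := Pdiv.Idomain.divp_eq h w => /(canLR (addKr _)) <-.
    set l := lead_coef w ^+ _; set q := divp h w.
    exists (l%:P * u' - q * u), (l%:P * v' - q * v).
    by rewrite -mul_polyC Eh Ew; ring.
  by rewrite -sw leqNgt ltn_modpN0.
have divI h : I h -> exists c q, c != 0 /\ c%:P * h = q * w.
  move=> /rem0 r0; have := Pdiv.Idomain.divp_eq h w; rewrite r0 addr0 -mul_polyC => E.
  exists (lead_coef w ^+ scalp h w), (divp h w).
  by split=> //; apply: Pdiv.WeakIdomain.lc_expn_scalp_neq0.
have [|c [q [c0 Eq]]] := divI f; first by exists 1, 0; rewrite mul1r mul0r addr0.
have [c1 [c2 [q' [w' [E1 E2 E3 E4]]]]] := strip_constant c0 Eq.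
have [uq|uw] := irrf.2 _ _ E4; last first.
  have Ew' : w = (c2 * w'`_0)%:P.
    move: uw; rewrite poly_unitE => /andP[/eqP/eq_leq/size1_polyC Ew' _].
    by rewrite E3 {1}Ew' polyCM.
  exists (c2 * w'`_0), u, v; split; last by rewrite -Ew' Ew.
  by rewrite -polyC_eq0 -Ew'.
have [|c' [q'' [c'0 Eq']]] := divI g; first by exists 0, 1; rewrite mul1r mul0r add0r.
case: fg; apply: (@strip_divides c' f g (q'' * c2%:P * q'^-1)) => //.
rewrite Eq' E3 E4 -[LHS]mul1r -(mulrV uq); move: q'^-1 => z; ring.
Qed.

Lemma irreducible_prime_poly f : irreducible_elt f -> prime_elt f.
Proof.
move=> irrf g h [t Et].
have [sf|sf] := ltnP 1 (size f); last first.
  have Ef := size1_polyC sf.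
  have irrc : irreducible_elt f`_0 by apply: irreducible_polyC; rewrite -Ef.
  by rewrite Ef; apply: (prime_polyC (proj2 UFD _ irrc)); exists t; rewrite -Ef.
apply: contrapT => /not_orP[Hg Hh]; apply: Hh.
have [c [u [v [c0 E]]]] := bezout_constant irrf sf Hg.
apply: (@strip_divides c f h (u * h + v * t)) => //.
by rewrite E mulrDl mulrDr -[v * g * h]mulrA Et; ring.
Qed.

End GaussLemma.

Section MPolyFactorial.
Variable K : fieldType.

Lemma eq_rmorph_mpoly (S : comNzRingType) n (A : comNzRingType) (f g : {rmorphism {mpoly A[n]} -> S}) :
  (forall c, f (mpolyC n c) = g (mpolyC n c)) -> (forall i, f (mpolyX A (mnm1 i)) = g (mpolyX A (mnm1 i))) ->
  f =1 g.
Proof.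
move=> fgC fgX p; elim/mpolyind: p => [|c m p _ _ IH]; first by rewrite !rmorph0.
rewrite !rmorphD IH; congr (_ + _); rewrite -mul_mpolyC !rmorphM fgC; congr (_ * _).
rewrite mpolyXE_id !rmorph_prod; apply: eq_bigr => i _.
by rewrite !rmorphXn fgX.
Qed.

Lemma muni_widen n (i : 'I_n) :
  muni (mpolyX K (mnm1 (widen_ord (leqnSn n) i))) = (mpolyX K (mnm1 i))%:P.
Proof.
rewrite muniE msuppX big_seq1 mcoeffX eqxx scale1r mnmE -val_eqE /= ltn_eqF ?ltn_ord //.
rewrite expr0 alg_polyC; congr (mpolyX _ _)%:P.
by apply/mnmP=> j; rewrite !mnmE -!val_eqE.
Qed.

Lemma muni_max n : muni (mpolyX K (mnm1 (@ord_max n))) = 'X.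
Proof.
rewrite muniE msuppX big_seq1 mcoeffX eqxx scale1r mnmE eqxx expr1.
rewrite [X in mpolyX _ X](_ : _ = @mnm0 n) ?mpolyX0 ?scale1r //.
apply/mnmP=> j; rewrite !mnmE -val_eqE /=.
by rewrite gtn_eqF ?ltn_ord.
Qed.

(** Inverse of [muni]. Polynomials in n+1 variables become polynomials in the last variable over
    those in n variables, the form in which the one-variable Gauss lemma applies. *)
Definition mback n (p : {poly {mpoly K[n]}}) : {mpoly K[n.+1]} :=
  (map_poly (@mwiden n K) p).[mpolyX K (mnm1 ord_max)].

Lemma mback_is_additive n : additive (@mback n).
Proof. by move=> p q; rewrite /mback rmorphB hornerD hornerN. Qed.
Lemma mback_is_multiplicative n : multiplicative (@mback n).
Proof.
split=> [p q|]; first by rewrite /mback rmorphM hornerM.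
by rewrite /mback rmorph1 hornerC.
Qed.
HB.instance Definition _ n := GRing.isAdditive.Build _ _ (@mback n) (@mback_is_additive n).
HB.instance Definition _ n := GRing.isMultiplicative.Build _ _ (@mback n) (@mback_is_multiplicative n).

Lemma muniK n : cancel (@muni n K) (@mback n).
Proof.
apply: (@eq_rmorph_mpoly _ _ _ (@mback n \o @muni n K) idfun) => [c|i] /=.
  by rewrite muniC /mback map_polyC hornerC /= mwidenC.
have [j ->|->] := unliftP ord_max i; last by rewrite muni_max /mback map_polyX hornerX.
have -> : lift ord_max j = widen_ord (leqnSn n) j by apply: val_inj; rewrite /= /bump leqNgt ltn_ord.
by rewrite muni_widen /mback map_polyC hornerC /= mwidenX mnmwiden1.
Qed.

Lemma mbackK n : cancel (@mback n) (@muni n K).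
Proof.
move=> p; elim/poly_ind: p => [|p c IH]; first by rewrite /mback rmorph0 horner0 muni0.
rewrite /mback rmorphD rmorphM /= map_polyX map_polyC hornerMXaddC.
rewrite rmorphD rmorphM /= -/(mback p) IH muni_max; congr (_ + _).
elim/mpolyind: c => [|a m c _ _ IHc]; first by rewrite mwiden0 muni0.
rewrite !rmorphD /= IHc; congr (_ + _).
rewrite -mul_mpolyC !rmorphM /= mwidenC muniC; congr (_ * _).
rewrite mpolyXE_id !rmorph_prod; apply: eq_bigr => i _.
by rewrite !rmorphXn /= mwidenX mnmwiden1 muni_widen.
Qed.

Lemma mpoly_unitE n (p : {mpoly K[n]}) : (p \is a GRing.unit) = (mmeasure mdeg p == 1)%N.
Proof.
apply/idP/idP => [/andP[/eqP Ep up]|/msize_poly1P[c c0 ->]].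
  by rewrite Ep; apply/msize_poly1P; exists (mcoeff (@mnm0 n) p) => //; rewrite -unitfE.
by apply/andP; rewrite mcoeffC eqxx mulr1 eqxx unitfE c0.
Qed.

Lemma atomic_mpoly n : atomic {mpoly K[n]}.
Proof.
move=> c; have [m] := ubnP (mmeasure mdeg c); elim: m c => // m IH c sc c0.
have [uc|nuc] := boolP (c \is a GRing.unit).
  by exists c, [::]; rewrite big_nil mulr1.
have [irr|red] := pselect (irreducible_elt c).
  exists 1, [:: c]; rewrite unitr1 big_seq1 mul1r; split=> //.
  by move=> p; rewrite inE => /eqP ->.
have [a [b [Eab na nb]]] : exists a b, [/\ c = a * b, a \isn't a GRing.unit & b \isn't a GRing.unit].
  apply: contrapT => H; apply: red; split=> // a b Eab.
  apply: contrapT => /not_orP[/negP na /negP nb].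
  by apply: H; exists a, b.
have a0 : a != 0 by apply: contraNneq c0 => a0; rewrite Eab a0 mul0r.
have b0 : b != 0 by apply: contraNneq c0 => b0; rewrite Eab b0 mulr0.
have := msizeM a0 b0; rewrite -Eab => Ec.
have sa : (1 < mmeasure mdeg a)%N.
  by rewrite ltn_neqAle eq_sym -mpoly_unitE na lt0n mmeasure_poly_eq0.
have sb : (1 < mmeasure mdeg b)%N.
  by rewrite ltn_neqAle eq_sym -mpoly_unitE nb lt0n mmeasure_poly_eq0.
rewrite Eab; have [|ua [la [uua irra ->]]] := IH a _ a0; first by move: sc sa sb; rewrite Ec; lia.
have [|ub [lb [uub irrb ->]]] := IH b _ b0; first by move: sc sa sb; rewrite Ec; lia.
exists (ua * ub), (la ++ lb); split.
- by rewrite unitrM uua.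
- by move=> p; rewrite mem_cat => /orP[/irra|/irrb].
- by rewrite big_cat mulrACA.
Qed.

Lemma muni_unit n (p : {mpoly K[n.+1]}) : (muni p \is a GRing.unit) = (p \is a GRing.unit).
Proof.
apply/idP/idP => /unitrP[q [_ E]]; last by apply/unitrPr; exists (muni q); rewrite -muniM E muni1.
apply/unitrPr; exists (mback q).
by rewrite -[LHS]muniK muniM mbackK E rmorph1.
Qed.

Lemma muni_irreducible n (p : {mpoly K[n.+1]}) :
  irreducible_elt p -> irreducible_elt (muni p).
Proof.
move=> [up irr]; split; first by rewrite muni_unit.
move=> a b E; have := irr (mback a) (mback b).
by rewrite -!muni_unit !mbackK; apply; rewrite -[LHS]muniK E rmorphM.
Qed.

Lemma muni_divides n (p q : {mpoly K[n.+1]}) : divides (muni p) (muni q) <-> divides p q.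
Proof.
split=> [[c E]|[c ->]]; last by exists (muni c); rewrite muniM.
by exists (mback c); rewrite -[q]muniK E rmorphM /= muniK.
Qed.

Lemma irreducible_neq0 (R : comUnitRingType) (p : R) : irreducible_elt p -> p != 0.
Proof.
move=> [np irr]; apply: contraNneq np => p0.
by have [|//|//] := irr 0 0; rewrite p0 ?mulr0.
Qed.

Lemma nvar0_irreducible (p : {mpoly K[0]}) : ~ irreducible_elt p.
Proof.
move=> irr; have p0 := irreducible_neq0 irr; have [/negP[]] := irr.
rewrite mpoly_unitE; apply/msize_poly1P; exists (mcoeff (@mnm0 0) p); last exact: nvar0_mpolyC.
by rewrite -(mpolyC_eq0 0) -nvar0_mpolyC.
Qed.

Theorem factorial_mpoly n : factorial {mpoly K[n]}.
Proof.
split; first exact: atomic_mpoly.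
elim: n => [|n IH] p irrp.
  by have := nvar0_irreducible irrp.
move=> a b; rewrite -!muni_divides muniM.
apply: irreducible_prime_poly; last exact: muni_irreducible.
by split=> //; apply: atomic_mpoly.
Qed.

Lemma meval_muni n (x : 'I_n.+1 -> K) (p : {mpoly K[n.+1]}) :
  meval x p = (map_poly (meval (x \o widen_ord (leqnSn n))) (muni p)).[x ord_max].
Proof.
pose x' := x \o widen_ord (leqnSn n).
apply: (@eq_rmorph_mpoly _ _ _ (meval x)
  (horner_eval (x ord_max) \o map_poly (meval x') \o @muni n K)) => [c|i] /=.
  by rewrite muniC map_polyC /horner_eval hornerC /= !mevalC.
have [j ->|->] := unliftP ord_max i; last first.
  by rewrite muni_max map_polyX /horner_eval hornerX mevalXU.
have -> : lift ord_max j = widen_ord (leqnSn n) j by apply: val_inj; rewrite /= /bump leqNgt ltn_ord.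
by rewrite muni_widen map_polyC /horner_eval hornerC /= !mevalXU.
Qed.

End MPolyFactorial.

Section Hypersurface.
Variable K : numClosedFieldType.

Lemma poly_nonroot (p : {poly K}) (s : seq K) : p != 0 -> exists2 a, p.[a] != 0 & a \notin s.
Proof.
move=> p0; pose q := p * \prod_(c <- s) ('X - c%:P).
have q0 : q != 0 by rewrite mulf_neq0 // monic_neq0 // monic_prod_XsubC.
have : ~~ all (root q) [seq (i%:R : K) | i <- iota 0 (size q)].
  apply/negP => H; have := max_poly_roots q0 H.
  rewrite map_inj_uniq ?iota_uniq; last exact: mulrIn (oner_neq0 K).
  by rewrite size_map size_iota ltnn => /(_ isT).
case/allPn => a _; rewrite rootE hornerM mulf_eq0 negb_or => /andP[pa sa].
exists a => //; apply: contraNN sa => /(nthP 0)[i si <-]; rewrite horner_prod.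
by rewrite -[X in _ == X](mulr0 1); apply/eqP; rewrite (big_nth 0) big_mkord (bigD1 (Ordinal si)) //= hornerXsubC subrr mul0r mulr0.
Qed.

Definition extend_pt n (x : 'I_n -> K) (a : K) (i : 'I_n.+1) : K :=
  if unlift ord_max i is Some j then x j else a.

Lemma meval_extend n (x : 'I_n -> K) a (p : {mpoly K[n.+1]}) :
  meval (extend_pt x a) p = (map_poly (meval x) (muni p)).[a].
Proof.
rewrite meval_muni /extend_pt unlift_none; congr (_.[_]).
apply: eq_map_poly => q; apply: meval_eq => j /=.
have -> : widen_ord (leqnSn n) j = lift ord_max j by apply: val_inj; rewrite /= /bump leqNgt ltn_ord.
by rewrite liftK.
Qed.

Lemma mpoly_nonroot n (p : {mpoly K[n]}) : p != 0 -> exists x, meval x p != 0.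
Proof.
elim: n p => [|n IH] p p0.
  exists (fun=> 0); rewrite (nvar0_mpolyC p) mevalC -(mpolyC_eq0 0).
  by rewrite -(nvar0_mpolyC p).
have : lead_coef (muni p) != 0.
  by rewrite lead_coef_eq0; apply: contraNneq p0 => E; rewrite -[p]muniK E raddf0.
case/IH=> x Hx; have [|a Ha _] := @poly_nonroot (map_poly (meval x) (muni p)) [::].
  apply: contraNneq Hx => /polyP/(_ (size (muni p)).-1).
  by rewrite coef_map coef0 => <-.
by exists (extend_pt x a); rewrite meval_extend.
Qed.

Lemma rmorph_bezout (A : comNzRingType) (S : comNzRingType) (h : {rmorphism A -> S}) c u f v g :
  c = u * f + v * g -> h f = 0 -> h g = 0 -> h c = 0.
Proof. by move=> -> hf hg; rewrite rmorphD !rmorphM hf hg !mulr0 addr0. Qed.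

(** When [f] involves the last variable, [bezout_constant] gives [c] free of it with c = u f + v g.
    At a point where [c] and the leading coefficient of [f] do not vanish, a root of [f] in the last
    variable is not a root of [g]. Otherwise [f] fails to divide some coefficient of [g], and
    induction applies to that coefficient. *)
Lemma hypersurface_point n (f g : {mpoly K[n]}) :
  irreducible_elt f -> ~ divides f g -> exists x, meval x f = 0 /\ meval x g != 0.
Proof.
elim: n f g => [|n IH] f g irrf fg.
  by have := nvar0_irreducible irrf.
have irrF := muni_irreducible irrf.
have FG : ~ divides (muni f) (muni g) by rewrite muni_divides.
have [sF|sF] := ltnP 1 (size (muni f)); last first.
  have Ef := size1_polyC sF.
  have irrc : irreducible_elt (muni f)`_0 by apply: irreducible_polyC; rewrite -Ef.
  have [i [Hi _]] : exists i, ~ divides (muni f)`_0 (muni g)`_i /\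
      forall j, (j < i)%N -> divides (muni f)`_0 (muni g)`_j.
    by apply: min_nondivisible; rewrite -Ef.
  have [x [fx gx]] := IH _ _ irrc Hi.
  have [|a Ha _] := @poly_nonroot (map_poly (meval x) (muni g)) [::].
    by apply: contraNneq gx => /polyP/(_ i); rewrite coef_map coef0 => <-.
  exists (extend_pt x a); rewrite !meval_extend; split=> //.
  by rewrite Ef map_polyC hornerC.
have [c [u [v [c0 E]]]] := bezout_constant (factorial_mpoly K n) irrF sF FG.
have : c * lead_coef (muni f) != 0.
  by rewrite mulf_neq0 // lead_coef_eq0 -size_poly_gt0 (ltn_trans _ sF).
case/mpoly_nonroot => x; rewrite mevalM mulf_eq0 negb_or => /andP[cx lx].
have [|a] := @closed_rootP K (map_poly (meval x) (muni f)) _.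
  by rewrite size_map_poly_id0 // gtn_eqF.
move=> /rootP fa; exists (extend_pt x a); rewrite !meval_extend; split=> //.
apply: contraNneq cx => ga; apply/eqP; rewrite -[LHS](hornerC _ a) -(map_polyC (meval x)) /=.
exact: (@rmorph_bezout _ _ (horner_eval a \o map_poly (meval x)) _ _ _ _ _ E fa ga).
Qed.

End Hypersurface.

(** * The basis F^a z^b and its determinant *)

Section MonomialDivision.
Variable N : nat.
Implicit Types (g a b : multinom N) (d : nat).

Definition mkmnm (f : 'I_N -> nat) : multinom N := Multinom [tuple f i | i < N].

Lemma mkmnmE f i : mkmnm f i = f i.
Proof. exact: mnmE. Qed.

Definition mdivn g d := mkmnm (fun i => g i %/ d)%N.
Definition mmodn g d := mkmnm (fun i => g i %% d)%N.

Lemma mdivn_eq g d : g = mnm_add (mnm_muln (mdivn g d) d) (mmodn g d).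
Proof. by apply/mnmP=> i; rewrite mnmDE mulmnE !mkmnmE -divn_eq. Qed.

Lemma mdeg_divn g d : mdeg g = (mdeg (mdivn g d) * d + mdeg (mmodn g d))%N.
Proof. by rewrite {1}(mdivn_eq g d) mdegD mdegMn. Qed.

Lemma mdeg_modn_le g d : (0 < d)%N -> (mdeg (mmodn g d) <= N * d.-1)%N.
Proof.
move=> d0; rewrite mdegE -[X in (X * _)%N]card_ord -sum_nat_const.
by apply: leq_sum => i _; rewrite mkmnmE -ltnS prednK // ltn_mod.
Qed.

Lemma mdivn_add a b d : (forall i, b i < d)%N -> mdivn (mnm_add (mnm_muln a d) b) d = a.
Proof.
move=> bd; apply/mnmP=> i; rewrite mkmnmE mnmDE mulmnE divnMDl ?divn_small ?addn0 //.
by apply: leq_ltn_trans (bd i).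
Qed.

Lemma mmodn_add a b d : (forall i, b i < d)%N -> mmodn (mnm_add (mnm_muln a d) b) d = b.
Proof. by move=> bd; apply/mnmP=> i; rewrite mkmnmE mnmDE mulmnE modnMDl modn_small. Qed.

End MonomialDivision.

(** One induction serves every grading used below: homogeneity, vanishing order, degree in the
    coefficients and degree in a parameter are all additive on products. *)
Lemma mmap1_graded (A : comNzRingType) (P : nat -> A -> Prop) N (F : 'I_N -> A)
    (c : nat) (a : multinom N) :
  P 0%N 1 -> (forall s t x y, P s x -> P t y -> P (s + t)%N (x * y)) ->
  (forall i, P c (F i)) -> P (mdeg a * c)%N (mmap1 F a).
Proof.
move=> P1 PM PF; rewrite /mmap1 mdegE big_distrl /=.
apply: (big_ind2 (fun t x => P t x)) => //; first by move=> s t x y; apply: PM.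
move=> i _; elim: (a i) => [|k IH]; first by rewrite expr0.
by rewrite exprS mulSn; apply: PM.
Qed.

Section Composition.
Variables (S : comNzRingType) (N : nat).
Implicit Types (F : 'I_N -> {mpoly S[N]}) (p q : {mpoly S[N]}).

Definition mcomp F p : {mpoly S[N]} := mmap (@mpolyC N S) F p.

HB.instance Definition _ F := GRing.isAdditive.Build _ _ (mcomp F) (@mmap_is_additive _ _ _ _ _).
HB.instance Definition _ F := GRing.isMultiplicative.Build _ _ (mcomp F) (@mmap_is_multiplicative _ _ _ _ _).

Lemma mcompC F c : mcomp F (mpolyC N c) = mpolyC N c.
Proof. exact: mmapC. Qed.

Lemma mcompX F m : mcomp F (mpolyX S m) = mmap1 F m.
Proof. exact: mmapX. Qed.

Lemma mcompZ F c p : mcomp F (c *: p) = c *: mcomp F p.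
Proof. by rewrite /mcomp mmapZ mul_mpolyC. Qed.

Lemma meval_mcomp (x : 'I_N -> S) F p : meval x (mcomp F p) = meval (fun i => meval x (F i)) p.
Proof.
apply: (@eq_rmorph_mpoly _ _ _ (meval x \o mcomp F) (meval (fun i => meval x (F i)))) => [c|i] /=.
  by rewrite mcompC !mevalC.
by rewrite mcompX mmap1U mevalXU.
Qed.

Lemma mcomp_comp F G p : mcomp F (mcomp G p) = mcomp (fun i => mcomp F (G i)) p.
Proof.
apply: (@eq_rmorph_mpoly _ _ _ (mcomp F \o mcomp G) (mcomp (fun i => mcomp F (G i)))) => [c|i] /=.
  by rewrite !mcompC.
by rewrite !mcompX !mmap1U.
Qed.

Lemma mcomp_id p : mcomp (fun i => mpolyX S (mnm1 i)) p = p.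
Proof.
apply: (@eq_rmorph_mpoly _ _ _ (mcomp (fun i => mpolyX S (mnm1 i))) idfun) => [c|i] /=.
  by rewrite mcompC.
by rewrite mcompX mmap1U.
Qed.

Lemma eq_mcomp F G p : F =1 G -> mcomp F p = mcomp G p.
Proof. by move=> FG; apply: eq_bigr => m _; congr (_ * _); apply: mmap1_eq. Qed.

Definition deg_le (t : nat) p : Prop := forall m, (t < mdeg m)%N -> mcoeff m p = 0.
Definition homog (t : nat) p : Prop := forall m, mdeg m != t -> mcoeff m p = 0.

Lemma homogP t p : reflect (homog t p) (p \is ishomog1 t mdeg).
Proof.
apply: (iffP (dhomogP _ _ _)) => [H m mt|H m].
  by apply: memN_msupp_eq0; apply: contra mt => /H ->.
by rewrite mcoeff_msupp => pm; apply/eqP; apply: contraNT pm => /H ->.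
Qed.

Lemma homog_deg_le t p : homog t p -> deg_le t p.
Proof. by move=> H m tm; apply: H; rewrite gtn_eqF. Qed.

Lemma homog_mul s t p q : homog s p -> homog t q -> homog (s + t) (p * q).
Proof. by move=> /homogP Hp /homogP Hq; apply/homogP; apply: dhomogM. Qed.

Lemma homog1 : homog 0 1.
Proof. by apply/homogP; apply: dhomog1. Qed.

Lemma homogX m : homog (mdeg m) (mpolyX S m).
Proof. by apply/homogP; rewrite dhomogX. Qed.

Lemma deg_leP t p : deg_le t p <-> (mmeasure mdeg p <= t.+1)%N.
Proof.
split=> [H|H m tm]; last first.
  by apply: memN_msupp_eq0; apply: msize_mdeg_ge (leq_trans H tm).
rewrite mmeasureE; apply/bigmax_leqP_seq => m; rewrite mcoeff_msupp => pm _.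
by rewrite ltnS leqNgt; apply: contra pm => /H ->.
Qed.

Lemma mcoeffM_eq0 p q m :
  (forall k1 k2, m = mnm_add k1 k2 -> mcoeff k1 p * mcoeff k2 q = 0) -> mcoeff m (p * q) = 0.
Proof. by move=> H; rewrite mcoeffM big1 // => k /eqP /H. Qed.

Lemma deg_le_mul s t p q : deg_le s p -> deg_le t q -> deg_le (s + t) (p * q).
Proof.
move=> Hp Hq m; move=> stm; apply: mcoeffM_eq0 => k1 k2 E.
have [sk|sk] := ltnP s (mdeg k1); first by rewrite Hp ?mul0r.
rewrite Hq ?mulr0 //; move: stm; rewrite E mdegD; lia.
Qed.

Lemma deg_leD t p q : deg_le t p -> deg_le t q -> deg_le t (p + q).
Proof. by move=> Hp Hq m tm; rewrite mcoeffD Hp ?Hq ?addr0. Qed.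

Lemma deg_le_weaken s t p : (s <= t)%N -> deg_le s p -> deg_le t p.
Proof. by move=> st H m tm; apply: H; apply: leq_ltn_trans tm. Qed.

Lemma deg_le_expand t p : deg_le t p ->
  p = \sum_(m : bmultinom N t.+1) mcoeff (bmnm m) p *: mpolyX S (bmnm m).
Proof. by move=> /deg_leP /mpolywE. Qed.

Variable d : nat.

(* The family F^(g div d) z^(g mod d); for F = (z_i^d) it consists of the monomials. *)
Definition bfam F (g : multinom N) : {mpoly S[N]} :=
  mmap1 F (mdivn g d) * mpolyX S (mmodn g d).

Lemma bfam_homog F g : (forall i, homog d (F i)) -> homog (mdeg g) (bfam F g).
Proof.
move=> HF; rewrite (mdeg_divn g d); apply: homog_mul; last exact: homogX.
by apply: (@mmap1_graded _ homog) => //; [exact: homog1 | exact: homog_mul].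
Qed.

Lemma bfam_power g : bfam (fun i => mpolyX S (mnm1 i) ^+ d) g = mpolyX S g.
Proof.
rewrite [in RHS](mdivn_eq g d) mpolyXD /bfam; congr (_ * _).
rewrite -mpolyXn mpolyXE_id -prodrXl /mmap1; apply: eq_bigr => i _.
by rewrite -!exprM mulnC.
Qed.

(** The bound of [bmultinom] is strict: [m.+1] selects the degrees at most [m], for the family as
    for the monomials. *)
Definition famdet (m : nat) (b : multinom N -> {mpoly S[N]}) : S :=
  fdet (fun g g' : bmultinom N m.+1 => mcoeff (bmnm g') (b (bmnm g))).

Lemma famdet_X m : famdet m (mpolyX S) = 1.
Proof.
rewrite -[RHS](fdet_delta S (bmultinom N m.+1)); apply: eq_fdet => g g'.
by rewrite mcoeffX -bmeqP.
Qed.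

Lemma eq_famdet m b b' : b =1 b' -> famdet m b = famdet m b'.
Proof. by move=> bb; apply: eq_fdet => g g'; rewrite bb. Qed.

Lemma famdet_change m b (f : {mpoly S[N]} -> {mpoly S[N]}) :
  (forall g, (mdeg g <= m)%N -> deg_le m (b g)) -> (forall c p, f (c *: p) = c *: f p) ->
  additive f ->
  famdet m (f \o b) = famdet m b * famdet m (fun g => f (mpolyX S g)).
Proof.
move=> bm fZ fB; rewrite -fdet_mul; apply: eq_fdet => g g'.
have f0 : f 0 = 0 by have := fB 0 0; rewrite !subrr.
have fD p q : f (p + q) = f p + f q.
  by rewrite -[q in LHS]opprK fB -[- q]sub0r fB f0 sub0r opprK.
rewrite /= {1}(deg_le_expand (bm (bmnm g) _)); last by rewrite -ltnS bmdeg.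
rewrite (big_morph f fD f0) raddf_sum /=.
by apply: eq_bigr => k _; rewrite fZ mcoeffZ.
Qed.

End Composition.

Lemma map_mpoly_mmap1 (S T : comNzRingType) N (h : {rmorphism S -> T}) (F : 'I_N -> {mpoly S[N]}) a :
  map_mpoly h (mmap1 F a) = mmap1 (fun i => map_mpoly h (F i)) a.
Proof. by rewrite /mmap1 rmorph_prod; apply: eq_bigr => i _; rewrite rmorphXn. Qed.

Lemma map_bfam (S T : comNzRingType) N d (h : {rmorphism S -> T}) (F : 'I_N -> {mpoly S[N]}) g :
  map_mpoly h (bfam d F g) = bfam d (fun i => map_mpoly h (F i)) g.
Proof. by rewrite /bfam rmorphM /= map_mpoly_mmap1 map_mpolyX. Qed.

Lemma map_famdet (S T : comNzRingType) N m (h : {rmorphism S -> T}) (b : multinom N -> {mpoly S[N]}) :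
  h (famdet m b) = famdet m (fun g => map_mpoly h (b g)).
Proof. by rewrite rmorph_fdet; apply: eq_fdet => g g'; rewrite mcoeff_map_mpoly. Qed.

(** * The resultant divides the determinant of the basis *)

Section VanishingOrder.
Variables (K : fieldType) (N d : nat).
Hypothesis d_gt0 : (0 < d)%N.
Local Notation PS := {mpoly {poly K}[N]}.

(** Here ['X] is the parameter of a line of systems. The condition says that [p] lies in the power
    [t] of the ideal generated by ['X] and the z_j with j <> i0: it measures the order at parameter
    0 and at the basis point e_i0, where z^m already has order [mdeg m - m i0]. *)
Definition ordge (i0 : 'I_N) (t : nat) (p : PS) : Prop :=
  forall m, 'X^(t - (mdeg m - m i0)) %| mcoeff m p.

Lemma ordge0 i0 p : ordge i0 0 p.
Proof. by move=> m; rewrite sub0n expr0 dvd1p. Qed.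

Lemma mnm_le_mdeg (m : multinom N) i : (m i <= mdeg m)%N.
Proof. by rewrite mdegE (bigD1 i) //= leq_addr. Qed.

Lemma ordge_mul i0 s t p q : ordge i0 s p -> ordge i0 t q -> ordge i0 (s + t) (p * q).
Proof.
move=> Hp Hq m; rewrite mcoeffM; elim/big_ind: _ => [|x y|[[k1 ?] [k2 ?]] /= /eqP E].
- exact: dvdp0.
- exact: dvdp_add.
have D : ('X^(s + t - (mdeg m - m i0)) : {poly K}) %| 'X^(s - (mdeg k1 - k1 i0)) * 'X^(t - (mdeg k2 - k2 i0)).
  rewrite -exprD; apply: dvdp_exp2l; rewrite E mdegD mnmDE.
  have := mnm_le_mdeg k1 i0; have := mnm_le_mdeg k2 i0; lia.
by apply: dvdp_trans D _; apply: dvdp_mul.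
Qed.

(** Lower bound for the number of factors F_i in F^a z^b when |d a + b| = n, since |b| <= N
    (d-1). *)
Definition kappa n := ((n - N * d.-1) %/ d)%N.

Lemma kappa_le (g : multinom N) : (kappa (mdeg g) <= mdeg (mdivn g d))%N.
Proof.
rewrite /kappa {1}(mdeg_divn g d) -[X in (_ <= X)%N](mulnK _ d_gt0).
by apply: leq_div2r; have := mdeg_modn_le g d_gt0; lia.
Qed.

Lemma ordge_mmap1 i0 (F : 'I_N -> PS) g (r : PS) : (forall i, ordge i0 1 (F i)) ->
  ordge i0 (mdeg (mdivn g d)) (mmap1 F (mdivn g d) * r).
Proof.
move=> HF; rewrite -[X in ordge _ X]addn0; apply: ordge_mul; last exact: ordge0.
rewrite -[X in ordge _ X]muln1.
by apply: (@mmap1_graded _ (ordge i0)) => //; [exact: ordge0 | exact: ordge_mul].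
Qed.

(** The power of ['X] that an order at least [kappa] forces on the coefficient of z^g in a form of
    degree |g|. *)
Definition point_weight i0 (g : multinom N) := (kappa (mdeg g) - (mdeg g - g i0))%N.

(** By homogeneity, the nonzero entries of column g' lie in rows of degree |g'|, all of order at
    least [kappa] of that degree; so a power of ['X] comes out of each column. The factors [r g] are
    left general because a linear change of variables does not preserve the monomials z^b. *)
Lemma order_at_point m i0 (F : 'I_N -> PS) (r : multinom N -> PS) :
  (forall i, homog d (F i)) -> (forall g, homog (mdeg (mmodn g d)) (r g)) ->
  (forall i, ordge i0 1 (F i)) ->
  'X^(\sum_(g : bmultinom N m.+1) point_weight i0 (bmnm g)) %|
     famdet m (fun g => mmap1 F (mdivn g d) * r g).
Proof.
move=> hF hr oF; pose b g := mmap1 F (mdivn g d) * r g; rewrite -[fun g => _ * _]/b.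
have hb g : homog (mdeg g) (b g).
  rewrite (mdeg_divn g d); apply: homog_mul => //.
  by apply: (@mmap1_graded _ (fun t => @homog _ _ t)) => //; [exact: homog1 | exact: homog_mul].
have /choice[f Hf] : forall gg : bmultinom N m.+1 * bmultinom N m.+1, exists f,
    mcoeff (bmnm gg.2) (b (bmnm gg.1)) = f * 'X^(point_weight i0 (bmnm gg.2)).
  move=> [g g'] /=; apply/dvdpP.
  have [E|/eqP E] := eqVneq (mdeg (bmnm g')) (mdeg (bmnm g)); last first.
    by rewrite hb ?dvdp0 //; apply/eqP.
  apply: (dvdp_trans _ (@ordge_mmap1 i0 F (bmnm g) (r (bmnm g)) oF (bmnm g'))).
  by apply: dvdp_exp2l; rewrite /point_weight E; apply: leq_sub2r; apply: kappa_le.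
rewrite /famdet (_ : fdet _ = fdet (fun g g' : bmultinom N m.+1 => f (g, g') * 'X^(point_weight i0 (bmnm g')))).
  by rewrite fdet_scale_col -prodrXr dvdp_mulr.
by apply: eq_fdet => g g'; rewrite (Hf (g, g')).
Qed.

(** Here the powers of ['X] come out of the rows: F^a contains F_i0 with exponent a_i0. *)
Lemma order_zero_component m i0 (F : 'I_N -> PS) F0 : F i0 = 'X *: F0 ->
  'X^(\sum_(g : bmultinom N m.+1) (bmnm g) i0 %/ d)%N %| famdet m (bfam d F).
Proof.
move=> EF; pose F' i := if i == i0 then F0 else F i.
have EF' g : bfam d F g = 'X^(g i0 %/ d) *: bfam d F' g.
  rewrite /bfam scalerAl; congr (_ * _); rewrite /mmap1 (bigD1 i0) //= [in RHS](bigD1 i0) //=.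
  rewrite /F' eqxx EF exprZn mkmnmE scalerAl; congr (_ * _).
  by apply: eq_bigr => i /negbTE ->.
rewrite /famdet (_ : fdet _ = fdet (fun g g' : bmultinom N m.+1 =>
    'X^((bmnm g) i0 %/ d) * mcoeff (bmnm g') (bfam d F' (bmnm g)))).
  by rewrite fdet_scale_row -prodrXr dvdp_mulr.
by apply: eq_fdet => g g'; rewrite EF' mcoeffZ.
Qed.

(** This makes [vanish_order] a valid lower bound in both cases of degeneracy. *)
Lemma point_weight_le i0 g : (point_weight i0 g <= g i0 %/ d)%N.
Proof.
rewrite /point_weight /kappa leq_subLR; have gi := mnm_le_mdeg g i0.
rewrite -divnMDl //; apply: leq_div2r.
have : (mdeg g - g i0 <= (mdeg g - g i0) * d)%N by rewrite leq_pmulr.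
lia.
Qed.

(** A bound independent of the point. The shift N (d-1) + d absorbs the rounding in [kappa]: t < m -
    (N (d-1) + d) - d |e| implies |e| < kappa (m - t). *)
Definition vanish_order m := (\sum_(e : bmultinom N m.+1) (m - (N * d.-1 + d) - mdeg (bmnm e) * d))%N.

Lemma sum_nat_card (I : finType) m (f : I -> nat) : (forall i, f i <= m)%N ->
  (\sum_i f i)%N = #|finset (fun it : I * 'I_m => (it.2 < f it.1)%N)|.
Proof.
move=> fm; rewrite -sum1_card (eq_bigl (fun it : I * 'I_m => xpredT it.1 && (it.2 < f it.1)%N)); last first.
  by move=> it; rewrite inE.
rewrite -(pair_big_dep xpredT (fun i (t : 'I_m) => (t < f i)%N) (fun _ _ => 1%N)) /=.
apply: eq_bigr => i _.
by rewrite -(big_ord_widen m (fun=> 1%N) (fm i)) sum_nat_const card_ord muln1.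
Qed.

(** Both sums count pairs of an exponent and an integer, by [sum_nat_card]. The injection keeps the
    components of e other than i0, completes them at i0 to degree m - t, and records e_i0 as the
    integer; the bound on that integer then reads |e| < kappa (m - t). *)
Lemma vanish_order_le m i0 : (vanish_order m <= \sum_(g : bmultinom N m.+1) point_weight i0 (bmnm g))%N.
Proof.
pose I := bmultinom N m.+1.
have kn n : (kappa n <= n)%N by apply: leq_trans (leq_div _ _) (leq_subr _ _).
have wt (g : I) : (point_weight i0 (bmnm g) <= m.+1)%N.
  rewrite /point_weight; have := kn (mdeg (bmnm g)); have := bmdeg g; lia.
rewrite (sum_nat_card wt) /vanish_order.
pose c := (N * d.-1 + d)%N.
have fm : (forall e : I, m - c - mdeg (bmnm e) * d <= m.+1)%N.
  by move=> e; lia.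
rewrite (sum_nat_card fm).
(* (e, t) stands for the degree n = m - t, for which mdeg e < kappa n. *)
pose low (e : I) := (mdeg (bmnm e) - bmnm e i0)%N.
pose mono (e : I) (n : nat) : multinom N :=
  mkmnm (fun i => if i == i0 then n - low e else bmnm e i)%N.
have mono_deg (e : I) n : (low e <= n)%N -> mdeg (mono e n) = n.
  move=> le; rewrite mdegE (bigD1 i0) //= mkmnmE eqxx.
  rewrite (eq_bigr (fun i => bmnm e i)); last by move=> i /negbTE ni; rewrite mkmnmE ni.
  have : low e = (\sum_(i < N | i != i0) bmnm e i)%N.
    by rewrite /low mdegE (bigD1 i0) //= addKn.
  by move=> <-; rewrite subnK.
have mono_bd (e : I) (t : 'I_m.+1) : (low e <= m - t)%N -> (mdeg (mono e (m - t)) < m.+1)%N.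
  by move=> /mono_deg ->; lia.
pose phi (et : I * 'I_m.+1) : I * 'I_m.+1 :=
  (insubd et.1 (mono et.1 (m - et.2)%N), inord (bmnm et.1 i0)).
set A := finset _; set B := finset _.
have inA et : et \in A -> [/\ (low et.1 <= m - et.2)%N,
    (mdeg (bmnm et.1) < kappa (m - et.2))%N & bmnm et.1 i0 <= m]%N.
  case: et => e t; rewrite inE /= => lt_t.
  have e_k : (mdeg (bmnm e) < kappa (m - t))%N.
    rewrite /kappa leq_divRL // mulSn; move: lt_t; rewrite /c; lia.
  split=> //; first by have := kn (m - t)%N; rewrite /low; lia.
  by have := bmdeg e; have := mnm_le_mdeg (bmnm e) i0; lia.
have phi_val et : et \in A -> bmnm (phi et).1 = mono et.1 (m - et.2)%N.
  by move=> /inA[l1 _ _]; rewrite /phi /= val_insubd mono_bd.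
have phi_val2 et : et \in A -> val (phi et).2 = bmnm et.1 i0.
  by move=> /inA[_ _ l3]; rewrite /phi /= inordK.
have <- : #|phi @: A| = #|A|.
  apply: card_in_imset => et et' eA e'A E.
  have E1 : bmnm et.1 i0 = bmnm et'.1 i0 by rewrite -!phi_val2 // E.
  have E2 : mono et.1 (m - et.2)%N = mono et'.1 (m - et'.2)%N by rewrite -!phi_val // E.
  have Ee : et.1 = et'.1.
    apply: val_inj; apply/mnmP => i /=; have [->//|ni] := eqVneq i i0.
    by have := congr1 (fun g : multinom N => g i) E2; rewrite !mkmnmE (negbTE ni).
  have En : (m - et.2 = m - et'.2)%N.
    have [l1 _ _] := inA _ eA; have [l1' _ _] := inA _ e'A.
    by rewrite -(mono_deg _ _ l1) -(mono_deg _ _ l1') E2.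
  case: et et' Ee En {eA e'A E E1 E2} => [e t] [e' t'] /= -> En; congr (_, _).
  by apply: val_inj => /=; have := ltn_ord t; have := ltn_ord t'; lia.
apply: subset_leq_card; apply/fintype.subsetP => _ /imsetP[et eA ->]; rewrite inE.
rewrite phi_val2 // phi_val // /point_weight; have [l1 l2 l3] := inA _ eA.
rewrite mono_deg // mkmnmE eqxx; move: l2 l1; rewrite /low.
by have := mnm_le_mdeg (bmnm et.1) i0; have := kn (m - et.2)%N; lia.
Qed.

End VanishingOrder.

Lemma homog_mcomp (S : comNzRingType) N (t c : nat) (L : 'I_N -> {mpoly S[N]}) p :
  homog t p -> (forall i, homog c (L i)) -> homog (t * c) (mcomp L p).
Proof.
move=> hp hL; rewrite (deg_le_expand (homog_deg_le hp)) raddf_sum /= => m mt.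
rewrite raddf_sum /= big1 // => g _; rewrite mcompZ mcoeffZ mcompX.
have [E|E] := eqVneq (mdeg (bmnm g)) t; last by rewrite hp ?mul0r.
have hg : homog (mdeg (bmnm g) * c) (mmap1 L (bmnm g)).
  by apply: (@mmap1_graded _ (fun t => @homog _ _ t)) => //; [exact: homog1 | exact: homog_mul].
by rewrite hg ?mulr0 // E.
Qed.

Lemma homogD (S : comNzRingType) N t (p q : {mpoly S[N]}) : homog t p -> homog t q -> homog t (p + q).
Proof. by move=> hp hq m mt; rewrite mcoeffD hp ?hq ?addr0. Qed.

Lemma homogZ (S : comNzRingType) N t c (p : {mpoly S[N]}) : homog t p -> homog t (c *: p).
Proof. by move=> hp m mt; rewrite mcoeffZ hp ?mulr0. Qed.

Lemma homog_sum (S : comNzRingType) N t (I : Type) (r : seq I) (P : pred I) (f : I -> {mpoly S[N]}) :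
  (forall i, P i -> homog t (f i)) -> homog t (\sum_(i <- r | P i) f i).
Proof.
by move=> hf; apply: big_ind => //; [move=> m _; rewrite mcoeff0 | exact: homogD].
Qed.

Lemma homog_map (S T : comNzRingType) (h : {rmorphism S -> T}) N t (p : {mpoly S[N]}) :
  homog t p -> homog t (map_mpoly h p).
Proof. by move=> hp m mt; rewrite mcoeff_map_mpoly (hp _ mt) raddf0. Qed.

Lemma map_mcomp (S T : comNzRingType) (h : {rmorphism S -> T}) N (L : 'I_N -> {mpoly S[N]}) p :
  map_mpoly h (mcomp L p) = mcomp (fun i => map_mpoly h (L i)) (map_mpoly h p).
Proof.
apply: (@eq_rmorph_mpoly _ _ _ (map_mpoly h \o mcomp L)
  (mcomp (fun i => map_mpoly h (L i)) \o map_mpoly h)) => [c|i] /=.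
  by rewrite mcompC !map_mpolyC mcompC.
by rewrite mcompX map_mpoly_mmap1 map_mpolyX mcompX.
Qed.

Lemma homog_coef_axis (S : comNzRingType) N t (p : {mpoly S[N]}) i0 m :
  homog t p -> mdeg m = m i0 -> mdeg m = t ->
  mcoeff m p = meval (fun j => (j == i0)%:R) p.
Proof.
move=> hp mi0 mt; have mt' : (mdeg m < t.+1)%N by rewrite mt.
rewrite [in RHS](deg_le_expand (homog_deg_le hp)) raddf_sum /=.
have zero (g : multinom N) : g != m -> mdeg g = t ->
    \prod_(j < N) ((j == i0)%:R : S) ^+ g j = 0.
  move=> gm gt; have [j ji gj] : exists2 j, j != i0 & g j != 0%N.
    apply: contrapT => H; case/eqP: gm; apply/mnmP => j.
    have others (k : multinom N) : mdeg k = k i0 -> forall j, j != i0 -> k j = 0%N.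
      move=> E j' j'i; apply/eqP; rewrite -leqn0.
      have : (k i0 + k j' <= k i0)%N.
        rewrite -[X in (_ <= X)%N]E mdegE (bigD1 i0) //= leq_add2l (bigD1 j') //=.
        exact: leq_addr.
      by rewrite -[X in (_ <= X)%N]addn0 leq_add2l.
    have gg : mdeg g = g i0.
      rewrite mdegE (bigD1 i0) //= big1 ?addn0 // => k ki; apply/eqP.
      by apply: contraT => gk; case: H; exists k.
    have [->|ji] := eqVneq j i0; first by rewrite -gg -mi0 gt mt.
    by rewrite (others _ gg _ ji) (others _ mi0 _ ji).
  by rewrite (bigD1 j) //= (negbTE ji) expr0n (negbTE gj) mul0r.
rewrite (bigD1 (BMultinom mt')) //= mevalZ mevalX [X in _ + X]big1 => [|g gm]; last first.
  rewrite /= mevalZ mevalX; have [E|E] := eqVneq (mdeg (bmnm g)) t; last by rewrite hp ?mul0r.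
  by rewrite zero ?mulr0 //; apply: contra gm => /eqP gm; apply/eqP/val_inj.
rewrite addr0 big1 ?mulr1 // => j _; have [->|ji] := eqVneq j i0; first by rewrite expr1n.
rewrite (_ : m j = 0%N) ?expr0 //; apply/eqP; rewrite -leqn0.
have : (m i0 + m j <= m i0)%N.
  by rewrite -[X in (_ <= X)%N]mi0 mdegE (bigD1 i0) //= leq_add2l (bigD1 j) //= leq_addr.
by rewrite -[X in (_ <= X)%N]addn0 leq_add2l.
Qed.

(** With c = p - e_i0 this linear map sends e_i0 to p. It is a rank one perturbation of the
    identity, so its inverse in [shear_inverse] is again a shear, with denominator 1 + c_i0 =
    p_i0. *)
Definition shear (S : comNzRingType) N (i0 : 'I_N) (c : 'I_N -> S) (j : 'I_N) : {mpoly S[N]} :=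
  mpolyX S (mnm1 j) + c j *: mpolyX S (mnm1 i0).

Lemma shear_homog (S : comNzRingType) N (i0 : 'I_N) (c : 'I_N -> S) j : homog 1 (shear i0 c j).
Proof.
have h1 k : homog 1 (mpolyX S (mnm1 k) : {mpoly S[N]}) by rewrite -(mdeg1 k); apply: homogX.
by apply: homogD; [|apply: homogZ].
Qed.

Lemma shear_inverse (F : fieldType) N (i0 : 'I_N) (c : 'I_N -> F) (p : {mpoly F[N]}) :
  1 + c i0 != 0 ->
  mcomp (shear i0 (fun j => - c j / (1 + c i0))) (mcomp (shear i0 c) p) = p.
Proof.
move=> c0; rewrite mcomp_comp -[RHS]mcomp_id; apply: eq_mcomp => j.
rewrite /shear raddfD /= mcompZ !mcompX !mmap1U /shear scalerDr scalerA -addrA.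
rewrite -scalerDl -scalerDl -[RHS]addr0; congr (_ + _).
rewrite (_ : _ + _ = 0) ?scale0r //; field; exact: c0.
Qed.

Lemma mcoeff_line (K : fieldType) N k (p q : {mpoly K[N]}) :
  mcoeff k (map_mpoly (@polyC K) p + 'X *: map_mpoly (@polyC K) q) = (mcoeff k p)%:P + 'X * (mcoeff k q)%:P.
Proof. by rewrite mcoeffD mcoeffZ !mcoeff_map_mpoly. Qed.

Section Line.
Variables (K : fieldType) (N d : nat).
Hypothesis d_gt0 : (0 < d)%N.

Definition lineF (H G : 'I_N -> {mpoly K[N]}) (i : 'I_N) : {mpoly {poly K}[N]} :=
  map_mpoly (@polyC K) (H i) + 'X *: map_mpoly (@polyC K) (G i).

Lemma lineF_homog H G t : (forall i, homog t (H i)) -> (forall i, homog t (G i)) ->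
  forall i, homog t (lineF H G i).
Proof. by move=> hH hG i; apply: homogD; [|apply: homogZ]; apply: homog_map. Qed.

Lemma famdet_shear m i0 (c : 'I_N -> K) : 1 + c i0 != 0 ->
  famdet m (fun g => mcomp (shear i0 c) (mpolyX K g)) != 0.
Proof.
move=> c0; pose c' j := - c j / (1 + c i0).
have : famdet m (fun g => mcomp (shear i0 c) (mpolyX K g)) *
   famdet m (fun g => mcomp (shear i0 c') (mpolyX K g)) = 1.
  rewrite -famdet_change => [|g gm|a p|p q].
  - by rewrite -[RHS](famdet_X K N m); apply: eq_famdet => g /=; rewrite shear_inverse.
  - apply: deg_le_weaken gm _; apply: homog_deg_le; rewrite -[X in homog X]muln1.
    by apply: homog_mcomp; [exact: homogX | exact: shear_homog].
  - exact: mcompZ.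
  - exact: raddfB.
by move=> E; apply: contra_eq_neq E => ->; rewrite mul0r eq_sym oner_neq0.
Qed.

(** A common zero p of H is moved to e_i0 by a shear, which changes the determinant by a nonzero
    constant only. Every component of the line then has order at least 1 there, and [order_at_point]
    applies. A zero component of H is left to [order_zero_component]. *)
Lemma vanish_line m (H G : 'I_N -> {mpoly K[N]}) :
  (forall i, homog d (H i)) -> (forall i, homog d (G i)) ->
  (exists i, H i = 0) \/ (exists p, (exists i, p i != 0) /\ forall i, meval p (H i) = 0) ->
  'X^(vanish_order N d m) %| famdet m (bfam d (lineF H G)).
Proof.
move=> hH hG [[i0 Hi0]|[p [[i0 pi0] Hp]]].
  have E : lineF H G i0 = 'X *: map_mpoly (@polyC K) (G i0) by rewrite /lineF Hi0 raddf0 add0r.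
  apply: (dvdp_trans _ (order_zero_component d m E)); apply: dvdp_exp2l; apply: leq_trans (vanish_order_le d_gt0 m i0) _.
  by apply: leq_sum => g _; apply: point_weight_le.
pose c j := p j - (j == i0)%:R.
have c0 : 1 + c i0 != 0 by rewrite /c eqxx addrC subrK.
pose sg := mcomp (fun j => map_mpoly (@polyC K) (shear i0 c j)).
have hL := lineF_homog hH hG.
have E : famdet m (sg \o bfam d (lineF H G)) =
   famdet m (bfam d (lineF H G)) * (famdet m (fun g => mcomp (shear i0 c) (mpolyX K g)))%:P.
  rewrite famdet_change => [|g gm|a q|q r].
  - congr (_ * _); rewrite (map_famdet m (@polyC K)); apply: eq_famdet => g.
    by rewrite map_mcomp map_mpolyX.
  - by apply: deg_le_weaken gm _; apply: homog_deg_le; apply: bfam_homog.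
  - exact: mcompZ.
  - exact: raddfB.
have -> : 'X^(vanish_order N d m) %| famdet m (bfam d (lineF H G)) =
   ('X^(vanish_order N d m) %| famdet m (sg \o bfam d (lineF H G))).
  by rewrite E mulrC mul_polyC dvdpZr // famdet_shear.
have -> : famdet m (sg \o bfam d (lineF H G)) = famdet m (fun g =>
    mmap1 (fun i => sg (lineF H G i)) (mdivn g d) * sg (mpolyX _ (mmodn g d))).
  apply: eq_famdet => g; rewrite /= /bfam /sg rmorphM /=; congr (_ * _).
  by rewrite /mmap1 rmorph_prod; apply: eq_bigr => i _; rewrite rmorphXn.
have hsg t q : homog t q -> homog t (sg q).
  rewrite -[X in _ -> homog X _]muln1 => hq; apply: homog_mcomp => // j.
  by apply: homog_map; apply: shear_homog.
apply: (dvdp_trans _ (@order_at_point _ _ _ d_gt0 m i0 _ (fun g => sg (mpolyX _ (mmodn g d))) _ _ _)).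
- by apply: dvdp_exp2l; apply: vanish_order_le.
- by move=> i; apply: hsg.
- by move=> g; apply: hsg; apply: homogX.
move=> i k.
(* Order 1 constrains only the coefficient of z_i0^d; its constant term in ['X] is the value of H_i
   at p, which is 0. *)
have [dk|] := ltnP 0 (mdeg k - k i0).
  by rewrite (_ : (1 - _ = 0)%N) ?expr0 ?dvd1p //; apply/eqP; rewrite subn_eq0.
rewrite leqn0 subn_eq0 => dk.
have {}dk : mdeg k = k i0 by apply/eqP; rewrite eqn_leq dk mnm_le_mdeg.
rewrite dk subnn subn0 expr1.
have [kd|kd] := eqVneq (mdeg k) d; last by rewrite (hsg d) ?dvdp0.
rewrite /lineF /sg raddfD /= mcompZ -!(map_mcomp (@polyC K)) /=.
rewrite mcoeff_line.
rewrite [mcoeff k (mcomp _ (H i))](homog_coef_axis (t := d) (i0 := i0)) //; last first.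
  by rewrite -[d]muln1; apply: homog_mcomp => // j; apply: shear_homog.
rewrite meval_mcomp (meval_eq (v2 := p)) => [|j].
  by rewrite Hp add0r dvdp_mulr.
by rewrite /shear mevalD mevalZ !mevalXU eqxx mulr1 /c addrC subrK.
Qed.

End Line.

Lemma deg_leC (S : comNzRingType) n (c : S) : deg_le 0 (mpolyC n c).
Proof. by move=> a a0; rewrite mcoeffC; case: eqP a0 => [->|_ _]; rewrite ?mdeg0 // mulr0. Qed.

Section CoefficientVector.
Variables (N d : nat).
Local Notation n := #|coef_index N d|.

Definition cidx (k : 'I_n) : 'I_N * bmultinom N d.+1 := val (enum_val k).

Lemma cidx_inj : injective cidx.
Proof. by move=> k k' /val_inj /enum_val_inj. Qed.

Lemma cidx_deg k : mdeg (bmnm (cidx k).2) = d.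
Proof. by rewrite /cidx; case: (enum_val k) => im /= /eqP. Qed.

Lemma cidx_surj (i : 'I_N) (m : multinom N) : mdeg m = d ->
  exists k, (cidx k).1 = i /\ bmnm (cidx k).2 = m.
Proof.
move=> md; have lt : (mdeg m < d.+1)%N by rewrite md.
have eqd : mdeg (i, BMultinom lt).2 == d by rewrite /= md.
exists (enum_rank (exist _ (i, BMultinom lt) eqd : coef_index N d)).
by rewrite /cidx enum_rankK.
Qed.

Definition ofcoefs (S : comNzRingType) (x : 'I_n -> S) (i : 'I_N) : {mpoly S[N]} :=
  \sum_(k | (cidx k).1 == i) x k *: mpolyX S (bmnm (cidx k).2).

Definition gcoefs (S : comNzRingType) (H : 'I_N -> {mpoly S[N]}) (k : 'I_n) : S :=
  mcoeff (bmnm (cidx k).2) (H (cidx k).1).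

Lemma mcoeff_ofcoefs (S : comNzRingType) (x : 'I_n -> S) i m : mcoeff m (ofcoefs x i) =
  \sum_(k | (cidx k).1 == i) x k * (bmnm (cidx k).2 == m)%:R.
Proof.
by rewrite /ofcoefs raddf_sum; apply: eq_bigr => k _; rewrite /= mcoeffZ mcoeffX.
Qed.

Lemma ofcoefsK (S : comNzRingType) (x : 'I_n -> S) k : gcoefs (ofcoefs x) k = x k.
Proof.
rewrite /gcoefs mcoeff_ofcoefs (bigD1 k) //= eqxx mulr1.
rewrite big1 ?addr0 // => k' /andP[/eqP E1 kk'].
case: eqP => [E2|]; last by rewrite mulr0.
case/eqP: kk'; apply: cidx_inj; move: E1 E2; case: (cidx k') => a b; case: (cidx k) => a' b' /= -> E2.
by congr (_, _); apply: val_inj.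
Qed.

Lemma ofcoefs_homog (S : comNzRingType) (x : 'I_n -> S) i : homog d (ofcoefs x i).
Proof. by apply: homog_sum => k _; apply: homogZ; rewrite -[X in homog X](cidx_deg k); apply: homogX. Qed.

Lemma gcoefsK (S : comNzRingType) (H : 'I_N -> {mpoly S[N]}) :
  (forall i, homog d (H i)) -> ofcoefs (gcoefs H) =1 H.
Proof.
move=> hH i; apply/mpolyP => m; have [md|md] := eqVneq (mdeg m) d; last first.
  by rewrite hH ?ofcoefs_homog.
have [k [<- <-]] := cidx_surj i md; exact: (ofcoefsK (gcoefs H) k).
Qed.

Lemma map_ofcoefs (S T : comNzRingType) (h : {rmorphism S -> T}) (x : 'I_n -> S) i :
  map_mpoly h (ofcoefs x i) = ofcoefs (fun k => h (x k)) i.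
Proof.
apply/mpolyP => m; rewrite mcoeff_map_mpoly !mcoeff_ofcoefs raddf_sum /=.
by apply: eq_bigr => k _; rewrite rmorphM rmorph_nat.
Qed.

Lemma eq_ofcoefs (S : comNzRingType) (x y : 'I_n -> S) : x =1 y -> ofcoefs x =1 ofcoefs y.
Proof. by move=> xy i; apply: eq_bigr => k _; rewrite xy. Qed.

Lemma eq_bfam (S : comNzRingType) (F G : 'I_N -> {mpoly S[N]}) g : F =1 G -> bfam d F g = bfam d G g.
Proof. by move=> FG; rewrite /bfam; congr (_ * _); apply: mmap1_eq. Qed.

Variable K : fieldType.

Definition universal (i : 'I_N) : {mpoly {mpoly K[n]}[N]} :=
  ofcoefs (fun k => mpolyX K (mnm1 k)) i.

(** A determinant in the style of Macaulay: the coefficients of the system are indeterminates, so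
    that one polynomial specializes to [famdet] of any system, lines of systems included. *)
Definition macaulay m : {mpoly K[n]} := famdet m (bfam d universal).

Lemma mmap_macaulay (S : comNzRingType) (f : {rmorphism K -> S}) (x : 'I_n -> S) m :
  mmap f x (macaulay m) = famdet m (bfam d (ofcoefs x)).
Proof.
rewrite (map_famdet m (mmap f x)); apply: eq_famdet => g; rewrite map_bfam.
apply: eq_bfam => i; rewrite map_ofcoefs; apply: eq_ofcoefs => k /=.
by rewrite mmapX mmap1U.
Qed.

Lemma mmap_macaulay_homog (S : comNzRingType) (f : {rmorphism K -> S}) (H : 'I_N -> {mpoly S[N]}) m :
  (forall i, homog d (H i)) -> mmap f (gcoefs H) (macaulay m) = famdet m (bfam d H).
Proof.
by move=> hH; rewrite mmap_macaulay; apply: eq_famdet => g; apply: eq_bfam; apply: gcoefsK.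
Qed.

Definition divsum m := (\sum_(g : bmultinom N m.+1) mdeg (mdivn (bmnm g) d))%N.

(** Row g is a product of |g div d| components, each linear in the coefficients, and a monomial; the
    Leibniz formula adds up the rows. *)
Lemma macaulay_degree m : deg_le (divsum m) (macaulay m).
Proof.
pose P t (p : {mpoly {mpoly K[n]}[N]}) := forall k, deg_le t (mcoeff k p).
have P1 : P 0%N 1.
  by move=> k; rewrite mcoeff1 -mpolyC_nat; apply: deg_leC.
have dl0 t : deg_le t (0 : {mpoly K[n]}) by move=> a _; rewrite mcoeff0.
have PM s t p q : P s p -> P t q -> P (s + t)%N (p * q).
  move=> Pp Pq k; rewrite mcoeffM; elim/big_ind: _ => // [x y|i _]; first exact: deg_leD.
  by apply: deg_le_mul.
have Pb g : P (mdeg (mdivn g d)) (bfam d universal g).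
  rewrite -[X in P X]addn0; apply: (PM); last first.
    by move=> k; rewrite mcoeffX -mpolyC_nat; apply: deg_leC.
  rewrite -[X in P X]muln1; apply: (@mmap1_graded _ P) => // i k.
  rewrite /universal mcoeff_ofcoefs; elim/big_ind: _ => // [x y|j _]; first exact: deg_leD.
  rewrite -mpolyC_nat mulrC mul_mpolyC => a a1.
  rewrite mcoeffZ mcoeffX; have [E|_] := eqVneq (mnm1 j) a; rewrite ?mulr0 //.
  by move: a1; rewrite -E mdeg1.
apply: fdet_ind => // [x y|s b]; first exact: deg_leD.
have -> : divsum m = (0 + divsum m)%N by [].
apply: deg_le_mul.
  have -> : (-1) ^+ b = mpolyC n ((-1) ^+ b) :> {mpoly K[n]} by rewrite rmorphXn rmorphN1.
  exact: deg_leC.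
rewrite /divsum; apply: (big_ind2 (fun t p => deg_le t p)) => //.
- by rewrite -mpolyC1; apply: deg_leC.
- by move=> s1 t p q; apply: deg_le_mul.
- by move=> i _; apply: Pb.
Qed.

Lemma ofcoefs_line (x y : 'I_n -> K) i :
  ofcoefs (fun k => (x k)%:P + 'X * (y k)%:P) i = lineF (ofcoefs x) (ofcoefs y) i.
Proof.
rewrite /lineF !map_ofcoefs /ofcoefs scaler_sumr -big_split /=.
by apply: eq_bigr => k _; rewrite scalerDl scalerA.
Qed.

End CoefficientVector.

Section Resultant.
Variables (K : numClosedFieldType) (N d : nat).
Hypothesis d_gt0 : (0 < d)%N.
Local Notation n := #|coef_index N d|.

Lemma deriv_mmap (h : 'I_n -> {poly K}) k0 (P : {mpoly K[n]}) :
  (forall k, (h k)^`() = (k == k0)%:R) ->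
  (mmap (@polyC K) h P)^`() = mmap (@polyC K) h (mderiv k0 P).
Proof.
move=> dh; pose D P := (mmap (@polyC K) h P)^`() = mmap (@polyC K) h (mderiv k0 P).
have D1 : D 1 by rewrite /D rmorph1 -[1 in RHS]mpolyC1 mderivC mmap0 derivC.
have DM p q : D p -> D q -> D (p * q).
  by move=> Dp Dq; rewrite /D mderivM !rmorphM derivM Dp Dq rmorphD !rmorphM.
elim/mpolyind: P => [|c m p _ _ IH]; first by rewrite mderiv0 !mmap0 derivC.
rewrite mderivD !rmorphD derivD /= IH; congr (_ + _).
rewrite mderivZ !mmapZ derivM derivC mul0r add0r; congr (_ * _); rewrite mpolyXE_id.
apply: (big_ind D) => // k _; elim: (m k) => [|j IHj]; first by rewrite expr0.
rewrite exprS; apply: DM => //; rewrite /D mmapX mmap1U dh mderivX mmapZ mmapX mnm1E.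
case: eqP => [->|]; last by rewrite mul0r.
by rewrite mul1r (_ : mnm_sub _ _ = @mnm0 _) ?mmap11 //; apply/mnmP=> j'; rewrite mnmBE subnn mnm0E.
Qed.

(** The first case reflects that [regular] asks every component to have degree exactly d, hence to
    be nonzero. *)
Definition degenerate (H : 'I_N -> {mpoly K[N]}) : Prop :=
  (exists i, H i = 0) \/ (exists p, (exists i, p i != 0) /\ forall i, meval p (H i) = 0).

Variable P : {mpoly K[n]}.
Hypothesis irrP : irreducible_elt P.
Hypothesis degP : forall x, meval x P = 0 -> degenerate (ofcoefs x).

Lemma mderiv_size k0 : (mmeasure mdeg (mderiv k0 P) <= (mmeasure mdeg P).-1)%N.
Proof.
have P0 := irreducible_neq0 irrP.
have sP : (mmeasure mdeg P != 1)%N by rewrite -mpoly_unitE; have [] := irrP.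
case E : (mmeasure mdeg P) => [|[|t]].
- by move/eqP: E; rewrite mmeasure_poly_eq0 (negbTE P0).
- by rewrite E in sP.
apply/deg_leP => m tm; rewrite mcoeff_deriv (_ : mcoeff _ P = 0) ?mul0rn //.
by apply: memN_msupp_eq0; apply: msize_mdeg_ge; rewrite E mdegD mdeg1 addn1.
Qed.

(** In characteristic 0 a nonconstant polynomial has a nonzero partial derivative, whose degree is
    too small for a multiple of [P]. *)
Lemma simple_direction : exists k0, ~ divides P (mderiv k0 P).
Proof.
have P0 := irreducible_neq0 irrP.
have sP : (mmeasure mdeg P != 1)%N by rewrite -mpoly_unitE; have [] := irrP.
have [k0 Hk] : exists k0, mderiv k0 P != 0.
  have := mlead_deg P0; set m := mlead P => Em.
  have [k0 mk] : exists k0, m k0 != 0%N.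
    apply: contrapT => H; move: sP; rewrite -Em eqSS mdegE big1 // => k _.
    by apply/eqP; apply: contraT => mk; case: H; exists k.
  exists k0; apply/eqP => /(congr1 (mcoeff (mnm_sub m (mnm1 k0)))); rewrite mcoeff0 mcoeff_deriv.
  have le : mnm_add (mnm_sub m (mnm1 k0)) (mnm1 k0) = m by apply: submK; rewrite lep1mP.
  by rewrite le => /eqP; rewrite mulrn_eq0 /= mleadc_eq0 (negbTE P0).
exists k0 => -[c Ec]; have c0 : c != 0 by apply: contraNneq Hk => c0; rewrite Ec c0 mulr0.
have := mderiv_size k0; rewrite Ec msizeM //.
have sc : (0 < mmeasure mdeg c)%N by rewrite lt0n mmeasure_poly_eq0.
have sP' : (0 < mmeasure mdeg P)%N by rewrite lt0n mmeasure_poly_eq0.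
move: (mmeasure mdeg c) (mmeasure mdeg P) sc sP' => a b; clear; lia.
Qed.

(* At a point of [P = 0] where [B] and a derivative of [P] do not vanish, the
   order of [P^j B] along a line is exactly [j]. *)
Lemma resultant_power_divides m : exists B, macaulay N d K m = P ^+ vanish_order N d m * B.
Proof.
have [k0 nk0] := simple_direction.
suff H j : (j <= vanish_order N d m)%N -> exists B, macaulay N d K m = P ^+ j * B by exact: H.
elim: j => [_|j IH jk]; first by exists (macaulay N d K m); rewrite expr0 mul1r.
have [B EB] := IH (ltnW jk).
have [[c Ec]|nB] := pselect (divides P B).
  by exists c; rewrite EB Ec mulrA exprSr.
have : ~ divides P (B * mderiv k0 P).
  by move=> /(proj2 (factorial_mpoly K n) _ irrP)[].
case/(hypersurface_point irrP) => x [Px]; rewrite mevalM mulf_eq0 negb_or => /andP[Bx dPx].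
pose y k : K := (k == k0)%:R.
pose h k := (x k)%:P + 'X * (y k)%:P.
have h0 k : (h k).[0] = x k by rewrite /h !hornerE.
have ev0 (Q : {mpoly K[n]}) : (mmap (@polyC K) h Q).[0] = meval x Q.
  apply: (@eq_rmorph_mpoly _ _ _ (horner_eval 0 \o mmap (@polyC K) h) (meval x)) => [c|k] /=.
    by rewrite mmapC mevalC /horner_eval hornerC.
  by rewrite mmapX mmap1U mevalXU /horner_eval h0.
have dv : 'X^(vanish_order N d m) %| mmap (@polyC K) h (macaulay N d K m).
  rewrite mmap_macaulay.
  rewrite (@eq_famdet _ _ m _ (bfam d (lineF (ofcoefs x) (ofcoefs y)))); last first.
    by move=> g; apply: eq_bfam => i; apply: ofcoefs_line.
  apply: vanish_line => //; [exact: ofcoefs_homog | exact: ofcoefs_homog |].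
  exact: degP.
have [u Eu] : exists u, mmap (@polyC K) h P = u * 'X.
  have /factor_theorem[u] : root (mmap (@polyC K) h P) 0 by apply/rootP; rewrite ev0.
  by rewrite subr0 => Eu; exists u.
have u0 : u.[0] != 0.
  have := deriv_mmap (h := h) (k0 := k0) P; rewrite Eu => E.
  have : (u * 'X)^`().[0] = meval x (mderiv k0 P).
    rewrite E ?ev0 // => k; rewrite /h derivD derivC add0r derivM derivX derivC mulr0 mul1r addr0.
    by rewrite /y; case: eqP.
  by rewrite derivM derivX mulr1 hornerD hornerM hornerX mulr0 add0r => ->.
case/negP: Bx; move: dv; rewrite EB rmorphM rmorphXn /= Eu.
rewrite exprMn mulrAC => /(dvdp_trans (dvdp_exp2l 'X jk)).
rewrite exprS dvdp_mul2r ?expf_neq0 ?polyX_eq0 // -['X]subr0 -(rmorph0 (@polyC K)).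
rewrite dvdp_XsubCl rootM => /orP[|]; rewrite rootE; last by rewrite ev0.
by rewrite horner_exp expf_eq0 (negbTE u0) andbF.
Qed.

End Resultant.

Lemma prim_root_exists (K : numClosedFieldType) n : (n > 0)%N -> {z : K | n.-primitive_root z}.
Proof.
pose p : {poly K} := 'X^n - 1; have [r Dp] := closed_field_poly_normal p.
move=> n_gt0; apply/sigW; rewrite (monicP _) ?monicXnsubC // scale1r in Dp.
have rn1: all n.-unity_root r by apply/allP=> z; rewrite -root_prod_XsubC -Dp.
have sz_r: (n < (size r).+1)%N.
  by rewrite -(size_prod_XsubC r id) -Dp size_XnsubC.
have [|z] := hasP (has_prim_root n_gt0 rn1 _ sz_r); last by exists z.
by rewrite -separable_prod_XsubC -Dp separable_Xn_sub_1 // pnatr_eq0 -lt0n.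
Qed.

Lemma norm_prim_root (K : numClosedFieldType) n (z : K) : n.-primitive_root z -> `|z| = 1.
Proof.
move=> pz; have n0 := prim_order_gt0 pz; apply/eqP.
by rewrite -(pexpr_eq1 n0) // -normrX (prim_expr_order pz) normr1.
Qed.

Lemma sum_digits d N t : (0 < d)%N -> (t < d ^ N)%N ->
  (\sum_(i < N) ((t %/ d ^ i) %% d) * d ^ i)%N = t.
Proof.
move=> d0 tN; rewrite -[RHS](modn_small tN); elim: N {tN} => [|N IH].
  by rewrite big_ord0 expn0 modn1.
rewrite big_ord_recr /= IH expnSr.
have lt1 : (t %% d ^ N < d ^ N)%N by rewrite ltn_mod expn_gt0 d0.
have lt2 : ((t %/ d ^ N) %% d < d)%N by rewrite ltn_mod.
set a := (t %/ d ^ N)%N in lt2 *.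
have Et : t = (a %/ d * (d ^ N * d) + (a %% d * d ^ N + t %% d ^ N))%N.
  rewrite {1}(divn_eq t (d ^ N)) -/a {1}(divn_eq a d) mulnDl -mulnA -addnA.
  by rewrite [(d * d ^ N)%N]mulnC.
rewrite [in RHS]Et modnMDl (@modn_small (a %% d * d ^ N + t %% d ^ N)); first by rewrite addnC.
apply: (@leq_trans ((a %% d).+1 * d ^ N)%N); first by rewrite mulSn addnC ltn_add2r.
by rewrite mulnC leq_mul2l lt2 orbT.
Qed.

Lemma size_mmap_polyC (K : fieldType) n e t (x : 'I_n -> {poly K}) (P : {mpoly K[n]}) :
  deg_le t P -> (forall k, size (x k) <= e.+1)%N ->
  (size (mmap (@polyC K) x P) <= (e * t).+1)%N.
Proof.
move=> dP sx; pose Q j (q : {poly K}) := (size q <= j.+1)%N.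
have QM i j p q : Q i p -> Q j q -> Q (i + j)%N (p * q).
  rewrite /Q => pi qj; apply: leq_trans (size_polyMleq _ _) _.
  by move: (size p) (size q) pi qj => a b; clear; lia.
rewrite /mmap big_seq; elim/big_ind: _ => [|p q sp sq|m]; first by rewrite size_poly0.
  by rewrite (leq_trans (size_polyD _ _)) // geq_max sp.
rewrite mcoeff_msupp => Pm; rewrite mul_polyC (leq_trans (size_scale_leq _ _)) //.
have : Q (mdeg m * e)%N (mmap1 x m).
  by apply: (@mmap1_graded _ Q) => //; rewrite /Q size_poly1.
move=> /leq_trans; apply; rewrite ltnS mulnC leq_mul2l; apply/orP; right.
by rewrite leqNgt; apply: contra Pm => /dP ->.
Qed.

(** * Lower bound for the degree of the resultant *)

Section ResultantDegree.
Variables (K : numClosedFieldType) (N d : nat).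
Hypotheses (N_gt0 : (0 < N)%N) (d_gt0 : (0 < d)%N).
Local Notation n := #|coef_index N d|.
Variable P : {mpoly K[n]}.
Hypothesis P1 : meval (gcoefs (fun i : 'I_N => mpolyX K (mnm1 i) ^+ d)) P = 1.
Hypothesis P0 : forall H : 'I_N -> {mpoly K[N]}, (forall i, homog d (H i)) ->
  (exists p, (exists i, p i != 0) /\ forall i, meval p (H i) = 0) -> meval (gcoefs H) P = 0.

(** When the k_i are the base-d digits of l, prod_i c_(i, k_i) = 2^(N l), and every l < d^N arises
    in this way. The factor N in the exponent makes s^N 2^(N l) = 1 solvable by s = w^j 2^(-l) with
    w^N = 1. *)
Let c (i : 'I_N) (k : nat) : K := 2 ^+ (N * (k * d ^ i))%N.

(* The system [prod_k (z_i - s c_ik z_(i+1))], with indices mod N, has a common zero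
   iff [s^N prod_i c_(i, k_i) = 1] for some choice of the [k_i]. *)
Definition cyclic_system (S : comNzRingType) (s : S) (c : 'I_N -> nat -> S) (i : 'I_N) : {mpoly S[N]} :=
  \prod_(k < d) (mpolyX S (mnm1 i) - (s * c i k) *: mpolyX S (mnm1 (ordS i))).

Lemma cyclic_homog (S : comNzRingType) (s : S) (e : 'I_N -> nat -> S) i : homog d (cyclic_system s e i).
Proof.
rewrite -[X in homog X]muln1 -[X in (X * _)%N]card_ord -sum_nat_const.
apply: (big_ind2 (fun t (p : {mpoly S[N]}) => homog t p)) => //; first exact: homog1.
  by move=> t1 p1 t2 p2; apply: homog_mul.
move=> k _; rewrite -scaleNr; apply: homogD; last apply: homogZ.
  by rewrite -[X in homog X](mdeg1 i); apply: homogX.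
by rewrite -[X in homog X](mdeg1 (ordS i)); apply: homogX.
Qed.

Lemma map_cyclic (S T : comNzRingType) (h : {rmorphism S -> T}) (s : S) (e : 'I_N -> nat -> S) i :
  map_mpoly h (cyclic_system s e i) = cyclic_system (h s) (fun i k => h (e i k)) i.
Proof.
rewrite /cyclic_system rmorph_prod; apply: eq_bigr => k _.
by rewrite raddfB /= map_mpolyZ !map_mpolyX rmorphM.
Qed.

(** The coordinates are solved for backwards from the last one; the hypothesis is what closes the
    cycle. *)
Lemma cyclic_common_zero (s : K) (k : 'I_N -> 'I_d) : \prod_i (s * c i (k i)) = 1 ->
  exists p, (exists i, p i != 0) /\ forall i, meval p (cyclic_system s c i) = 0.
Proof.
move=> prod1; pose z (i : nat) := \prod_(l < N | (i <= l)%N) (s * c l (k l)).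
have z0 : z 0%N = 1 by rewrite -prod1; apply: eq_bigl.
exists (fun i => z (val i)); split.
  by exists (Ordinal N_gt0); rewrite /= z0 oner_neq0.
have zS (i : 'I_N) : z i.+1 = z (ordS i).
  rewrite /=; have [lt|ge] := ltnP i.+1 N; first by rewrite modn_small.
  have -> : i.+1 = N by apply/eqP; rewrite eqn_leq ge ltn_ord.
  rewrite modnn z0 /z big_pred0 // => l.
  by apply/negbTE; rewrite -ltnNge.
move=> i; rewrite /cyclic_system rmorph_prod (bigD1 (k i)) //=.
rewrite mevalB mevalZ !mevalXU -zS /z (bigD1 i) //=.
rewrite (eq_bigl (fun l : 'I_N => (i < l)%N)) ?subrr ?mul0r // => l.
by rewrite ltn_neqAle eq_sym andbC.
Qed.

(** In the parameter s, the resultant of the cyclic system has degree at most d t. It is 1 at s = 0,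
    where the system is (z_i^d), and it vanishes at the N d^N numbers w^j 2^(-l), where l is read
    off the modulus and j off the argument. *)
Lemma resultant_degree t : deg_le t P -> (N * d ^ N <= d * t)%N.
Proof.
move=> dP; have [w pw] := prim_root_exists K N_gt0.
pose cs := cyclic_system ('X : {poly K}) (fun i k => (c i k)%:P).
pose Q := mmap (@polyC K) (gcoefs cs) P.
have Qs s : Q.[s] = meval (gcoefs (cyclic_system s c)) P.
  have -> : Q.[s] = horner_eval s Q by [].
  rewrite /Q; transitivity (meval (fun k => (gcoefs cs k).[s]) P).
    apply: (@eq_rmorph_mpoly _ _ _ (horner_eval s \o mmap (@polyC K) (gcoefs cs)) (meval (fun k => (gcoefs cs k).[s]))) => [a|k] /=.
      by rewrite mmapC mevalC /horner_eval hornerC.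
    by rewrite mmapX mmap1U mevalXU /horner_eval.
  apply: meval_eq => k; rewrite /gcoefs.
  have -> : (mcoeff (bmnm (cidx k).2) (cs (cidx k).1)).[s] =
     mcoeff (bmnm (cidx k).2) (map_mpoly (horner_eval s) (cs (cidx k).1)).
    by rewrite mcoeff_map_mpoly.
  rewrite map_cyclic; congr (mcoeff _ _).
  by apply: eq_bigr => j _ /=; rewrite /horner_eval hornerX hornerC.
have sQ : (size Q <= (d * t).+1)%N.
  apply: size_mmap_polyC => // k; rewrite /gcoefs.
  pose R j (p : {mpoly {poly K}[N]}) := forall m, (size (mcoeff m p) <= j.+1)%N.
  have RD j p q : R j p -> R j q -> R j (p + q).
    by move=> Rp Rq m; rewrite mcoeffD (leq_trans (size_polyD _ _)) // geq_max Rp Rq.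
  have RM i j p q : R i p -> R j q -> R (i + j)%N (p * q).
    move=> Rp Rq m; rewrite mcoeffM; elim/big_ind: _ => [|x y sx sy|l _]; first by rewrite size_poly0.
      by rewrite (leq_trans (size_polyD _ _)) // geq_max sx.
    apply: leq_trans (size_polyMleq _ _) _; have := Rp (bmnm l.1); have := Rq (bmnm l.2).
    by move: (size _) (size _) => a b; clear; lia.
  have RX m : R 0%N (mpolyX _ m).
    by move=> l; rewrite mcoeffX; case: (m == l); rewrite ?size_poly1 ?size_poly0.
  suff : R d (cs (cidx k).1) by apply.
  rewrite /cs -[X in R X]muln1 -[X in (X * _)%N]card_ord -sum_nat_const.
  apply: (big_ind2 R) => //; first by rewrite -mpolyX0; apply: RX.
    by move=> t1 p1 t2 p2; apply: RM.
  move=> j _; apply: RD; first by move=> m; apply: leq_trans (RX _ m) _.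
  move=> m; rewrite mcoeffN size_polyN mcoeffZ; apply: leq_trans (size_polyMleq _ _) _.
  have a2 : (size ('X * (c (cidx k).1 j)%:P : {poly K})%R <= 2)%N.
    by rewrite mulrC mul_polyC (leq_trans (size_scale_leq _ _)) ?size_polyX.
  by rewrite -subn1 leq_subLR (leq_trans (leq_add a2 (RX _ m))).
have Q0 : Q != 0.
  apply/eqP => Q0; have := Qs 0; rewrite Q0 horner0 -[RHS]/(meval _ P).
  rewrite (meval_eq (v2 := gcoefs (fun i : 'I_N => mpolyX K (mnm1 i) ^+ d))) ?P1; last first.
    move=> k; rewrite /gcoefs; congr (mcoeff _ _); rewrite /cyclic_system.
    rewrite (eq_bigr (fun=> mpolyX K (mnm1 (cidx k).1))) ?prodr_const ?card_ord // => j _.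
    by rewrite mul0r scale0r subr0.
  by move/esym/eqP; rewrite oner_eq0.
pose rs := [seq w ^+ j * (2 ^+ l)^-1 | j <- iota 0 N, l <- iota 0 (d ^ N)].
have urs : uniq rs.
  apply: allpairs_uniq; [exact: iota_uniq | exact: iota_uniq |].
  move=> [j l] [j' l'] /allpairsP[[a b] /= [ja lb [-> ->]]] /allpairsP[[a' b'] /= [ja' lb' [-> ->]]] /= E.
  have nw := norm_prim_root pw.
  have El : b = b'.
    have := congr1 Num.norm E; rewrite !normrM !normrX nw !expr1n !mul1r !normfV !normrX normr_nat.
    by move/invr_inj/eqP; rewrite -!natrX eqr_nat eqn_exp2l // => /eqP.
  congr (_, _) => //; move: E; rewrite El => /mulIf; rewrite invr_eq0 expf_neq0 ?pnatr_eq0 // => /(_ isT)/eqP.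
  rewrite (eq_prim_root_expr pw) !modn_small; first by move/eqP.
    by move: ja'; rewrite mem_iota add0n.
  by move: ja; rewrite mem_iota add0n.
have rrs : all (root Q) rs.
  apply/allP => _ /allpairsP[[j l] /= [_ + ->]]; rewrite mem_iota add0n /= => lt_l.
  rewrite rootE Qs; apply/eqP; apply: P0; first by move=> i; apply: cyclic_homog.
  apply: (@cyclic_common_zero _ (fun i => Ordinal (ltn_pmod (l %/ d ^ i)%N d_gt0))).
  rewrite big_split prodr_const card_ord /= /c prodrXr -big_distrr /= sum_digits //.
  rewrite exprMn exprAC (prim_expr_order pw) expr1n mul1r exprVn -exprM mulnC mulVf ?expf_neq0 ?pnatr_eq0 //.
have := max_poly_roots Q0 rrs urs; rewrite size_allpairs !size_iota => lt.
by rewrite -ltnS; apply: leq_trans lt sQ.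
Qed.

End ResultantDegree.

(** * Counting monomials *)

Section SigmaDecomposition.
Variables (I B : finType) (c : I -> B) (J : B -> finType) (phi : forall b, J b -> I).
Hypotheses (inj_phi : forall b, injective (phi (b := b)))
  (c_phi : forall b a, c (phi (b := b) a) = b)
  (phi_c : forall i, exists a : J (c i), phi a = i).

Lemma big_sigma (R : Type) (idx : R) (op : Monoid.com_law idx) (F : I -> R) :
  \big[op/idx]_i F i = \big[op/idx]_b \big[op/idx]_(a : J b) F (phi a).
Proof.
rewrite (sig_big_dep xpredT (fun _ _ => true) (fun b (a : J b) => F (phi a))) /=.
pose g i : {b : B & J b} := Tagged J (projT1 (cid (phi_c i))).
rewrite (reindex (fun u : {b : B & J b} => phi (tagged u))) //=.
apply: onW_bij; exists g => [[b a]|i] /=; last by rewrite /g /=; case: (cid _).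
have tag_eq b' (a' : J b') b0 (a0 : J b0) : b' = b0 -> phi a' = phi a0 ->
    Tagged J a' = Tagged J a0.
  by move=> E; case: b0 / E a0 => a0 /inj_phi ->.
by apply: tag_eq (c_phi a) _; case: (cid _).
Qed.
End SigmaDecomposition.

Section CountMonomials.
Variable N : nat.
Local Notation I m := (bmultinom N m.+1).

Lemma big_bmultinom (R : Type) (idx : R) (op : Monoid.com_law idx) (F : multinom N -> R) a b :
  (b <= a)%N -> \big[op/idx]_(g : bmultinom N a | (mdeg (bmnm g) < b)%N) F (bmnm g) =
    \big[op/idx]_(g : bmultinom N b) F (bmnm g).
Proof.
move=> ba.
pose w (g : bmultinom N b) : bmultinom N a := BMultinom (leq_trans (bmdeg g) ba).
pose v (g : bmultinom N a) : option (bmultinom N b) := insub (bmnm g).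
rewrite (reindex_omap w v) => [|g gb]; last first.
  by rewrite /v insubT /=; congr Some; apply: val_inj.
apply: eq_bigl => g; rewrite /= (bmdeg g) /v.
case: insubP => [u _ Eu|/negP[]]; last exact: (bmdeg g).
by apply/eqP; congr Some; apply: val_inj.
Qed.

Lemma card_monomials m : #|{: I m}| = 'C(N + m, N).
Proof.
rewrite -card_partial_ord_partitions.
have inM (g : I m) i : (bmnm g i < m.+1)%N.
  by apply: leq_ltn_trans (mnm_le_mdeg _ _) (bmdeg g).
pose f (g : I m) : N.-tuple 'I_m.+1 := [tuple Ordinal (inM g i) | i < N].
have inj_f : injective f.
  move=> g g' /(congr1 (fun t => tnth t)) E; apply: val_inj; apply/mnmP => i.
  by have := congr1 (fun h => val (h i)) E; rewrite !tnth_mktuple.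
rewrite -(fintype.card_image inj_f); apply: eq_card => t.
rewrite [in RHS]inE; apply/idP/idP => [/fintype.imageP[g _ ->]|Ht].
  rewrite big_tuple; under eq_bigr do rewrite tnth_mktuple /=.
  by rewrite -mdegE -ltnS bmdeg.
have lt : (mdeg (mkmnm (fun i => val (tnth t i))) < m.+1)%N.
  by rewrite ltnS mdegE; under eq_bigr do rewrite mkmnmE; rewrite -(big_tuple _ _ t xpredT val).
apply/fintype.imageP; exists (BMultinom lt) => //.
by apply: eq_from_tnth => i; rewrite tnth_mktuple; apply: val_inj; rewrite /= mkmnmE.
Qed.

(** Passing from m to m + 1 adds 1 for each monomial of degree at most m, and Pascal's rule adds the
    same number on the right. *)
Lemma codegree_sum m : (\sum_(g : I m) (m - mdeg (bmnm g)))%N = 'C(N + m, N.+1).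
Proof.
elim: m => [|m IH].
  by rewrite addn0 bin_small // big1 // => g _; rewrite sub0n.
have card1 : #|{: I m}| = (\sum_(g : I m) 1)%N by rewrite sum1_card.
rewrite addnS binS -IH -card_monomials card1 -big_split /=.
have /= <- := @big_bmultinom _ _ addn (fun g => (m - mdeg g + 1)%N) m.+2 m.+1 (leqnSn _).
rewrite [RHS]big_mkcond /=; apply: eq_bigr => g _.
have := bmdeg g; case: (ltnP (mdeg (bmnm g)) m.+1); move: (mdeg _) => k; clear; lia.
Qed.

(** The normalizing exponent of the transfinite diameter is thus the total degree of the monomials.
    Degrees and codegrees add up to m times the number of monomials, so [codegree_sum] gives the
    value. *)
Lemma degree_sum m : (\sum_(g : I m) mdeg (bmnm g))%N = (N * 'C(N + m, N.+1))%N.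
Proof.
have E : (\sum_(g : I m) mdeg (bmnm g) + 'C(N + m, N.+1) = m * 'C(N + m, N))%N.
  have card1 : (#|{: I m}| * m)%N = (\sum_(g : I m) m)%N by rewrite sum_nat_const.
  rewrite -codegree_sum -big_split /= -card_monomials mulnC card1.
  by apply: eq_bigr => g _; rewrite subnKC // -ltnS bmdeg.
have := mul_bin_left (N + m) N; rewrite addKn -E mulSn.
by move: (\sum_g _)%N ('C(_, _)) (N * _)%N => a b e; clear; lia.
Qed.

Variable d : nat.
Hypothesis d_gt0 : (0 < d)%N.
Local Notation B := {ffun 'I_N -> 'I_d}.

Definition digit_deg (b : B) : nat := (\sum_i b i)%N.

Lemma digit_deg_le b : (digit_deg b <= N * d.-1)%N.
Proof.
rewrite /digit_deg -[X in (X * _)%N]card_ord -sum_nat_const.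
by apply: leq_sum => i _; rewrite -ltnS prednK.
Qed.

Definition low_digit (g : multinom N) : B := [ffun i => Ordinal (ltn_pmod (g i) d_gt0)].
Definition digit_mnm (b : B) : multinom N := mkmnm (fun i => val (b i)).

Lemma digit_mnm_deg b : mdeg (digit_mnm b) = digit_deg b.
Proof. by rewrite mdegE; apply: eq_bigr => i _; rewrite mkmnmE. Qed.

Lemma digit_low g : digit_mnm (low_digit g) = mmodn g d.
Proof. by apply/mnmP => i; rewrite !mkmnmE ffunE. Qed.

(* Strict bound on the degree of [g div d] when [mdeg g <= m] and [g mod d = b]. *)
Definition quo_bound m (b : B) : nat :=
  if (digit_deg b <= m)%N then ((m - digit_deg b) %/ d).+1 else 0.

Lemma join_bound m b (a : bmultinom N (quo_bound m b)) :
  (mdeg (mnm_add (mnm_muln (bmnm a) d) (digit_mnm b)) < m.+1)%N.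
Proof.
rewrite ltnS mdegD mdegMn digit_mnm_deg.
have := bmdeg a; rewrite {2}/quo_bound; case: ifP => // bm.
by rewrite ltnS leq_divRL // -(leq_add2r (digit_deg b)) subnK.
Qed.

Definition join_digit m b (a : bmultinom N (quo_bound m b)) : I m := BMultinom (join_bound a).

Lemma join_digit_inj m b : injective (join_digit (m := m) (b := b)).
Proof.
move=> a a' /(congr1 (fun g => mdivn (bmnm g) d)) /=.
by rewrite !mdivn_add => [/val_inj//|i|i]; rewrite mkmnmE ltn_ord.
Qed.

Lemma join_digit_low m b (a : bmultinom N (quo_bound m b)) : low_digit (bmnm (join_digit a)) = b.
Proof.
apply/ffunP => i; apply: val_inj; rewrite ffunE /= mnmDE mulmnE mkmnmE modnMDl.
by rewrite modn_small ?ltn_ord.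
Qed.

Lemma join_digit_surj m (g : I m) : exists a : bmultinom N (quo_bound m (low_digit (bmnm g))), join_digit a = g.
Proof.
have Eg := mdivn_eq (bmnm g) d.
have lt : (mdeg (mdivn (bmnm g) d) < quo_bound m (low_digit (bmnm g)))%N.
  have := bmdeg g; rewrite ltnS (mdeg_divn (bmnm g) d) /quo_bound -digit_mnm_deg digit_low => H.
  rewrite (leq_trans (leq_addl _ _) H) ltnS leq_divRL //.
  by rewrite -(leq_add2r (mdeg (mmodn (bmnm g) d))) subnK // (leq_trans (leq_addl _ _) H).
exists (BMultinom lt); apply: val_inj; rewrite /= digit_low.
exact: esym.
Qed.

Lemma big_digits (R : Type) (idx : R) (op : Monoid.com_law idx) m (F : multinom N -> R) :
  \big[op/idx]_(g : I m) F (bmnm g) =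
  \big[op/idx]_b \big[op/idx]_(a : bmultinom N (quo_bound m b))
     F (mnm_add (mnm_muln (bmnm a) d) (digit_mnm b)).
Proof.
exact: (big_sigma (c := fun g : I m => low_digit (bmnm g)) (phi := join_digit (m := m))
  (@join_digit_inj m) (@join_digit_low m) (@join_digit_surj m) op (fun g => F (bmnm g))).
Qed.

(** Group the exponents by residues mod d: each of the d^N classes contributes at most the sum of
    the m - d |a|, which is [vanish_order] up to the shift in its definition. So [vanish_order] is
    at least about D(m) / (N d^N). *)
Lemma codegree_vanish m : ('C(N + m, N.+1) <=
  d ^ N * (vanish_order N d m + (N * d.-1 + d) * #|{: I m}|))%N.
Proof.
rewrite -codegree_sum (big_digits _ m (fun g => m - mdeg g)%N) /=.
have -> : (d ^ N = \sum_(b : B) 1)%N by rewrite sum1_card card_ffun !card_ord.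
rewrite big_distrl /=; apply: leq_sum => b _; rewrite mul1n.
apply: (@leq_trans (\sum_(a : I m) (m - mdeg (bmnm a) * d))%N).
  have qb : (quo_bound m b <= m.+1)%N.
    rewrite /quo_bound; case: ifP => // _; rewrite ltnS.
    by apply: leq_trans (leq_div _ _) (leq_subr _ _).
  rewrite -[X in (_ <= X)%N](big_mkcond xpredT) /= (bigID (fun a : I m => (mdeg (bmnm a) < quo_bound m b)%N)) /=.
  apply: leq_trans (leq_addr _ _).
  have /= -> := @big_bmultinom _ _ addn (fun a => m - mdeg a * d)%N _ _ qb; apply: leq_sum => a _.
  by rewrite leq_sub2l // mdegD mdegMn leq_addr.
have -> : ((N * d.-1 + d) * #|{: I m}| = \sum_(a : I m) (N * d.-1 + d))%N by rewrite sum_nat_const mulnC.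
rewrite /vanish_order -big_split /=; apply: leq_sum => a _.
by move: (mdeg _ * d)%N (N * d.-1 + d)%N => x y; clear; lia.
Qed.

End CountMonomials.

(** * Growth of the determinant of the basis *)

Section Span.
Variables (K : fieldType) (N d : nat).
Hypothesis d_gt0 : (0 < d)%N.
Variable F : 'I_N -> {mpoly K[N]}.
Hypothesis hF : forall i, homog d (F i).
Local Notation I m := (bmultinom N m.+1).
Local Notation b := (bfam d F).

Definition inspan m (p : {mpoly K[N]}) : Prop :=
  exists c : multinom N -> K, p = \sum_(g : I m) c (bmnm g) *: b (bmnm g).

Lemma inspanD m p q : inspan m p -> inspan m q -> inspan m (p + q).
Proof.
move=> [c ->] [c' ->]; exists (fun g => c g + c' g); rewrite -big_split /=.
by apply: eq_bigr => g _; rewrite scalerDl.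
Qed.

Lemma inspanZ m a p : inspan m p -> inspan m (a *: p).
Proof.
move=> [c ->]; exists (fun g => a * c g); rewrite scaler_sumr.
by apply: eq_bigr => g _; rewrite scalerA.
Qed.

Lemma inspan_sum m (J : Type) (r : seq J) (P : pred J) (f : J -> {mpoly K[N]}) :
  (forall j, P j -> inspan m (f j)) -> inspan m (\sum_(j <- r | P j) f j).
Proof.
move=> H; apply: big_ind => //; last exact: inspanD.
by exists (fun=> 0); rewrite big1 // => g _; rewrite scale0r.
Qed.

Lemma inspan_bfam m g : (mdeg g <= m)%N -> inspan m (b g).
Proof.
rewrite -ltnS => gm; exists (fun h => (h == g)%:R).
rewrite (bigD1 (BMultinom gm)) //= eqxx scale1r big1 ?addr0 // => h hg.
rewrite (_ : (bmnm h == g) = false) ?scale0r //; apply/negbTE; apply: contra hg => /eqP E.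
exact/eqP/val_inj.
Qed.

(** The family is stable under multiplication by F_i, which lets [famdet_all] climb from one degree
    to all. *)
Lemma bfam_mulF i g : F i * b g = b (mnm_add g (mnm_muln (mnm1 i) d)).
Proof.
have gE := mdivn_eq g d; set g' := mnm_add _ _.
have lt j : (mmodn g d j < d)%N by rewrite mkmnmE ltn_mod.
have Eg' : g' = mnm_add (mnm_muln (mnm_add (mdivn g d) (mnm1 i)) d) (mmodn g d).
  apply/mnmP => j; rewrite /g' {1}gE !mnmDE !mulmnE !mnmDE mulnDl; lia.
rewrite /bfam Eg' mdivn_add // mmodn_add // mulrA; congr (_ * _).
rewrite /mmap1 (bigD1 i) //= [in RHS](bigD1 i) //= mulrA; congr (_ * _).
  by rewrite mnmDE mnm1E eqxx addn1 exprS.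
by apply: eq_bigr => j ji; rewrite mnmDE mnm1E eq_sym (negbTE ji) addn0.
Qed.

Lemma inspan_mulF m i p : inspan m p -> inspan (m + d) (F i * p).
Proof.
move=> [c ->]; rewrite mulr_sumr; apply: inspan_sum => g _.
rewrite -scalerAr; apply: inspanZ; rewrite bfam_mulF; apply: inspan_bfam.
by rewrite mdegD mdegMn mdeg1 mul1n leq_add2r -ltnS bmdeg.
Qed.

Lemma inspan_famdet m : (forall g, (mdeg g <= m)%N -> inspan m (mpolyX K g)) -> famdet m b != 0.
Proof.
move=> H; have /choice[c Hc] : forall g : I m, exists c : multinom N -> K,
    mpolyX K (bmnm g) = \sum_(h : I m) c (bmnm h) *: b (bmnm h).
  by move=> g; apply: H; rewrite -ltnS bmdeg.
have E : fdet (fun g h : I m => c g (bmnm h)) * famdet m b = 1.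
  apply: fdet_inverse => g l; have /(congr1 (mcoeff (bmnm l))) := Hc g.
  rewrite mcoeffX -bmeqP => ->; rewrite raddf_sum /=.
  by apply: eq_bigr => h _; rewrite mcoeffZ.
by apply: contra_eq_neq E => ->; rewrite mulr0 eq_sym oner_neq0.
Qed.

Lemma famdet_inspan m p : famdet m b != 0 -> deg_le m p -> inspan m p.
Proof.
move=> /fdet_unit_inverse[f [_ Hf]] dp.
pose c (g : multinom N) : K :=
  if insub g is Some h then \sum_(k : I m) mcoeff (bmnm k) p * f k h else 0.
exists c; apply/mpolyP => l; rewrite raddf_sum /=.
have [lm|lm] := ltnP m (mdeg l).
  rewrite dp // big1 // => g _; rewrite mcoeffZ (bfam_homog hF) ?mulr0 //.
  by rewrite gtn_eqF // (leq_trans (bmdeg g)).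
have lm' : (mdeg l < m.+1)%N by [].
transitivity (\sum_(k : I m) mcoeff (bmnm k) p * (k == BMultinom lm')%:R).
  rewrite (bigD1 (BMultinom lm')) //= eqxx mulr1 big1 ?addr0 // => k /negbTE ->.
  by rewrite mulr0.
transitivity (\sum_(k : I m) \sum_(h : I m) mcoeff (bmnm k) p * (f k h * mcoeff l (b (bmnm h)))).
  by apply: eq_bigr => k _; rewrite -mulr_sumr; congr (_ * _); apply/esym/(Hf k (BMultinom lm')).
rewrite exchange_big /=; apply: eq_bigr => g _.
rewrite mcoeffZ /c valK mulr_suml; apply: eq_bigr => k _.
by rewrite mulrA.
Qed.

Lemma homog_expand m t p (c : multinom N -> K) : homog t p ->
  p = \sum_(g : I m) c (bmnm g) *: b (bmnm g) ->
  p = \sum_(g : I m | mdeg (bmnm g) == t) c (bmnm g) *: b (bmnm g).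
Proof.
move=> hp Ep; apply/mpolyP => l; have [lt|lt] := eqVneq (mdeg l) t; last first.
  rewrite hp // raddf_sum big1 //= => g /eqP gt; rewrite mcoeffZ (bfam_homog hF) ?mulr0 //.
  by rewrite gt.
rewrite {1}Ep !raddf_sum /= (bigID (fun g : I m => mdeg (bmnm g) == t)) /=.
rewrite [X in _ + X]big1 ?addr0 // => g gt; rewrite mcoeffZ (bfam_homog hF) ?mulr0 //.
by rewrite lt eq_sym.
Qed.

(* In degree [N (d - 1) + 1] every [b_g] is divisible by some [F_i]. *)
Lemma famdet_all m : famdet (N * d.-1).+1 b != 0 -> famdet m b != 0.
Proof.
set m1 := (N * d.-1).+1 => A1.
have low g : (mdeg g <= m1)%N -> exists c : multinom N -> K,
    mpolyX K g = \sum_(h : I m1 | mdeg (bmnm h) == mdeg g) c (bmnm h) *: b (bmnm h).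
  move=> gm; have [|c Ec] := @famdet_inspan m1 (mpolyX K g) A1.
    by apply: deg_le_weaken gm _; apply/homog_deg_le/homogX.
  by exists c; apply: homog_expand Ec; apply: homogX.
elim/ltn_ind: m => m IH; apply: inspan_famdet => g gm.
have [gm1|gm1] := leqP (mdeg g) m1.
  have [c ->] := low g gm1; apply: inspan_sum => h /eqP hg.
  by apply: inspanZ; apply: inspan_bfam; rewrite hg.
(* z^g = z^g1 z^g2 with |g2| = [m1]. Expanding z^g2 brings out some F_i, and the remaining product
   z^g1 b_h' has degree at most m - d, where the family is already known to span. *)
have [g1 [g2 [Eg dg2]]] : exists g1 g2, g = mnm_add g1 g2 /\ mdeg g2 = m1.
  elim: (m1) (ltnW gm1) => [|k IHk] km.
    by exists g, (@mnm0 N); rewrite addm0 mdeg0.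
  have [g1 [g2 [E dg2]]] := IHk (ltnW km).
  have [i gi] : exists i, g1 i != 0%N.
    apply: contrapT => H; move: km; rewrite E mdegD dg2 mdegE big1 ?add0n ?ltnn // => i _.
    by apply/eqP; apply: contraT => gi; case: H; exists i.
  exists (mnm_sub g1 (mnm1 i)), (mnm_add (mnm1 i) g2); split.
    by rewrite addmA submK // lep1mP.
  by rewrite mdegD mdeg1 dg2.
have [c Ec] := low g2 (eq_leq dg2).
rewrite Eg mpolyXD Ec mulr_sumr; apply: inspan_sum => h /eqP dh.
rewrite -scalerAr; apply: inspanZ.
have [i hi] : exists i, (d <= bmnm h i)%N.
  apply: contrapT => H; have : (mdeg (bmnm h) <= N * d.-1)%N.
    rewrite mdegE -[X in (X * _)%N]card_ord -sum_nat_const; apply: leq_sum => i _.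
    by rewrite -ltnS prednK // ltnNge; apply/negP => di; apply: H; exists i.
  by rewrite dh dg2 /m1 ltnn.
have Eh : bmnm h = mnm_add (mnm_sub (bmnm h) (mnm_muln (mnm1 i) d)) (mnm_muln (mnm1 i) d).
  apply/esym/submK/mnm_lepP => j; rewrite mulmnE mnm1E.
  by case: eqP => [<-|]; rewrite ?mul1n ?mul0n.
rewrite Eh -bfam_mulF mulrCA; set h' := mnm_sub _ _.
have dh' : (mdeg h' + d = m1)%N by rewrite -dg2 -dh Eh mdegD mdegMn mdeg1 mul1n.
have mE : (m = (m - d) + d)%N.
  by rewrite subnK // (leq_trans _ gm) // (leq_trans _ (ltnW gm1)) // -dh' leq_addl.
rewrite mE; apply: inspan_mulF; apply: famdet_inspan; first by apply: IH; rewrite ltn_subrL d_gt0 (leq_trans _ gm) // (leq_ltn_trans _ gm1).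
apply: (@deg_le_weaken _ _ (mdeg g1 + mdeg h')).
  rewrite -(leq_add2r d) -mE -addnA dh' -dg2 -mdegD -Eg //.
apply: deg_le_mul; first exact/homog_deg_le/homogX.
exact/homog_deg_le/bfam_homog.
Qed.

Lemma bfam_free m (c : multinom N -> K) : famdet m b != 0 ->
  \sum_(g : I m) c (bmnm g) *: b (bmnm g) = 0 -> forall g, (mdeg g <= m)%N -> c g = 0.
Proof.
move=> /fdet_unit_inverse[f [Hf _]] E g; rewrite -ltnS => gm.
transitivity (\sum_(h : I m) c (bmnm h) * (h == BMultinom gm)%:R).
  by rewrite (bigD1 (BMultinom gm)) //= eqxx mulr1 big1 ?addr0 // => k /negbTE ->; rewrite mulr0.
transitivity (\sum_(h : I m) \sum_(k : I m) c (bmnm h) * (mcoeff (bmnm k) (b (bmnm h)) * f k (BMultinom gm))).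
  by apply: eq_bigr => h _; rewrite -mulr_sumr; congr (_ * _); apply/esym/(Hf h (BMultinom gm)).
rewrite exchange_big /= big1 // => k _.
have := congr1 (mcoeff (bmnm k)) E; rewrite mcoeff0 raddf_sum /= => Ek.
under eq_bigr do rewrite mulrA.
rewrite -mulr_suml (_ : \sum_i _ = 0) ?mul0r // -[RHS]Ek.
by apply: eq_bigr => h _; rewrite mcoeffZ.
Qed.

End Span.

Section Modulus.
Variable R : realType.
Implicit Types x y z : C R.

Lemma modulusM x y : modulus (x * y) = modulus x * modulus y.
Proof. exact: ComplexField.Normc.normcM. Qed.
Lemma modulus0 : modulus (0 : C R) = 0.
Proof. exact: ComplexField.Normc.normc0. Qed.
Lemma modulus1 : modulus (1 : C R) = 1.
Proof. exact: ComplexField.Normc.normc1. Qed.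
Lemma modulusV x : modulus x^-1 = (modulus x)^-1.
Proof. exact: ComplexField.Normc.normcV. Qed.
Lemma modulusD x y : modulus (x + y) <= modulus x + modulus y.
Proof. exact: le_normcD. Qed.
Lemma modulusN x : modulus (- x) = modulus x.
Proof. exact: normcN. Qed.
Lemma modulus_ge0 x : 0 <= modulus x.
Proof. by case: x => a b; rewrite /modulus /= sqrtr_ge0. Qed.
Lemma modulus_eq0 x : (modulus x == 0) = (x == 0).
Proof.
by apply/eqP/eqP => [/ComplexField.Normc.eq0_normc//|->]; exact: modulus0.
Qed.
Lemma modulus_gt0 x : (0 < modulus x) = (x != 0).
Proof. by rewrite lt_neqAle modulus_ge0 andbT eq_sym modulus_eq0. Qed.
Lemma modulusX x k : modulus (x ^+ k) = modulus x ^+ k.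
Proof. by elim: k => [|k IH]; rewrite ?expr0 ?modulus1 // !exprS modulusM IH. Qed.
Lemma modulus_prod (I : Type) (r : seq I) (P : pred I) (f : I -> C R) :
  modulus (\prod_(i <- r | P i) f i) = \prod_(i <- r | P i) modulus (f i).
Proof. exact: (big_morph (@modulus R) modulusM modulus1). Qed.
Lemma modulus_sum (I : Type) (r : seq I) (P : pred I) (f : I -> C R) :
  modulus (\sum_(i <- r | P i) f i) <= \sum_(i <- r | P i) modulus (f i).
Proof.
apply: (big_ind2 (fun x (y : R) => modulus x <= y)) => //; first by rewrite modulus0.
by move=> x1 y1 x2 y2 h1 h2; apply: le_trans (modulusD _ _) (lerD h1 h2).
Qed.
Lemma modulus_norm x : `|x| = (modulus x)%:C%C.
Proof. by case: x. Qed.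
Lemma modulus_real (a : R) : modulus (a%:C%C : C R) = `|a|.
Proof. by rewrite /modulus /= expr0n addr0 sqrtr_sqr. Qed.
Lemma modulus_nat k : modulus (k%:R : C R) = k%:R.
Proof.
have -> : (k%:R : C R) = (k%:R : R)%:C%C by rewrite rmorph_nat.
by rewrite modulus_real ger0_norm.
Qed.
End Modulus.

Section RootBound.
Variable R : realType.

(** As q(0) = 1, q(1) is the product over the roots z of (1 - z) / (0 - z); each factor is one of
    finitely many nonzero numbers, and there are at most t factors. *)
Lemma root_bound (rs : seq (C R)) : 0 \notin rs -> 1 \notin rs ->
  exists c : R, 0 <= c /\ forall (q : {poly C R}) t, (size q <= t.+1)%N -> q.[0] = 1 ->
    (forall z, root q z -> z \in rs) -> q.[1] != 0 /\ `|ln (modulus q.[1])| <= c * t%:R.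
Proof.
move=> rs0 rs1; pose f (z : C R) : C R := (1 - z) / (0 - z).
pose c := \sum_(z <- rs) `|ln (modulus (f z))|; exists c.
have c0 : 0 <= c by apply: sumr_ge0.
split=> // q t sq q0 rq; have qn0 : q != 0.
  by apply: contra_eq_neq q0 => ->; rewrite horner0 eq_sym oner_neq0.
have [s Eq] := closed_field_poly_normal q.
have ss : (size s <= t)%N.
  move: sq; rewrite {1}Eq size_scale ?lead_coef_eq0 // size_prod_XsubC.
  by rewrite ltnS.
have srs z : z \in s -> z \in rs.
  by move=> zs; apply: rq; rewrite Eq rootZ ?lead_coef_eq0 // root_prod_XsubC.
have E1 : q.[1] = \prod_(z <- s) f z.
  rewrite -[LHS]divr1 -[X in _ / X]q0 Eq !hornerZ -mulf_div divff ?lead_coef_eq0 // mul1r.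
  rewrite !horner_prod -prodf_div; apply: eq_bigr => z _.
  by rewrite !hornerXsubC.
have : \prod_(z <- s) f z != 0 /\ `|ln (modulus (\prod_(z <- s) f z))| <= c * (size s)%:R.
  elim: s srs {ss Eq E1} => [|z s IH] srs.
    by rewrite big_nil oner_neq0 modulus1 ln1 normr0 mulr0.
  have [|n0 le] := IH; first by move=> y ys; apply: srs; rewrite inE ys orbT.
  have zrs : z \in rs by apply: srs; rewrite mem_head.
  have fz : f z != 0.
    apply: mulf_neq0; first by rewrite subr_eq0; apply: contraNneq rs1 => ->.
    by rewrite invr_eq0 sub0r oppr_eq0; apply: contraNneq rs0 => <-.
  rewrite big_cons mulf_neq0 //; split=> //.
  rewrite modulusM lnM ?posrE ?modulus_gt0 // (le_trans (ler_normD _ _)) //.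
  rewrite /= -natr1 mulrDr mulr1 addrC lerD //.
  by rewrite /c (big_rem z) //= lerDl sumr_ge0.
rewrite -E1 => -[n0 le]; split=> //; apply: le_trans le _.
by rewrite ler_wpM2l // ler_nat.
Qed.
End RootBound.

Section Estimate.
Variables (R : realType) (N d : nat).
Hypotheses (N_gt0 : (0 < N)%N) (d_gt0 : (0 < d)%N).
Local Notation n := #|coef_index N d|.
Local Notation pw := (fun i : 'I_N => mpolyX (C R) (mnm1 i) ^+ d).
Variable P : {mpoly (C R)[n]}.
Hypothesis irrP : irreducible_elt P.
Hypothesis P1 : meval (gcoefs pw) P = 1.
Hypothesis degP : forall x, meval x P = 0 -> degenerate (ofcoefs x).
Hypothesis P0 : forall H : 'I_N -> {mpoly (C R)[N]}, (forall i, homog d (H i)) ->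
  (exists p, (exists i, p i != 0) /\ forall i, meval p (H i) = 0) -> meval (gcoefs H) P = 0.

Definition fekete_degree m : nat := (N * 'C(N + m, N.+1))%N.
Definition num_monomials m : nat := #|{: bmultinom N m.+1}|.

(** The error per monomial in [codegree_vanish], multiplied by N to compare with [fekete_degree]. *)
Let err := (N * d ^ N * (N * d.-1 + d))%N.

Lemma power_homog i : homog d (pw i).
Proof.
apply/homogP; rewrite -[X in ishomog1 X](mul1n d) mulnC -[(d * 1)%N]mulnC.
by apply: dhomogMn; apply/homogP; rewrite -[X in homog X](mdeg1 i); apply: homogX.
Qed.

(** With k the exponent of P: k N d^N <= k d deg P, then d (k deg P + deg B) = d deg A_m <= D(m),
    and [codegree_vanish] gives D(m) <= k N d^N + err M(m). Subtracting bounds deg B. *)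
Lemma cofactor_degree m (B : {mpoly (C R)[n]}) :
  macaulay N d (C R) m = P ^+ vanish_order N d m * B -> 
  [/\ deg_le (err * num_monomials m) B,
     (vanish_order N d m * (N * d ^ N) <= fekete_degree m)%N &
     (fekete_degree m <= vanish_order N d m * (N * d ^ N) + err * num_monomials m)%N].
Proof.
set k := vanish_order N d m => E.
have A0 : macaulay N d (C R) m != 0.
  apply: contraTneq (oner_neq0 (C R)) => A0; rewrite negbK.
  have := @mmap_macaulay_homog N d (C R) (C R) idfun _ m power_homog.
  by rewrite A0 rmorph0 (eq_famdet _ (@bfam_power _ _ d)) famdet_X => ->.
have Pn0 := irreducible_neq0 irrP.
have B0 : B != 0 by apply: contraNneq A0 => B0; rewrite E B0 mulr0.
have dA : (mdeg (mlead (macaulay N d (C R) m)) <= divsum N d m)%N.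
  by rewrite -ltnS mlead_deg //; apply/deg_leP/macaulay_degree.
move: dA; rewrite E mleadM ?expf_neq0 // mleadX // mdegD mdegMn => dA.
have dP : deg_le (mdeg (mlead P)) P by apply/deg_leP; rewrite mlead_deg.
have := resultant_degree N_gt0 d_gt0 P1 P0 dP.
have dD : (divsum N d m * d <= fekete_degree m)%N.
  rewrite /fekete_degree -degree_sum /divsum big_distrl /=; apply: leq_sum => g _.
  by rewrite (mdeg_divn (bmnm g) d) leq_addr.
have := codegree_vanish N d_gt0 m; rewrite -/k -/(num_monomials m).
have dB : deg_le (mdeg (mlead B)) B by apply/deg_leP; rewrite mlead_deg.
move: dD dA; rewrite /fekete_degree; set T := 'C(_, _); set W := divsum N d m.
set rho := mdeg (mlead P); set dg := mdeg (mlead B); set M := num_monomials m => dD dA cnt res.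
have k1 : (k * (N * d ^ N) + dg * d <= N * T)%N.
  have h1 : (k * (N * d ^ N) <= k * (d * rho))%N by rewrite leq_mul2l res orbT.
  have h2 : ((rho * k + dg) * d <= W * d)%N by rewrite leq_mul2r dA orbT.
  by move: h1 h2 dD; clear; nia.
have k2 : (N * T <= k * (N * d ^ N) + err * M)%N.
  have : (N * T <= N * (d ^ N * (k + (N * d.-1 + d) * M)))%N by rewrite leq_mul2l cnt orbT.
  by rewrite /err; move: (d ^ N)%N (N * d.-1 + d)%N; clear; nia.
split=> //; last by apply: leq_trans k1; rewrite leq_addr.
apply: deg_le_weaken dB; apply: (@leq_trans (dg * d)); first by rewrite leq_pmulr.
by have := leq_trans k1 k2; rewrite leq_add2l.
Qed.

Variable F : 'I_N -> {mpoly (C R)[N]}.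
Hypothesis hF : forall i, homog d (F i).
Hypothesis PF : meval (gcoefs F) P != 0.
Hypothesis goodF : famdet (N * d.-1).+1 (bfam d F) != 0.

(** On the line from (z_i^d) at 0 to F at 1, A_m = P^k B with B = 1 at 0. The power P^k gives the
    main term, and [root_bound] the error, deg B being O(M(m)). *)
Lemma famdet_log_estimate : exists c : R, 0 <= c /\ forall m,
  `|ln (modulus (famdet m (bfam d F))) * (N * d ^ N)%:R
     - (fekete_degree m)%:R * ln (modulus (meval (gcoefs F) P))| <= c * (num_monomials m)%:R.
Proof.
pose x := gcoefs (d := d) pw; pose y k := gcoefs F k - x k.
pose h k := (x k)%:P + 'X * (y k)%:P.
pose ev s := mmap (@polyC (C R)) h.
have hor s (Q : {mpoly (C R)[n]}) : (mmap (@polyC (C R)) h Q).[s] = meval (fun k => x k + s * y k) Q.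
  apply: (@eq_rmorph_mpoly _ _ _ (horner_eval s \o mmap (@polyC (C R)) h) (meval (fun k => x k + s * y k))) => [a|k] /=.
    by rewrite mmapC mevalC /horner_eval hornerC.
  by rewrite mmapX mmap1U mevalXU /horner_eval /h !hornerE.
have at0 Q : (mmap (@polyC (C R)) h Q).[0] = meval x Q.
  by rewrite hor; apply: meval_eq => k; rewrite mul0r addr0.
have at1 Q : (mmap (@polyC (C R)) h Q).[1] = meval (gcoefs F) Q.
  by rewrite hor; apply: meval_eq => k; rewrite mul1r /y addrC subrK.
pose a m := mmap (@polyC (C R)) h (macaulay N d (C R) m).
have a0 m : (a m).[0] = 1.
  rewrite at0; have := @mmap_macaulay_homog N d (C R) (C R) idfun _ m power_homog.
  by rewrite (eq_famdet _ (@bfam_power _ _ d)) famdet_X.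
have a1 m : (a m).[1] = famdet m (bfam d F).
  by rewrite at1; exact: (@mmap_macaulay_homog N d (C R) (C R) idfun _ m hF).
have as_ m s : (a m).[s] = famdet m (bfam d (ofcoefs (fun k => x k + s * y k))).
  by rewrite hor; exact: (@mmap_macaulay N d (C R) (C R) idfun).
pose m1 := (N * d.-1).+1.
have [rs Ers] := closed_field_poly_normal (a m1).
have am1 : a m1 != 0 by apply: contra_eq_neq (a0 m1) => ->; rewrite horner0 eq_sym oner_neq0.
have rsP z : (z \in rs) = root (a m1) z.
  by rewrite [in RHS]Ers rootZ ?lead_coef_eq0 // root_prod_XsubC.
have rs0 : 0 \notin rs by rewrite rsP rootE a0 oner_neq0.
have rs1 : 1 \notin rs by rewrite rsP rootE a1; exact: goodF.
(* By [famdet_all], A_m has no root on the line outside those of A_m1; as this finite set does not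
   depend on m, neither does the constant of [root_bound]. *)
have roots m z : root (a m) z -> z \in rs.
  rewrite rsP !rootE; apply: contraTT; rewrite !as_ => H.
  by apply: famdet_all H => // i; apply: ofcoefs_homog.
have [c [c_ge0 Hc]] := root_bound rs0 rs1.
set L := ln _; exists (err%:R * `|L| + (N * d ^ N)%:R * (c * err%:R)); split.
  by rewrite addr_ge0 // ?mulr_ge0.
move=> m; have [B EB] := resultant_power_divides d_gt0 irrP degP m.
have [dB k1 k2] := cofactor_degree EB.
set k := vanish_order N d m in EB k1 k2.
pose bq := mmap (@polyC (C R)) h B.
have Ea : a m = mmap (@polyC (C R)) h P ^+ k * bq by rewrite /a EB rmorphM rmorphXn.
have bq0 : bq.[0] = 1.
  by have := a0 m; rewrite Ea hornerM horner_exp at0 P1 expr1n mul1r.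
have [||bn0 bl] := Hc bq (err * num_monomials m)%N _ bq0.
- have := @size_mmap_polyC _ _ 1 _ h B dB; rewrite mul1n; apply => j.
  rewrite (leq_trans (size_polyD _ _)) // geq_max (leq_trans (size_polyC_leq1 _)) //=.
  by rewrite mulrC mul_polyC (leq_trans (size_scale_leq _ _)) // size_polyX.
- by move=> z bz; apply: (roots m); rewrite Ea rootM bz orbT.
have -> : famdet m (bfam d F) = meval (gcoefs F) P ^+ k * bq.[1].
  by rewrite -a1 Ea hornerM horner_exp at1.
rewrite modulusM modulusX lnM ?posrE ?exprn_gt0 ?modulus_gt0 // lnXn ?modulus_gt0 // -/L.
rewrite -[L *+ k]mulr_natr.
have -> : (L * k%:R + ln (modulus bq.[1])) * (N * d ^ N)%:R - (fekete_degree m)%:R * L =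
   - ((fekete_degree m)%:R - (k * (N * d ^ N))%:R) * L + ln (modulus bq.[1]) * (N * d ^ N)%:R.
  by rewrite natrM; ring.
rewrite (le_trans (ler_normD _ _)) // mulrDl lerD //.
  rewrite normrM normrN -natrB // normr_nat mulrAC ler_wpM2r // -natrM ler_nat leq_subLR.
  exact: k2.
rewrite normrM normr_nat mulrC -mulrA ler_wpM2l // (le_trans bl) //.
by rewrite natrM mulrA.
Qed.

End Estimate.

(** * Products of iterates and the recursion for their determinant *)

Section IteratedBasis.
Variables (S : comNzRingType) (N d : nat).
Hypothesis d_gt1 : (1 < d)%N.
Let d_gt0 : (0 < d)%N := ltnW d_gt1.
Variable F : 'I_N -> {mpoly S[N]}.
Hypothesis hF : forall i, homog d (F i).

Lemma mdeg_divn_half (g : multinom N) : (mdeg (mdivn g d) <= (mdeg g)./2)%N.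
Proof.
rewrite -divn2 leq_divRL // (mdeg_divn g d).
by apply: leq_trans (leq_addr _ _); rewrite leq_mul2l d_gt1 orbT.
Qed.

(** The recursion q_g = z^(g mod d) (q_(g div d) o F) is not structural. Since g div d has at most
    half the degree of g, any fuel at least |g| gives the same value. *)
Fixpoint qfuel k (g : multinom N) : {mpoly S[N]} :=
  if k is k'.+1 then mpolyX S (mmodn g d) * mcomp F (qfuel k' (mdivn g d)) else 1.

(* The products of z^b0 (F z)^b1 (F^2 z)^b2 ... for the base-d digits b0, b1, b2, ... of g. *)
Definition qfam (g : multinom N) : {mpoly S[N]} := qfuel (mdeg g) g.

Lemma qfuel_deg k g : (mdeg g <= k)%N -> qfuel k g = qfam g.
Proof.
have q0 j g' : mdeg g' = 0%N -> qfuel j g' = 1.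
  elim: j g' => [//|j IH] g' /eqP; rewrite mdeg_eq0 => /eqP -> /=.
  have E0 : mdivn (@mnm0 N) d = @mnm0 N by apply/mnmP => i; rewrite mkmnmE mnm0E div0n.
  have E1 : mmodn (@mnm0 N) d = @mnm0 N by apply/mnmP => i; rewrite mkmnmE mnm0E mod0n.
  by rewrite E0 E1 mpolyX0 mul1r IH ?mdeg0 // rmorph1.
suff H j : (mdeg g <= j)%N -> (mdeg g <= k)%N -> qfuel k g = qfuel j g.
  by move=> gk; apply: H.
elim: k j g => [|k IH] j g; first by rewrite !leqn0 => _ /eqP g0; rewrite !q0.
case: j => [|j]; first by rewrite leqn0 => /eqP g0 _; rewrite !q0.
move=> gj gk /=; congr (_ * mcomp F _); apply: IH.
  by have := mdeg_divn_half g; move: gj; rewrite -divn2; lia.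
by have := mdeg_divn_half g; move: gk; rewrite -divn2; lia.
Qed.

Lemma qfamE g : qfam g = mpolyX S (mmodn g d) * mcomp F (qfam (mdivn g d)).
Proof.
rewrite -(@qfuel_deg (mdeg g).+1) //= (@qfuel_deg (mdeg g)) //.
by have := mdeg_divn_half g; rewrite -divn2; lia.
Qed.

Lemma qfam0 g : mdeg g = 0%N -> qfam g = 1.
Proof. by rewrite /qfam => ->. Qed.

Lemma qfam_homog g : homog (mdeg g) (qfam g).
Proof.
suff H k : (mdeg g <= k)%N -> homog (mdeg g) (qfuel k g) by exact: H.
elim: k g => [|k IH] g gk /=.
  by move: gk; rewrite leqn0 => /eqP ->; exact: homog1.
rewrite {1}(mdeg_divn g d) addnC; apply: homog_mul; first exact: homogX.
apply: homog_mcomp => //; apply: IH.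
by have := mdeg_divn_half g; move: gk; rewrite -divn2; lia.
Qed.

(** A version of [famdet] with a strict degree bound, so that the empty box k = 0 is included: it
    occurs in the recursion when a residue b has degree above m. *)
Definition boxdet k (b : multinom N -> {mpoly S[N]}) : S :=
  fdet (fun g g' : bmultinom N k => mcoeff (bmnm g') (b (bmnm g))).

Lemma bfam_join (a : multinom N) (b : {ffun 'I_N -> 'I_d}) :
  bfam d F (mnm_add (mnm_muln a d) (digit_mnm b)) = mmap1 F a * mpolyX S (digit_mnm b).
Proof. by rewrite /bfam mdivn_add ?mmodn_add // => i; rewrite mkmnmE ltn_ord. Qed.

Lemma qfam_join (a : multinom N) (b : {ffun 'I_N -> 'I_d}) :
  qfam (mnm_add (mnm_muln a d) (digit_mnm b)) = mpolyX S (digit_mnm b) * mcomp F (qfam a).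
Proof. by rewrite qfamE mdivn_add ?mmodn_add // => i; rewrite mkmnmE ltn_ord. Qed.

(** Expanding q_a in monomials z^a' and composing with F, q_(d a + b) = z^b (q_a o F) is a
    combination of the F^a' z^b with the same residue b. The matrix of q in the family F^a z^b is
    thus block diagonal, and its block at b is the matrix of q in a lower degree. *)
Lemma qdet_recursion m :
  famdet m qfam = (\prod_(b : {ffun 'I_N -> 'I_d}) boxdet (quo_bound m b) qfam) * famdet m (bfam d F).
Proof.
pose lo (g : bmultinom N m.+1) := low_digit d_gt0 (bmnm g).
pose W (g g' : bmultinom N m.+1) : S :=
  if lo g == lo g' then mcoeff (mdivn (bmnm g') d) (qfam (mdivn (bmnm g) d)) else 0.
have Ejd (b : {ffun 'I_N -> 'I_d}) (a : bmultinom N (quo_bound m b)) : mdivn (bmnm (join_digit d_gt0 a)) d = bmnm a.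
  by rewrite /= mdivn_add // => i; rewrite mkmnmE ltn_ord.
have -> : \prod_(b : {ffun 'I_N -> 'I_d}) boxdet (quo_bound m b) qfam = fdet W.
  have W0 g g' : lo g != lo g' -> W g g' = 0 by move=> /negbTE ne; rewrite /W ne.
  have -> := fdet_block (@join_digit_inj _ _ d_gt0 m) (@join_digit_low _ _ d_gt0 m)
     (@join_digit_surj _ _ d_gt0 m) W0.
  apply: eq_bigr => b _; apply: eq_fdet => a a'; rewrite /W /lo !join_digit_low eqxx.
  by rewrite !Ejd.
rewrite -fdet_mul; apply: eq_fdet => g l.
have [a Ea] := join_digit_surj d_gt0 g; set b := low_digit d_gt0 (bmnm g) in a Ea *.
rewrite -{1}Ea qfam_join.
have aq : (mmeasure mdeg (qfam (bmnm a)) <= quo_bound m b)%N.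
  by apply: leq_trans (bmdeg a); apply/deg_leP/homog_deg_le/qfam_homog.
rewrite {1}(mpolywE aq) raddf_sum /= mulr_sumr raddf_sum /=.
rewrite (big_sigma (c := lo) (phi := join_digit d_gt0 (m := m))
     (@join_digit_inj _ _ d_gt0 m) (@join_digit_low _ _ d_gt0 m) (@join_digit_surj _ _ d_gt0 m)).
rewrite (bigD1 b) //= [X in _ = _ + X]big1 ?addr0; last first.
  move=> b' bb'; rewrite big1 // => a' _; rewrite /W /lo join_digit_low.
  by rewrite -/b eq_sym (negbTE bb') mul0r.
apply: eq_bigr => a' _; rewrite mcompZ -scalerAr mcoeffZ mcompX mulrC [mpolyX _ _ * _]mulrC -bfam_join mulrC.
by rewrite /W /lo join_digit_low -/b eqxx Ejd -{1}Ea Ejd.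
Qed.

End IteratedBasis.

Section QdetEstimate.
Variables (R : realType) (N d : nat).
Hypotheses (N_gt0 : (0 < N)%N) (d_gt1 : (1 < d)%N).
Let d_gt0 : (0 < d)%N := ltnW d_gt1.
Variable F : 'I_N -> {mpoly (C R)[N]}.
Hypothesis hF : forall i, homog d (F i).
Hypothesis A_neq0 : forall m, famdet m (bfam d F) != 0.
Variables (L c : R).
Hypothesis c_ge0 : 0 <= c.
Hypothesis A_est : forall m, `|ln (modulus (famdet m (bfam d F))) * (N * d ^ N)%:R
     - (fekete_degree N m)%:R * L| <= c * (num_monomials N m)%:R.

Definition boxdeg k : nat := (\sum_(g : bmultinom N k) mdeg (bmnm g))%N.
Definition boxcard k : nat := #|{: bmultinom N k}|.

Lemma boxdeg_digits m : (boxdeg m.+1 = (\sum_(b : {ffun 'I_N -> 'I_d}) boxdeg (quo_bound m b)) * d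
  + \sum_(b : {ffun 'I_N -> 'I_d}) digit_deg b * boxcard (quo_bound m b))%N.
Proof.
rewrite /boxdeg (big_digits d_gt0 _ m (@mdeg N)) big_distrl -big_split /=.
apply: eq_bigr => b _; rewrite big_distrl /= mulnC /boxcard -sum1_card big_distrl -big_split /=.
by apply: eq_bigr => a _; rewrite mdegD mdegMn digit_mnm_deg mul1n.
Qed.

Lemma boxcard_digits m : (boxcard m.+1 = \sum_(b : {ffun 'I_N -> 'I_d}) boxcard (quo_bound m b))%N.
Proof.
rewrite /boxcard -sum1_card (big_digits d_gt0 _ m (fun=> 1%N)).
by apply: eq_bigr => b _; rewrite sum1_card.
Qed.

Lemma up_log_half m (b : {ffun 'I_N -> 'I_d}) : (0 < m)%N ->
  ((up_log 2 (quo_bound m b)).+1 <= up_log 2 m.+1)%N.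
Proof.
move=> m0; have H := up_logP m.+1 (ltnSn 1).
case E : (up_log 2 m.+1) H => [|u] H; first by rewrite expn0 in H; lia.
rewrite ltnS; apply: up_log_min => //.
have : (quo_bound m b <= (m %/ 2).+1)%N.
  rewrite /quo_bound; case: ifP => // _; rewrite ltnS.
  apply: leq_trans (leq_div2r _ (leq_subr _ _)) _; exact: leq_div2l.
by rewrite expnS in H; lia.
Qed.

Lemma boxdet_neq0 k : boxdet k (qfam d F) != 0.
Proof.
elim/ltn_ind: k => -[_|m IH].
  rewrite /boxdet /fdet (_ : \det _ = 1) ?oner_neq0 //.
  have k0 : #|{: bmultinom N 0}| = 0%N by apply: eq_card0 => -[g].
  by move: (fun _ _ => _); rewrite k0 => f; rewrite det_mx00.
have -> : boxdet m.+1 (qfam d F) = famdet m (qfam d F) by [].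
case: m IH => [|m] IH.
  rewrite (_ : famdet 0 _ = 1) ?oner_neq0 // -[RHS](famdet_X (C R) N 0).
  by apply: eq_fdet => g g'; have := bmdeg g; rewrite ltnS leqn0 => g0;
     rewrite qfam0 ?(eqP g0) //; move: g0; rewrite mdeg_eq0 => /eqP ->; rewrite mpolyX0.
rewrite qdet_recursion // mulf_neq0 //; apply/prodf_neq0 => b _; apply: IH.
rewrite /quo_bound; case: ifP => // _; rewrite ltnS.
apply: leq_ltn_trans (leq_div2r _ (leq_subr _ _)) _; exact: ltn_Pdiv.
Qed.

(** The solution of kap (1 - 1/d) = 1 / (N d^N), which makes D L kap reproduce itself under the
    recursion up to lower order terms. *)
Let kap : R := (N * d ^ N.-1 * d.-1)%:R^-1.

(** Each level of the recursion costs a constant times the number of monomials, and the boxes of one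
    level together have as many monomials as the box they come from. The number of levels is bounded
    by [up_log_half]. *)
Lemma qdet_estimate : exists c' : R, 0 <= c' /\ forall k,
  `|ln (modulus (boxdet k (qfam d F))) - (boxdeg k)%:R * L * kap|
     <= c' * (up_log 2 k)%:R * (boxcard k)%:R.
Proof.
(* The first term is the error in [A_est]; the second comes from the residues b, whose degrees are
   left over when |d a + b| is replaced by d |a|. *)
pose c' := c / (N * d ^ N)%:R + `|L * kap| * N%:R.
have c'0 : 0 <= c' by rewrite addr_ge0 // ?mulr_ge0 ?invr_ge0.
exists c'; split=> //; elim/ltn_ind => -[_|[_|m]].
- have E : boxcard 0 = 0%N by apply: eq_card0 => -[g].
  have -> : boxdeg 0 = 0%N by rewrite /boxdeg big1 // => -[g].
  rewrite E !mul0r subr0 !mulr0 /boxdet /fdet.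
  have -> : \det (\matrix_(i < #|{: bmultinom N 0}|, j < #|{: bmultinom N 0}|)
      mcoeff (bmnm (enum_val j)) (qfam d F (bmnm (enum_val i)))) = 1.
    by move: (fun _ _ => _); rewrite (E : #|{: bmultinom N 0}| = 0%N) => f; rewrite det_mx00.
  by rewrite modulus1 ln1 normr0.
- have -> : boxdeg 1 = 0%N by rewrite /boxdeg big1 // => g _; have := bmdeg g; lia.
  have -> : boxdet 1 (qfam d F) = 1.
    rewrite -[RHS](famdet_X (C R) N 0); apply: eq_fdet => g g'; have := bmdeg g.
    rewrite ltnS leqn0 => g0; rewrite qfam0 ?(eqP g0) //.
    by move: g0; rewrite mdeg_eq0 => /eqP ->; rewrite mpolyX0.
  by rewrite modulus1 ln1 !mul0r subrr normr0 !mulr_ge0.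
set m' := m.+1 => IH.
have ndN : (N * d ^ N)%:R = (N * d ^ N.-1)%:R * d%:R :> R.
  by rewrite -natrM -mulnA -expnSr prednK.
have n0 : (N * d ^ N.-1)%:R != 0 :> R.
  by rewrite pnatr_eq0 muln_eq0 negb_or -!lt0n N_gt0 expn_gt0 d_gt0.
have dd : d%:R != 0 :> R by rewrite pnatr_eq0 -lt0n.
have d1 : d.-1%:R != 0 :> R by rewrite pnatr_eq0 -lt0n; case: (d) d_gt1 => [|[|]].
have kapE : kap * d%:R - kap = d%:R / (N * d ^ N)%:R.
  have Ed : d%:R = d.-1%:R + 1 :> R by rewrite natr1 prednK.
  have -> : kap = ((N * d ^ N.-1)%:R * d.-1%:R)^-1 by rewrite /kap -natrM.
  rewrite ndN; move: (_ ^ _)%N n0 => A; move: (N * A)%:R d.-1%:R d1 dd Ed => a e e0 + Ed a0.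
  rewrite Ed => e1; field.
  by rewrite a0 e0 e1.
have -> : boxdet m'.+1 (qfam d F) = famdet m' (qfam d F) by [].
rewrite qdet_recursion // modulusM modulus_prod.
have pos b : 0 < modulus (boxdet (quo_bound m' b) (qfam d F)).
  by rewrite modulus_gt0 boxdet_neq0.
rewrite lnM ?posrE ?modulus_gt0 ?prodr_gt0 //.
have -> : ln (\prod_(b : {ffun 'I_N -> 'I_d}) modulus (boxdet (quo_bound m' b) (qfam d F))) =
    \sum_(b : {ffun 'I_N -> 'I_d}) ln (modulus (boxdet (quo_bound m' b) (qfam d F))).
  pose Q (x y : R) := 0 < x /\ ln x = y.
  suff : Q (\prod_(b : {ffun 'I_N -> 'I_d}) modulus (boxdet (quo_bound m' b) (qfam d F)))
     (\sum_(b : {ffun 'I_N -> 'I_d}) ln (modulus (boxdet (quo_bound m' b) (qfam d F)))) by move=> [_ ->].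
  apply: (big_rec2 Q); first by rewrite /Q ln1 ltr01.
  by move=> b x y _ [x0 <-]; rewrite /Q mulr_gt0 // lnM ?posrE.
set lnA := ln (modulus (famdet m' (bfam d F))).
pose S1 : R := (\sum_(b : {ffun 'I_N -> 'I_d}) boxdeg (quo_bound m' b))%:R.
pose S2 : R := (\sum_(b : {ffun 'I_N -> 'I_d}) digit_deg b * boxcard (quo_bound m' b))%:R.
have ED : (boxdeg m'.+1)%:R = S1 * d%:R + S2.
  by rewrite boxdeg_digits natrD natrM.
have A' := A_est m'.
have EF : fekete_degree N m' = boxdeg m'.+1 by rewrite /fekete_degree -degree_sum.
rewrite EF in A'.
have -> : \sum_(b : {ffun 'I_N -> 'I_d}) ln (modulus (boxdet (quo_bound m' b) (qfam d F))) + lnA - (boxdeg m'.+1)%:R * L * kap =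
   \sum_(b : {ffun 'I_N -> 'I_d}) (ln (modulus (boxdet (quo_bound m' b) (qfam d F))) - (boxdeg (quo_bound m' b))%:R * L * kap)
   + ((lnA * (N * d ^ N)%:R - (boxdeg m'.+1)%:R * L) / (N * d ^ N)%:R - L * kap * (S2 / d%:R)).
  rewrite sumrB -!mulr_suml -natr_sum -/S1.
  set X := \sum_b _; set D := (boxdeg m'.+1)%:R in ED *.
  have E1 : (lnA * (N * d ^ N)%:R - D * L) / (N * d ^ N)%:R = lnA - D * L * (kap - kap / d%:R).
    have -> : kap - kap / d%:R = (N * d ^ N)%:R^-1.
      apply: (mulIf dd); rewrite mulrBl divfK // kapE mulrC.
      by [].
    by rewrite mulrBl mulfK // ndN mulf_neq0.
  rewrite E1; have -> : S1 = (D - S2) / d%:R by rewrite ED addrK mulfK.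
  by field.
have cardE : (boxcard m'.+1)%:R = \sum_(b : {ffun 'I_N -> 'I_d}) (boxcard (quo_bound m' b))%:R :> R.
  by rewrite boxcard_digits natr_sum.
have S2le : `|S2 / d%:R| <= N%:R * (boxcard m'.+1)%:R.
  rewrite ger0_norm ?divr_ge0 // ler_pdivrMr ?ltr0n // -!natrM ler_nat boxcard_digits big_distrr big_distrl /=.
  apply: leq_sum => b _; rewrite mulnAC leq_mul2r; apply/orP; right.
  apply: leq_trans (digit_deg_le d_gt0 b) _; by rewrite leq_mul2l leq_pred orbT.
have up1 : (0 < up_log 2 m'.+1)%N.
  by apply: leq_trans (up_log_half [ffun=> Ordinal d_gt0] (ltn0Sn m)).
have -> : c' * (up_log 2 m'.+1)%:R * (boxcard m'.+1)%:R =
    c' * (up_log 2 m'.+1).-1%:R * (boxcard m'.+1)%:R + c' * (boxcard m'.+1)%:R.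
  by rewrite -[in LHS](prednK up1) -natr1; ring.
apply: le_trans (ler_normD _ _) _; apply: lerD.
  rewrite (le_trans (ler_norm_sum _ _ _)) // cardE mulr_sumr; apply: ler_sum => b _.
  have qb : (quo_bound m' b < m'.+1)%N.
    rewrite /quo_bound; case: ifP => // _; rewrite ltnS.
    by apply: leq_ltn_trans (leq_div2r _ (leq_subr _ _)) _; exact: ltn_Pdiv.
  apply: le_trans (IH _ qb) _; rewrite ler_wpM2r // ler_wpM2l // ler_nat.
  by rewrite -ltnS (leq_trans (up_log_half b (ltn0Sn m))) // leqSpred.
apply: le_trans (ler_normB _ _) _; rewrite /c' [X in _ <= X]mulrDl; apply: lerD.
  rewrite normrM normfV normr_nat mulrAC ler_wpM2r ?invr_ge0 //.
by rewrite normrM -mulrA ler_wpM2l.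
Qed.

End QdetEstimate.

(** * Selection of minors and products over grids of a torus *)

Section Selection.
Variable R : realType.

Lemma max_over (I : finType) (i0 : I) (V : I -> R) : exists i, forall j, V j <= V i.
Proof. by have := @arg_maxP _ R I i0 xpredT V isT; case=> i _ H; exists i => j; apply: H. Qed.

(** Expanding an n by n determinant along its last row and keeping the largest term costs a factor n
    B. This is repeated until [s] rows remain, and 1 <= B allows the uniform bound n! B^n. *)
Lemma laplace_ord s (B : R) : 1 <= B -> forall n (le : (s <= n)%N) (A : 'M[C R]_n),
  (forall i j, modulus (A i j) <= B) ->
  exists f : 'I_s -> 'I_n, modulus (\det A) <=
    n`!%:R * B ^+ n * modulus (\det (\matrix_(i, j) A (widen_ord le i) (f j))).
Proof.
move=> B1 n; have fB k : 1 <= (k`!%:R * B ^+ k : R).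
  by rewrite -[X in X <= _](mul1r 1) ler_pM // ?exprn_ege1 // ler1n fact_gt0.
elim: n => [|n IH] le A HA.
  case: s le => // le; exists id; rewrite det_mx00 (_ : \det _ = 1) ?modulus1 ?mulr1 //.
  by rewrite det_mx00.
have [E|lt] := eqVneq s n.+1.
  move: le; rewrite E => le; exists id.
  have -> : \matrix_(i, j) A (widen_ord le i) j = A.
    by apply/matrixP => i j; rewrite mxE; congr (A _ _); apply: val_inj.
  by rewrite ler_peMl ?modulus_ge0.
have le' : (s <= n)%N by rewrite -ltnS ltn_neqAle lt.
pose A' j := row' ord_max (col' j A).
have HA' j a b : modulus (A' j a b) <= B by rewrite !mxE.
pose V (f : 'I_s -> 'I_n.+1) := modulus (\det (\matrix_(i, j) A (widen_ord le i) (f j))).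
have H j : exists f, modulus (\det (A' j)) <= n`!%:R * B ^+ n * V f.
  have [f Hf] := IH le' _ (HA' j); exists (fun a => lift j (f a)); rewrite /V.
  apply: le_trans Hf _; rewrite (_ : \matrix_(_, _) _ =
    \matrix_(i, j0) A (widen_ord le i) (lift j (f j0))) //.
  apply/matrixP => a b; rewrite !mxE; congr (A _ _); apply: val_inj => /=.
  by rewrite /bump leqNgt (leq_trans (ltn_ord a) le').
have [f Hf] := choice H; have [j0 Hj0] := max_over ord_max (fun j => V (f j)).
exists (f j0); rewrite -/(V (f j0)) (expand_det_row _ ord_max).
apply: le_trans (modulus_sum _ _ _) _.
have -> : n.+1`!%:R * B ^+ n.+1 * V (f j0) = \sum_(j < n.+1) B * (n`!%:R * B ^+ n * V (f j0)).
  by rewrite sumr_const card_ord factS natrM exprS -[in RHS]mulr_natl; ring.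
apply: ler_sum => j _; rewrite modulusM /cofactor modulusM modulusX modulusN modulus1 expr1n mul1r.
rewrite ler_pM ?modulus_ge0 ?HA //; apply: le_trans (Hf j) _.
by rewrite ler_wpM2l // (le_trans ler01).
Qed.

Lemma enum_extend (I S : finType) (phi : S -> I) : injective phi ->
  exists n (le : (#|S| <= n)%N) (e : 'I_n -> I),
    [/\ bijective e, n = #|I| & forall i, e (widen_ord le i) = phi (enum_val i)].
Proof.
move=> inj_phi; pose K := {i : I | [forall a, phi a != i]}.
have Kn (k : K) a : (phi a == val k) = false.
  by apply/negbTE; case: k => i /= Hi; apply: (forallP Hi).
pose e (k : 'I_(#|S| + #|{: K}|)) : I :=
  match fintype.split k with
  | inl a => phi (enum_val a)
  | inr b => val (enum_val b)
  end.
have inj_e : injective e.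
  move=> i j; rewrite /e; case: fintype.splitP => a ia; case: fintype.splitP => b jb.
  - by move=> /inj_phi /enum_val_inj ab; apply: val_inj; rewrite /= ia jb ab.
  - by move/eqP; rewrite Kn.
  - by move/esym/eqP; rewrite Kn.
  - by move/val_inj/enum_val_inj=> ab; apply: val_inj; rewrite /= ia jb ab.
have se i : exists k, e k = i.
  have [Hi|] := boolP [forall a, phi a != i].
    exists (rshift _ (enum_rank (exist _ i Hi : K))); rewrite /e.
    case: fintype.splitP => k /= kE; first by have := ltn_ord k; rewrite -kE ltnNge leq_addr.
    by move/addnI: kE => /val_inj <-; rewrite enum_rankK.
  rewrite negb_forall => /existsP[a /negPn/eqP <-].
  exists (lshift _ (enum_rank a)); rewrite /e; case: fintype.splitP => k /= kE.
    by rewrite -(val_inj kE) enum_rankK.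
  by have := ltn_ord (enum_rank a); rewrite {1}kE ltnNge leq_addr.
have [g eg] := choice se.
have be : bijective e by exists g => // k; apply: inj_e; rewrite eg.
have le : (#|S| <= #|S| + #|{: K}|)%N by apply: leq_addr.
exists (#|S| + #|{: K}|)%N, le, e; split=> //.
  by rewrite -(bij_eq_card be) card_ord.
move=> i; rewrite /e; case: fintype.splitP => k /= kE; first by rewrite (val_inj kE).
by have := ltn_ord i; rewrite {1}kE ltnNge leq_addr.
Qed.

(* The Laplace expansion along the rows in the image of [phi]. *)
Lemma laplace_select (I S : finType) (phi : S -> I) (A : I -> I -> C R) (B : R) :
  injective phi -> 1 <= B -> (forall i j, modulus (A i j) <= B) ->
  exists f : S -> I, modulus (fdet A) <=
    (#|I|)`!%:R * B ^+ #|I| * modulus (fdet (fun s t => A (phi s) (f t))).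
Proof.
move=> inj_phi B1 HA; have [n [le [e [be En Ee]]]] := enum_extend inj_phi.
have [f Hf] := @laplace_ord _ _ B1 n le (\matrix_(i, j) A (e i) (e j))
  (fun i j => eq_ind_r (fun x => modulus x <= B) (HA _ _) (mxE _ _ _ _)).
exists (fun t => e (f (enum_rank t))); rewrite -(det_reindex _ be) -En.
apply: le_trans Hf _; rewrite /fdet (_ : \matrix_(_, _) _ = \matrix_(i, j)
   A (phi (enum_val i)) (e (f (enum_rank (enum_val j))))) //.
by apply/matrixP => i j; rewrite !mxE Ee enum_valK.
Qed.

End Selection.

Section Torus.
Variables (R : realType) (N : nat).
Implicit Types (p Q : {mpoly (C R)[N]}).

Lemma sum_prim_root n (w : C R) j : n.-primitive_root w -> ~~ (n %| j)%N ->
  \sum_(k < n) w ^+ (k * j) = 0.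
Proof.
move=> pw nj; have w1 : w ^+ j != 1 by rewrite -(prim_order_dvd pw).
have : (w ^+ j - 1) * \sum_(k < n) (w ^+ j) ^+ k = 0.
  by rewrite -subrX1 -exprM mulnC exprM (prim_expr_order pw) expr1n subrr.
move/eqP; rewrite mulf_eq0 subr_eq0 (negbTE w1) /= => /eqP E.
by rewrite -{}[in RHS]E; apply: eq_bigr => k _; rewrite -exprM mulnC.
Qed.

Lemma modulus_prim_root n (w : C R) : n.-primitive_root w -> modulus w = 1.
Proof.
move=> pw; have := norm_prim_root pw; rewrite modulus_norm => /eqP.
by rewrite eq_complex /= eqxx andbT => /eqP.
Qed.

(** Discrete Cauchy formula: the coefficient is the mean of Q(theta) theta^(-m) over a grid of roots
    of unity, so the largest modulus on the grid bounds it. *)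
Lemma torus_coef Q m : exists theta : 'I_N -> C R,
  (forall i, modulus (theta i) = 1) /\ modulus (mcoeff m Q) <= modulus (meval theta Q).
Proof.
have [D dQ] : exists D, deg_le D Q.
  by exists (mmeasure mdeg Q); apply/deg_leP; apply: leqnSn.
(* Large enough that exponents g_i <= D and m_i are equal as soon as they agree mod n; below, w^(n -
   m_i) stands for w^(-m_i). *)
pose n := (D + mdeg m).+1; have n0 : (0 < n)%N by [].
have [w pw] := prim_root_exists (C R) n0.
have w1 k : modulus (w ^+ k) = 1 by rewrite modulusX (modulus_prim_root pw) expr1n.
pose th (k : {ffun 'I_N -> 'I_n}) i := w ^+ k i.
pose G := {ffun 'I_N -> 'I_n}.
have key (g : multinom N) : (mdeg g <= D)%N ->
    \sum_(k : G) (\prod_i w ^+ (k i * (n - m i)) * \prod_i th k i ^+ g i) =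
    (n ^ N)%:R * (g == m)%:R.
  move=> gD; under eq_bigr do rewrite -big_split /=.
  rewrite -(bigA_distr_bigA (fun i (k : 'I_n) => w ^+ (k * (n - m i)) * (w ^+ k) ^+ g i)) /=.
  have [->|gm] := eqVneq g m.
    rewrite mulr1 (eq_bigr (fun=> n%:R)); first by rewrite prodr_const card_ord natrX.
    move=> i _; rewrite (eq_bigr (fun=> 1)) ?sumr_const ?card_ord // => k _.
    rewrite -exprM -exprD -mulnDr subnK ?exprM 1?exprAC ?(prim_expr_order pw) ?expr1n //.
    by rewrite /n (leq_trans (mnm_le_mdeg m i)) // leqW // leq_addl.
  have /existsP[i ni] : [exists i, g i != m i].
    rewrite -negb_forall; apply: contraNN gm => /forallP E.
    by apply/eqP/mnmP => i; apply/eqP.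
  rewrite mulr0 (bigD1 i) //= -[RHS](mul0r (\prod_(j < N | j != i)
    \sum_(k < n) w ^+ (k * (n - m j)) * (w ^+ k) ^+ g j)); congr (_ * _).
  under eq_bigr do rewrite -exprM -exprD -mulnDr.
  apply: (sum_prim_root pw).
  have gi := mnm_le_mdeg g i; have mi := mnm_le_mdeg m i.
  have ni' : g i <> m i by apply/eqP.
  apply/negP => /dvdnP[q Eq]; move: Eq; rewrite /n in gi mi ni' *.
  move: (mdeg g) (mdeg m) (g i) (m i) gD gi mi ni' => a b x y.
  by case: q => [|[|q]]; rewrite ?mul0n ?mul1n ?mulSn; lia.
have E : \sum_(k : G) (\prod_i w ^+ (k i * (n - m i))) * meval (th k) Q = (n ^ N)%:R * mcoeff m Q.
  under eq_bigr do rewrite {1}(deg_le_expand dQ) raddf_sum mulr_sumr /=.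
  rewrite exchange_big /= {2}(deg_le_expand dQ) raddf_sum mulr_sumr /=.
  apply: eq_bigr => g _; rewrite mcoeffZ mcoeffX mulrCA -key; last by rewrite -ltnS bmdeg.
  by rewrite mulr_sumr; apply: eq_bigr => k _; rewrite mevalZ mevalX mulrCA.
have nN : 0 < ((n ^ N)%:R : R) by rewrite ltr0n expn_gt0 n0.
have [k Hk] := @max_over R G [ffun=> ord0] (fun k => modulus (meval (th k) Q)).
exists (th k); split; first by move=> i; apply: w1.
rewrite -(ler_pM2l nN) -(modulus_nat R) -modulusM -E modulus_nat.
apply: le_trans (modulus_sum _ _ _) _.
have -> : (n ^ N)%:R * modulus (meval (th k) Q) = \sum_(k' : G) modulus (meval (th k) Q).
  by rewrite sumr_const mulr_natl card_ffun !card_ord.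
apply: ler_sum => k' _; rewrite modulusM modulus_prod big1 ?mul1r ?Hk // => i _; exact: w1.
Qed.

Definition dilate (a : 'I_N -> C R) p := mcomp (fun i => a i *: mpolyX (C R) (mnm1 i)) p.

Lemma meval_dilate a v p : meval v (dilate a p) = meval (fun i => a i * v i) p.
Proof. by rewrite meval_mcomp; apply: meval_eq => i; rewrite mevalZ mevalXU. Qed.

Lemma mcoeff_dilate a p m : mcoeff m (dilate a p) = (\prod_i a i ^+ m i) * mcoeff m p.
Proof.
have -> : dilate a p = \sum_(g <- msupp p) mcoeff g p *: dilate a (mpolyX _ g).
  rewrite {1}/dilate {1}(mpolyE p) /mcomp raddf_sum; apply: eq_bigr => g _.
  exact: mcompZ.
rewrite [in RHS](mpolyE p) !raddf_sum mulr_sumr; apply: eq_bigr => g _ /=.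
rewrite !mcoeffZ mulrCA; congr (_ * _).
have -> : dilate a (mpolyX _ g) =
    (\prod_i a i ^+ g i) *: mpolyX _ g.
  rewrite /dilate /mcomp mmapX /mmap1 /=; under eq_bigr do rewrite exprZn.
  by rewrite scaler_prod -mpolyXE_id.
by rewrite mcoeffZ mcoeffX; case: eqP => [->|_] //; rewrite !mulr0.
Qed.

Lemma mlead_dilate a p : (forall i, a i != 0) -> mlead (dilate a p) = mlead p.
Proof.
move=> a0; have H m : (m \in msupp (dilate a p)) = (m \in msupp p).
  rewrite !mcoeff_msupp mcoeff_dilate mulf_eq0 negb_or andbC.
  by case: eqP => //= _; apply/prodf_neq0 => i _; rewrite expf_neq0.
have [->|p0] := eqVneq p 0; first by rewrite /dilate /mcomp raddf0.
have d0 : dilate a p != 0.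
  apply/eqP => E; have := mlead_supp p0; rewrite -H E.
  by rewrite msupp0.
apply/eqP; rewrite eq_le !msupp_le_mlead //; first by rewrite H mlead_supp.
by rewrite -H mlead_supp.
Qed.

(** One rotation theta must keep p away from 0 over the whole grid, in geometric mean. The product
    over the grid is a polynomial in theta whose leading coefficient has modulus c^|J|, where c is
    the modulus of the leading coefficient of p(r z); [torus_coef] then yields theta, and c does not
    depend on the grid. *)
Lemma torus_grid_lower p (r : C R) : p != 0 -> r != 0 ->
  exists2 c : R, 0 < c & forall (J : finType) (om : J -> 'I_N -> C R),
   (forall j i, modulus (om j i) = 1) ->
   exists theta : 'I_N -> C R, (forall i, modulus (theta i) = 1) /\
     c ^+ #|J| <= \prod_j modulus (meval (fun i => r * (om j i * theta i)) p).
Proof.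
move=> p0 r0; pose p' := dilate (fun=> r) p.
have p'0 : mleadc p' != 0.
  rewrite mlead_dilate // mcoeff_dilate mulf_neq0 ?mleadc_eq0 //.
  by apply/prodf_neq0 => i _; rewrite expf_neq0.
have Ep' v : meval v p' = meval (fun i => r * v i) p by rewrite meval_dilate.
move: p' p'0 Ep' => p' p'0 Ep'; exists (modulus (mleadc p')); first by rewrite modulus_gt0.
move=> J om om1; have om0 j i : om j i != 0.
  by rewrite -modulus_eq0 om1 oner_eq0.
have E := mleadc_prod (index_enum J) xpredT (fun j => dilate (om j) p').
have [th [th1 H]] := torus_coef (\prod_j dilate (om j) p')
  (\big[mnm_add/@mnm0 N]_(j : J) mlead (dilate (om j) p')).
exists th; split=> //; move: H; rewrite {}E (rmorph_prod (meval th)) !modulus_prod.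
have -> : \prod_(j : J) modulus (mleadc (dilate (om j) p')) = modulus (mleadc p') ^+ #|J|.
  rewrite (eq_bigr (fun=> modulus (mleadc p'))); first by rewrite prodr_const.
  move=> j _; rewrite (mlead_dilate _ (om0 j)) mcoeff_dilate modulusM modulus_prod.
  by rewrite [X in X * _]big1 ?mul1r // => i _; rewrite modulusX om1 expr1n.
move/le_trans; apply; rewrite le_eqVlt; apply/orP; left; apply/eqP.
by apply: eq_bigr => j _; rewrite /= meval_dilate Ep'.
Qed.

End Torus.

(** * Fibres of a free polynomial map *)

Lemma trig_mul (S : pzRingType) n (A B : 'M[S]_n) : is_trig_mx A -> is_trig_mx B ->
  is_trig_mx (A *m B) /\ forall l, (A *m B) l l = A l l * B l l.
Proof.
move=> /is_trig_mxP tA /is_trig_mxP tB; split.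
  apply/is_trig_mxP => i j ij; rewrite mxE big1 // => k _.
  have [ik|ki] := ltnP i k; first by rewrite tA // mul0r.
  by rewrite tB ?mulr0 // (leq_ltn_trans ki).
move=> l; rewrite mxE (bigD1 l) //= big1 ?addr0 // => k kl.
have [lk|] := ltnP l k; first by rewrite tA // mul0r.
by rewrite leq_eqVlt (inj_eq val_inj) (negbTE kl) /= => kl'; rewrite tB // mulr0.
Qed.

Lemma trig_add (S : pzRingType) n (A B : 'M[S]_n) :
  is_trig_mx A -> is_trig_mx B -> is_trig_mx (A + B).
Proof.
move=> /is_trig_mxP tA /is_trig_mxP tB; apply/is_trig_mxP => i j ij.
by rewrite mxE tA ?tB ?addr0.
Qed.

Lemma mpoly_closure (K : comNzRingType) N (Q : {mpoly K[N]} -> Prop) :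
  (forall a, Q (mpolyC N a)) -> (forall p q, Q p -> Q q -> Q (p + q)) ->
  (forall p q, Q p -> Q q -> Q (p * q)) -> (forall k, Q (mpolyX K (mnm1 k))) -> forall p, Q p.
Proof.
move=> QC QD QM QX p; rewrite (mpolyE p); apply: big_ind => [||m _].
- by rewrite -(mpolyC0 N); apply: QC.
- exact: QD.
rewrite -mul_mpolyC; apply: (QM) => //; rewrite mpolyXE_id.
apply: big_ind => [||k _]; rewrite -?(mpolyC1 N); [exact: QC|exact: QM|].
elim: (m k) => [|e IH]; first by rewrite expr0 -(mpolyC1 N); apply: QC.
by rewrite exprS; apply: QM.
Qed.

(** On triangular matrices each diagonal entry is multiplicative and additive, hence is evaluation
    at the point formed by the diagonal entries of the variables. *)
Lemma trig_eval (K : comNzRingType) N n (B : {mpoly K[N]} -> 'M[K]_n) :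
  (forall p q, B (p * q) = B p *m B q) -> (forall p q, B (p + q) = B p + B q) ->
  (forall a, B (mpolyC N a) = a%:M) -> (forall k, is_trig_mx (B (mpolyX K (mnm1 k)))) ->
  forall p, is_trig_mx (B p) /\
    forall l, B p l l = meval (fun k => B (mpolyX K (mnm1 k)) l l) p.
Proof.
move=> BM BD BC trX; pose z l k := B (mpolyX K (mnm1 k)) l l.
pose Q p := is_trig_mx (B p) /\ forall l, B p l l = meval (z l) p.
have QM p q : Q p -> Q q -> Q (p * q).
  move=> [tp dp] [tq dq]; have [t d] := trig_mul tp tq.
  by split=> [|l]; rewrite BM // d dp dq rmorphM.
have QC a : Q (mpolyC N a).
  split=> [|l]; rewrite BC; first exact: scalar_mx_is_trig.
  by rewrite mxE eqxx mevalC.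
have QX k : Q (mpolyX K (mnm1 k)) by split=> [|l]; rewrite ?mevalXU.
apply: mpoly_closure => // p1 p2 [t1 d1] [t2 d2].
split=> [|l]; first by rewrite BD; apply: trig_add.
by rewrite BD mxE d1 d2 rmorphD.
Qed.

Section TraceForm.
Variables (S : idomainType) (n : nat) (h : {rmorphism S -> S}) (beta : 'I_n -> S).
Implicit Types (p q : S) (u v : 'rV[S]_n).

(** For h the composition with G, this is the general element of the module spanned by [beta] over
    C[G]; the coordinates are recorded before h is applied. *)
Definition lincomb u := \sum_j beta j * h (u 0 j).

Lemma lincombD u v : lincomb (u + v) = lincomb u + lincomb v.
Proof. by rewrite -big_split; apply: eq_bigr => j _; rewrite mxE rmorphD mulrDr. Qed.

Lemma lincombZ p u : lincomb (p *: u) = h p * lincomb u.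
Proof. by rewrite mulr_sumr; apply: eq_bigr => j _; rewrite mxE rmorphM mulrCA. Qed.

Lemma lincomb0 : lincomb 0 = 0.
Proof. by rewrite /lincomb big1 // => j _; rewrite mxE rmorph0 mulr0. Qed.

Lemma lincomb_sum (J : finType) (f : J -> 'rV[S]_n) :
  lincomb (\sum_j f j) = \sum_j lincomb (f j).
Proof. exact: (big_morph lincomb lincombD lincomb0). Qed.

Hypothesis span : forall p, exists u, p = lincomb u.
Hypothesis inj : forall u, lincomb u = 0 -> u = 0.

Lemma lincomb_inj : injective lincomb.
Proof.
move=> u v E; apply/eqP; rewrite -subr_eq0; apply/eqP/inj.
by rewrite lincombD -scaleN1r lincombZ {1}E rmorphN1 mulN1r subrr.
Qed.

Lemma multiplication_matrix : exists Mx : S -> 'M[S]_n,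
  [/\ forall p u, p * lincomb u = lincomb (u *m Mx p),
      forall p q, Mx (p * q) = Mx p *m Mx q,
      forall p q, Mx (p + q) = Mx p + Mx q &
      forall p, Mx (h p) = p%:M].
Proof.
have [dec decP] := choice span.
have [Mx MxE] : exists Mx : S -> 'M[S]_n, forall p i, row i (Mx p) = dec (p * beta i).
  by exists (fun p => \matrix_i dec (p * beta i)) => p i; rewrite rowK.
have key p u : p * lincomb u = lincomb (u *m Mx p).
  rewrite mulmx_sum_row lincomb_sum mulr_sumr; apply: eq_bigr => i _.
  by rewrite lincombZ MxE -decP mulrA mulrC.
have ext A B : (forall u, lincomb (u *m A) = lincomb (u *m B)) -> A = B.
  by move=> E; apply/row_matrixP => i; rewrite !rowE; exact: (lincomb_inj (E _)).
exists Mx; split=> // [p q|p q|p]; apply: ext => u.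
- by rewrite mulmxA -!key mulrA [q * p]mulrC.
- by rewrite mulmxDr lincombD -!key mulrDl.
- by rewrite -key mul_mx_scalar lincombZ.
Qed.

Variable Mx : S -> 'M[S]_n.
Hypothesis key : forall p u, p * lincomb u = lincomb (u *m Mx p).
Hypothesis MxM : forall p q, Mx (p * q) = Mx p *m Mx q.
Hypothesis MxD : forall p q, Mx (p + q) = Mx p + Mx q.
Hypothesis MxC : forall p, Mx (h p) = p%:M.

Lemma norm_neq0 p : p != 0 -> \det (Mx p) != 0.
Proof.
move=> p0; apply/negP => /det0P[u u0 E].
have : p * lincomb u = 0 by rewrite key E lincomb0.
move/eqP; rewrite mulf_eq0 (negbTE p0) /= => /eqP/inj E0.
by rewrite E0 eqxx in u0.
Qed.

(* An element of the kernel of the trace form would have all its multiples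
   of trace zero, in particular its norm. *)
Lemma trace_form_nondegenerate : (forall k, k.+1%:R != 0 :> S) ->
  \det (\matrix_(i, j) \tr (Mx (beta i * beta j))) != 0.
Proof.
move=> ch; apply/negP => /det0P[v v0 vT].
have Mxsum (J : finType) (f : J -> S) : Mx (\sum_j f j) = \sum_j Mx (f j).
  apply: (big_morph Mx MxD).
  by have := MxC 0; rewrite rmorph0 => ->; rewrite raddf0.
have trV q : \tr (Mx (lincomb v * q)) = 0.
  have [u ->] := span q; rewrite {2}/lincomb mulr_sumr.
  rewrite Mxsum raddf_sum big1 //= => j _; rewrite mulrA MxM MxC mul_mx_scalar mxtraceZ.
  suff -> : \tr (Mx (lincomb v * beta j)) = 0 by rewrite mulr0.
  have := congr1 (fun A : 'rV_n => A 0 j) vT; rewrite !mxE => <-.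
  rewrite mulr_suml Mxsum raddf_sum /=; apply: eq_bigr => i _.
  by rewrite mxE mulrAC [Mx (_ * h _)]MxM MxC mul_mx_scalar mxtraceZ.
have V0 : lincomb v != 0 by apply: contraNneq v0 => /inj ->.
have [e e1] := span 1.
have := trV (lincomb (e *m \adj (Mx (lincomb v)))).
rewrite key -mulmxA mul_adj_mx mul_mx_scalar lincombZ -e1 mulr1 MxC mxtrace_scalar.
have /rV0Pn[i _] := v0; have n0 : (0 < n)%N by apply: leq_ltn_trans (ltn_ord i).
move/eqP; rewrite -mulr_natr mulf_eq0 (negbTE (norm_neq0 V0)) /= -(prednK n0).
by rewrite (negbTE (ch _)).
Qed.

End TraceForm.

Section Fibres.
Variables (R : realType) (N n : nat) (G : 'I_N -> {mpoly (C R)[N]}).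
Variable beta : 'I_n -> {mpoly (C R)[N]}.
Let h : {rmorphism {mpoly (C R)[N]} -> {mpoly (C R)[N]}} := mcomp G.
Hypothesis span : forall p, exists u, p = lincomb h beta u.
Hypothesis inj : forall u, lincomb h beta u = 0 -> u = 0.

(** D is the discriminant of [beta], the determinant of its trace form. Over a given w the
    multiplication matrices commute, so they become triangular together; their diagonals give points
    of the fibre G = w, traces are sums over these points, and the trace form becomes Z Z^T for the
    matrix Z of values of [beta]. *)
Lemma fibre_discriminant : exists2 D : {mpoly (C R)[N]}, D != 0 &
  forall w : 'I_N -> C R, exists z : 'I_n -> 'I_N -> C R,
    (forall l k, meval (z l) (G k) = w k) /\
    \det (\matrix_(i, l) meval (z l) (beta i)) ^+ 2 = meval w D.
Proof.
have [Mx [key MxM MxD MxC]] := multiplication_matrix span inj.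
pose T := \matrix_(i, j) \tr (Mx (beta i * beta j)).
exists (\det T).
  apply: (trace_form_nondegenerate span inj key MxM MxD MxC) => k.
  by rewrite -mpolyC_nat mpolyC_eq0 pnatr_eq0.
move=> w; pose Mw p := map_mx (meval w) (Mx p).
have MwM p q : Mw (p * q) = Mw p *m Mw q by rewrite /Mw MxM map_mxM.
have MwD p q : Mw (p + q) = Mw p + Mw q by rewrite /Mw MxD map_mxD.
have MwC p : Mw (mcomp G p) = (meval w p)%:M by rewrite /Mw MxC map_scalar_mx.
pose X k := mpolyX (C R) (@mnm1 N k).
have [|P Pu /allP trP] := @cotrigonalization (C R) n [seq Mw (X k) | k : 'I_N].
  by move=> _ _ /mapP[k _ ->] /mapP[l _ ->]; rewrite /comm_mx -!MwM mulrC.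
have Pi := unitarymx_unit Pu.
pose B p := P *m Mw p *m invmx P.
have BM p q : B (p * q) = B p *m B q by rewrite /B MwM !mulmxA mulmxKV.
have BD p q : B (p + q) = B p + B q by rewrite /B MwD mulmxDr mulmxDl.
have BC a : B (mpolyC N a) = a%:M.
  rewrite -(mcompC G) /B MwC mevalC mul_mx_scalar -scalemxAl mulmxV //.
  by rewrite scalemx1.
pose z l k := B (X k) l l.
have trX k : is_trig_mx (B (X k)).
  have /= := trP _ (map_f _ (mem_enum 'I_N k)).
  by rewrite /similar_to /= conjumx.
have QA := trig_eval BM BD BC trX.
exists z; split=> [l k|].
  have [_ <-] := QA (G k).
  have -> : G k = mcomp G (X k) by rewrite mcompX mmap1U.
  rewrite /B MwC mevalXU mul_mx_scalar -scalemxAl mulmxV //.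
  by rewrite mxE mxE eqxx mulr1.
have trM p : \tr (Mw p) = \sum_l meval (z l) p.
  rewrite -[Mw p](mulKmx Pi) mxtrace_mulC; apply: eq_bigr => l _.
  by have [_ <-] := QA p.
set Z := \matrix_(i, l) _.
have -> : meval w (\det T) = \det (map_mx (meval w) T) by rewrite -det_map_mx.
rewrite expr2 -{2}det_tr -det_mulmx; congr (\det _); apply/matrixP => i j.
rewrite !mxE -[RHS]/(meval w (\tr (Mx (beta i * beta j)))).
transitivity (\tr (Mw (beta i * beta j))).
  by rewrite trM; apply: eq_bigr => l _; rewrite !mxE rmorphM.
by rewrite raddf_sum; apply: eq_bigr => l _; rewrite mxE.
Qed.

End Fibres.

(** * Polynomials as a free module over the polynomials in F^n *)

Section Tower.
Variables (K : fieldType) (N d : nat).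
Hypothesis d_gt1 : (1 < d)%N.
Let d_gt0 : (0 < d)%N := ltnW d_gt1.

Definition free_over (I : finType) (beta : I -> {mpoly K[N]}) (G : 'I_N -> {mpoly K[N]}) :=
  (forall p, exists u : I -> {mpoly K[N]}, p = \sum_i beta i * mcomp G (u i)) /\
  (forall u : I -> {mpoly K[N]}, \sum_i beta i * mcomp G (u i) = 0 -> forall i, u i = 0).

(** Tower law: the bases of the two stages multiply, the second one being pulled back by F. *)
Lemma free_over_comp (I J : finType) (beta : I -> {mpoly K[N]}) (gamma : J -> {mpoly K[N]}) F G :
  free_over beta F -> free_over gamma G ->
  free_over (fun ij : I * J => beta ij.1 * mcomp F (gamma ij.2)) (fun k => mcomp F (G k)).
Proof.
move=> [sp1 fr1] [sp2 fr2].
have E (u : I -> J -> {mpoly K[N]}) : \sum_(ij : I * J) beta ij.1 * mcomp F (gamma ij.2) *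
      mcomp (fun k => mcomp F (G k)) (u ij.1 ij.2) =
    \sum_i beta i * mcomp F (\sum_j gamma j * mcomp G (u i j)).
  rewrite -(pair_bigA _ (fun i j => beta i * mcomp F (gamma j) *
      mcomp (fun k => mcomp F (G k)) (u i j))) /=.
  apply: eq_bigr => i _; rewrite raddf_sum mulr_sumr /=; apply: eq_bigr => j _.
  by rewrite rmorphM /= mcomp_comp mulrA.
split=> [p|u u0].
  have [u Eu] := sp1 p; have [v Ev] := choice (fun i => sp2 (u i)).
  exists (fun ij => v ij.1 ij.2); rewrite E Eu; apply: eq_bigr => i _.
  by rewrite {1}Ev.
have u0' : \sum_i beta i * mcomp F (\sum_j gamma j * mcomp G (u (i, j))) = 0.
  by rewrite -E -[RHS]u0; apply: eq_bigr => -[i j].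
by case=> i j; apply: (fr2 (fun j => u (i, j))); apply: (fr1 _ u0').
Qed.

Fixpoint iterate (F : 'I_N -> {mpoly K[N]}) k : 'I_N -> {mpoly K[N]} :=
  if k is k'.+1 then fun i => mcomp F (iterate F k' i) else fun i => mpolyX K (mnm1 i).

Lemma meval_iterate F k z :
  (fun i => meval z (iterate F k i)) = iter k (fun z i => meval z (F i)) z.
Proof.
elim: k z => [|k IH] z /=; first by apply/funext => i; rewrite mevalXU.
etransitivity; last exact: (esym (iterSr k (fun z i => meval z (F i)) z)).
rewrite -IH; apply/funext => i.
by rewrite meval_mcomp.
Qed.

Variable F : 'I_N -> {mpoly K[N]}.
Hypothesis hF : forall i, homog d (F i).
Hypothesis A_neq0 : forall m, famdet m (bfam d F) != 0.

(** A combination of the F^a z^b, regrouped by b, is a sum of z^b times polynomials in F; so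
    spanning and independence of this family are those of the z^b over C[F]. *)
Lemma free_over_digits :
  free_over (fun b : {ffun 'I_N -> 'I_d} => mpolyX K (digit_mnm b)) F.
Proof.
have E m (c : multinom N -> K) : \sum_(g : bmultinom N m.+1) c (bmnm g) *: bfam d F (bmnm g) =
    \sum_(b : {ffun 'I_N -> 'I_d}) mpolyX K (digit_mnm b) *
       mcomp F (\sum_(a : bmultinom N (quo_bound m b))
          c (mnm_add (mnm_muln (bmnm a) d) (digit_mnm b)) *: mpolyX K (bmnm a)).
  rewrite (big_digits d_gt0 _ m (fun g => c g *: bfam d F g)); apply: eq_bigr => b _.
  rewrite raddf_sum mulr_sumr /=; apply: eq_bigr => a _.
  by rewrite bfam_join // mcompZ mcompX -scalerAr mulrC.
split=> [p|u u0].
  have dp : deg_le (mmeasure mdeg p) p by apply/deg_leP; apply: leqnSn.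
  have [c Ec] := famdet_inspan hF (A_neq0 _) dp.
  exists (fun b => \sum_(a : bmultinom N (quo_bound (mmeasure mdeg p) b))
    c (mnm_add (mnm_muln (bmnm a) d) (digit_mnm b)) *: mpolyX K (bmnm a)).
  by rewrite -E; exact: Ec.
(* Chosen so that, for every residue b, the box of quotients in degree m contains all monomials of
   u_b. *)
pose D := (\max_b mmeasure mdeg (u b))%N; pose m := (N * d.-1 + d * D)%N.
have qD b : exists t, quo_bound m b = t.+1 /\ deg_le t (u b).
  have bN := digit_deg_le d_gt0 b.
  have bm : (digit_deg b <= m)%N by rewrite (leq_trans bN) // leq_addr.
  rewrite /quo_bound bm; exists ((m - digit_deg b) %/ d)%N; split=> //; apply/deg_leP.
  apply: (@leq_trans D); first exact: (leq_bigmax b).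
  by apply: leqW; rewrite leq_divRL // leq_subRL // /m [(D * d)%N]mulnC leq_add2r.
pose c g := mcoeff (mdivn g d) (u (low_digit d_gt0 g)).
have cE b t (a : bmultinom N t) : quo_bound m b = t ->
    c (mnm_add (mnm_muln (bmnm a) d) (digit_mnm b)) = mcoeff (bmnm a) (u b).
  move=> Et; rewrite /c mdivn_add; last by move=> i; rewrite mkmnmE ltn_ord.
  congr (mcoeff _ (u _)); apply/ffunP => i; rewrite ffunE; apply: val_inj => /=.
  by rewrite mnmDE mulmnE modnMDl /digit_mnm mkmnmE modn_small // ltn_ord.
have uE b : u b = \sum_(a : bmultinom N (quo_bound m b))
    c (mnm_add (mnm_muln (bmnm a) d) (digit_mnm b)) *: mpolyX K (bmnm a).
  have [t [Et dt]] := qD b; move: (cE b) => cEb; rewrite Et in cEb *.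
  by rewrite {1}(deg_le_expand dt); apply: eq_bigr => a _; rewrite (cEb t.+1 a).
have c0 : \sum_(g : bmultinom N m.+1) c (bmnm g) *: bfam d F (bmnm g) = 0.
  by rewrite E -[RHS]u0; apply: eq_bigr => b _; rewrite -uE.
have cz := bfam_free (A_neq0 m) c0.
move=> b; rewrite (uE b) big1 // => a _; rewrite cz ?scale0r //.
by have := bmdeg (join_digit d_gt0 a); rewrite ltnS.
Qed.

(** The n lowest digits of g give the basis element, a product of powers of the components of z,
    F(z), ..., F^(n-1)(z); the remaining digits give a. *)
Lemma qfam_tower n : exists (I : finType) (beta : I -> {mpoly K[N]}),
  [/\ #|I| = ((d ^ N) ^ n)%N, free_over beta (iterate F n) &
    forall k g, (mdeg g <= d ^ n * k)%N -> exists i a, (mdeg a <= k)%N /\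
      qfam d F g = beta i * mcomp (iterate F n) (qfam d F a)].
Proof.
elim: n => [|n [I [beta [cI fr H]]]].
  have sum1 (f : unit -> {mpoly K[N]}) : \sum_i f i = f tt.
    by rewrite (bigD1 tt) //= big1 ?addr0 // => -[].
  exists unit, (fun=> 1); split; [by rewrite card_unit|split=> [p|u]|].
  - by exists (fun=> p); rewrite sum1 mul1r mcomp_id.
  - by rewrite sum1 mul1r mcomp_id => u0 [].
  - by move=> k g; rewrite mul1n => gk; exists tt, g; rewrite mul1r mcomp_id.
exists ({ffun 'I_N -> 'I_d} * I)%type, (fun bi => mpolyX K (digit_mnm bi.1) * mcomp F (beta bi.2)).
split; [by rewrite card_prod cI card_ffun !card_ord expnS| |].
  exact: free_over_comp free_over_digits fr.
move=> k g gk; have [|i [a [ak E]]] := H k (mdivn g d).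
  rewrite -(leq_pmul2l d_gt0) mulnA -expnS; apply: leq_trans gk.
  by rewrite (mdeg_divn g d) [(d * _)%N]mulnC leq_addr.
exists (low_digit d_gt0 g, i), a; split; first exact: ak.
transitivity (mpolyX K (mmodn g d) * mcomp F (qfam d F (mdivn g d))); first exact: qfamE.
have -> : mcomp F (qfam d F (mdivn g d)) =
    mcomp F (beta i) * mcomp F (mcomp (iterate F n) (qfam d F a)).
  by rewrite E; exact: rmorphM.
rewrite digit_low (mcomp_comp F (iterate F n) (qfam d F a)).
exact: mulrA.
Qed.

End Tower.

Lemma qfam_inj (R : realType) (N d : nat) (F : 'I_N -> {mpoly (C R)[N]}) :
  (1 < d)%N -> (forall i, homog d (F i)) -> (forall m, famdet m (bfam d F) != 0) ->
  injective (qfam d F).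
Proof.
move=> d_gt1 hF A_neq0 g g' E; pose m := maxn (mdeg g) (mdeg g').
have gm : (mdeg g < m.+1)%N by rewrite ltnS leq_maxl.
have gm' : (mdeg g' < m.+1)%N by rewrite ltnS leq_maxr.
have [f [Hf _]] := fdet_unit_inverse (boxdet_neq0 d_gt1 hF A_neq0 m.+1).
have := Hf (BMultinom gm) (BMultinom gm'); have := Hf (BMultinom gm') (BMultinom gm').
rewrite /= E eqxx => ->; case: eqP => [[]|_ /eqP] //.
by rewrite oner_eq0.
Qed.


(* The matrix factors through the values of [q] at the points [w]: it is the
   product of a block diagonal matrix with blocks [q a (w e)] and one with blocks
   the fibre matrices over the [w e]. *)
Lemma fdet_fibres (S : comNzRingType) (I A : finType) (q : A -> A -> S) (b : A -> I -> I -> S) :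
  fdet (fun x y : I * A => b y.2 x.1 y.1 * q x.2 y.2) =
  fdet q ^+ #|I| * \prod_e fdet (b e).
Proof.
pose X (x y : I * A) := if x.1 == y.1 then q x.2 y.2 else 0.
pose Y (x y : I * A) := if x.2 == y.2 then b y.2 x.1 y.1 else 0.
transitivity (fdet (fun x y => \sum_z X x z * Y z y)).
  apply: eq_fdet => -[i a] [l c]; rewrite (bigD1 (i, c)) //= big1 ?addr0; last first.
    move=> [j e] /eqP ne; rewrite /X /Y /=; case: eqP => [E|]; last by rewrite mul0r.
    by case: eqP => [E'|]; rewrite ?mulr0 //; case: ne; rewrite E E'.
  by rewrite /X /Y /= !eqxx mulrC.
rewrite fdet_mul; congr (_ * _).
  rewrite (@fdet_block _ _ I fst (fun=> A) (fun i a => (i, a))) /=.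
  - rewrite (eq_bigr (fun=> fdet q)) ?prodr_const // => i _; apply: eq_fdet => a c.
    by rewrite /X /= eqxx.
  - by move=> i a c [].
  - by [].
  - by move=> [i a]; exists a.
  - by move=> x y /negbTE xy; rewrite /X xy.
rewrite (@fdet_block _ _ A snd (fun=> I) (fun e i => (i, e))) /=.
- by apply: eq_bigr => e _; apply: eq_fdet => i j; rewrite /Y /= eqxx.
- by move=> e i j [].
- by [].
- by move=> [i a]; exists i.
- by move=> x y /negbTE xy; rewrite /Y xy.
Qed.

(** * Fekete determinants on an invariant set *)

Section DetBounds.
Variable R : realType.

Lemma modulus_fdet_le (I : finType) (f : I -> I -> C R) (B : R) : 0 <= B ->
  (forall i j, modulus (f i j) <= B) -> modulus (fdet f) <= (#|I|)`!%:R * B ^+ #|I|.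
Proof.
move=> B0 Hf; apply: le_trans (modulus_sum _ _ _) _.
have -> : (#|I|)`!%:R = \sum_(s : 'S_#|I|) 1 :> R by rewrite sumr_const card_Sn.
rewrite mulr_suml; apply: ler_sum => s _.
rewrite mul1r modulusM modulusX modulusN modulus1 expr1n mul1r modulus_prod.
rewrite -[X in B ^+ X]card_ord -prodr_const; apply: ler_prod => i _.
by rewrite modulus_ge0 mxE Hf.
Qed.

Lemma fdet_neq0_inj (I J : finType) (f : I -> J -> C R) (h : I -> J) :
  fdet (fun i j => f i (h j)) != 0 -> injective h.
Proof.
move=> /fdet_unit_inverse[g [_ Hg]] i j E; have := Hg i j.
under eq_bigr do rewrite -E; rewrite Hg eqxx; case: eqP => // _ /eqP.
by rewrite oner_eq0.
Qed.

(** A Fourier matrix: times its conjugate transpose it is L^N times the identity, so the square of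
    the modulus of its determinant is (L^N)^(L^N). *)
Lemma dft_lower N L (w : C R) : L.-primitive_root w ->
  1 <= modulus (fdet (fun a j : {ffun 'I_N -> 'I_L} => \prod_i (w ^+ j i) ^+ a i)).
Proof.
move=> pw; have L0 := prim_order_gt0 pw.
set f := (fun a j => _ : C R).
have w1 := modulus_prim_root pw.
have E : fdet (fun j l : {ffun 'I_N -> 'I_L} => \sum_(a : {ffun 'I_N -> 'I_L}) (\prod_i w ^- (j i * a i)) * f a l) = ((L ^ N)%:R) ^+ (L ^ N).
  rewrite (eq_fdet (g := fun j l => (L ^ N)%:R * (j == l)%:R)); last first.
    move=> j l; rewrite /f; under eq_bigr do rewrite -big_split /=.
    rewrite -(bigA_distr_bigA (fun i (a : 'I_L) => w ^- (j i * a) * (w ^+ l i) ^+ a)) /=.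
    have [->|jl] := eqVneq j l.
      rewrite mulr1 (eq_bigr (fun=> L%:R)); first by rewrite prodr_const card_ord natrX.
      move=> i _; rewrite (eq_bigr (fun=> 1)) ?sumr_const ?card_ord // => a _.
      by rewrite -exprM mulVf // expf_neq0 // -modulus_eq0 w1 oner_eq0.
    have /existsP[i ni] : [exists i, j i != l i].
      rewrite -negb_forall; apply: contraNN jl => /forallP E.
      by apply/eqP/ffunP => i; apply/eqP.
    rewrite mulr0 (bigD1 i) //= (_ : \sum_(_ < L) _ = 0) ?mul0r //.
    have w0 : w != 0 by rewrite -modulus_eq0 w1 oner_eq0.
    rewrite -[RHS](sum_prim_root (j := (L - j i + l i)%N) pw).
      apply: eq_bigr => a _; rewrite -exprM -[LHS]mul1r -(expr1n _ a) -{1}(prim_expr_order pw).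
      rewrite -!exprM -{1}(subnK (ltnW (ltn_ord (j i)))) mulnDl exprD mulrA mulfK ?expf_neq0 //.
      by rewrite -exprD; congr (w ^+ _); rewrite mulnC mulnDr [(a * l i)%N]mulnC.
    have lj : (j i < L)%N := ltn_ord (j i); have ll : (l i < L)%N := ltn_ord (l i).
    have ni' : (j i : nat) <> (l i : nat) by move=> E; case/eqP: ni; apply: val_inj.
    apply/negP => /dvdnP[q Eq]; move: Eq lj ll ni'; move: (j i : nat) (l i : nat) => x y.
    by case: q => [|[|q]]; rewrite ?mul0n ?mul1n ?mulSn; lia.
  rewrite fdet_scale_row fdet_delta mulr1 prodr_const card_ffun !card_ord.
  by [].
have LN : 1 <= (L ^ N)%:R :> R by rewrite ler1n expn_gt0 L0.
have nf x y : modulus (f x y) = 1.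
  by rewrite /f modulus_prod big1 // => i _; rewrite !modulusX w1 !expr1n.
have := congr1 (@modulus R) E; rewrite fdet_mul modulusM modulusX modulus_nat => E'.
have g1 : modulus (fdet (fun j a : {ffun 'I_N -> 'I_L} => \prod_i w ^- (j i * a i))) = modulus (fdet f).
  have mJ (z : C R) : modulus (z^*) = modulus z.
    have := norm_conjC z; rewrite !modulus_norm => /eqP.
    by rewrite eq_complex /= eqxx andbT => /eqP.
  rewrite -mJ (rmorph_fdet (Num.conj)) -[in RHS]fdet_tr; congr (modulus _).
  apply: eq_fdet => j a; rewrite rmorph_prod /f; apply: eq_bigr => i _.
  rewrite -exprM fmorphV rmorphXn /= -exprVn; congr (_ ^+ _).
  have ww : w * w^* = 1 by rewrite -normCK modulus_norm w1 expr1n.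
  have w0 : w != 0 by rewrite -modulus_eq0 w1 oner_eq0.
  have wJ : w^* = w^-1 by apply: (mulfI w0); rewrite ww mulfV.
  by rewrite wJ invrK.
rewrite g1 -expr2 in E'; rewrite -(@ler_pXn2r _ 2) ?nnegrE ?modulus_ge0 // expr1n E'.
exact: exprn_ege1.
Qed.

End DetBounds.

Section Points.
Variables (R : realType) (N : nat).
Implicit Types (p : {mpoly (C R)[N]}).

(* [vdm m zeta] is the determinant of [fekete_det], with points indexed by monomials. *)
Definition vdm m (zeta : bmultinom N m.+1 -> 'I_N -> C R) : C R :=
  fdet (fun g h => meval (zeta h) (mpolyX (C R) (bmnm g))).

Lemma vdm_change m (q : multinom N -> {mpoly (C R)[N]}) zeta :
  (forall g, homog (mdeg g) (q g)) ->
  fdet (fun g h : bmultinom N m.+1 => meval (zeta h) (q (bmnm g))) = famdet m q * vdm zeta.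
Proof.
move=> hq; rewrite -fdet_mul; apply: eq_fdet => g h.
have dq : deg_le m (q (bmnm g)).
  by apply: deg_le_weaken (homog_deg_le (hq _)); rewrite -ltnS bmdeg.
rewrite {1}(deg_le_expand dq) raddf_sum /=; apply: eq_bigr => k _.
by rewrite mevalZ.
Qed.

Lemma poly_bounded p (rho : R) : 0 <= rho -> exists2 B : R, 1 <= B &
  forall z, (forall i, modulus (z i) <= rho) -> modulus (meval z p) <= B.
Proof.
move=> rho0; exists (1 + \sum_(m <- msupp p) modulus (mcoeff m p) * rho ^+ mdeg m).
  rewrite lerDl; apply: sumr_ge0 => m _.
  by rewrite mulr_ge0 ?modulus_ge0 ?exprn_ge0.
move=> z Hz; rewrite {1}(mpolyE p) raddf_sum /=; apply: le_trans (modulus_sum _ _ _) _.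
apply: le_trans (_ : \sum_(m <- msupp p) modulus (mcoeff m p) * rho ^+ mdeg m <= _); last by rewrite lerDr.
apply: ler_sum => m _; rewrite mevalZ mevalX modulusM ler_wpM2l ?modulus_ge0 //.
rewrite modulus_prod mdegE -prodrXr; apply: ler_prod => i _.
by rewrite modulus_ge0 modulusX lerXn2r ?nnegrE ?modulus_ge0.
Qed.

End Points.

Lemma up_log_halved m h : (0 < m)%N -> (h <= m./2)%N -> (up_log 2 h.+1 < up_log 2 m.+1)%N.
Proof.
move=> m0 hm; have H := up_logP m.+1 (ltnSn 1).
case E : (up_log 2 m.+1) H => [|u] H; first by rewrite expn0 in H; lia.
rewrite ltnS; apply: up_log_min => //.
by rewrite expnS in H; move: hm; rewrite -divn2; lia.
Qed.

Section FeketeBounds.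
Variables (R : realType) (N d : nat).
Hypotheses (N_gt0 : (0 < N)%N) (d_gt1 : (1 < d)%N).
Let d_gt0 : (0 < d)%N := ltnW d_gt1.
Variable F : 'I_N -> {mpoly (C R)[N]}.
Hypothesis hF : forall i, homog d (F i).
Hypothesis A_neq0 : forall m, famdet m (bfam d F) != 0.
Let Fz (z : 'I_N -> C R) i := meval z (F i).

Variable K : ('I_N -> C R) -> Prop.
Variables rho r : R.
Hypothesis FK : forall z, K z -> K (Fz z).
Hypothesis KF : forall z, K (Fz z) -> K z.
Hypothesis rho_ge1 : 1 <= rho.
Hypothesis K_bounded : forall z, K z -> forall i, modulus (z i) <= rho.
Hypothesis r_gt0 : 0 < r.
Hypothesis K_ball : forall z, (forall i, modulus (z i) <= r) -> K z.

(** On the invariant set K all iterates stay in the polydisc of radius rho, so each base-d digit of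
    g costs at most rho^(N (d-1)), and the number of digits is logarithmic in |g|. *)
Lemma qfam_bounded : exists2 B : R, 1 <= B & forall g z, K z ->
  modulus (meval z (qfam d F g)) <= B ^+ up_log 2 (mdeg g).+1.
Proof.
have rho0 : 0 <= rho by apply: le_trans ler01 rho_ge1.
exists (rho ^+ (N * d.-1)); first exact: exprn_ege1.
move=> g; move Em : (mdeg g) => m; elim/ltn_ind: m g Em => m IH g Em z Kz.
have [m0|m0] := posnP m.
  by rewrite m0 in Em *; rewrite qfam0 // rmorph1 modulus1 exprn_ege1 ?exprn_ege1.
have half := mdeg_divn_half d_gt1 g; rewrite Em in half.
have hm : (m./2 < m)%N by rewrite -divn2 ltn_Pdiv.
rewrite (qfamE d_gt1) rmorphM /= modulusM meval_mcomp.
have le1 : modulus (meval z (mpolyX (C R) (mmodn g d))) <= rho ^+ (N * d.-1).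
  rewrite mevalX modulus_prod mulnC exprM -[X in _ ^+ X]card_ord -prodr_const.
  apply: ler_prod => i _; rewrite modulus_ge0 modulusX /=.
  apply: (@le_trans _ _ (rho ^+ mmodn g d i)).
    by rewrite lerXn2r ?nnegrE ?modulus_ge0 ?K_bounded.
  by rewrite ler_weXn2l // mkmnmE -ltnS prednK // ltn_mod.
have le2 := IH _ (leq_ltn_trans half hm) _ erefl _ (FK Kz).
apply: le_trans (ler_pM (modulus_ge0 _) (modulus_ge0 _) le1 le2) _.
by rewrite -exprS ler_weXn2l ?exprn_ege1 // up_log_halved.
Qed.

Local Notation Q m := (boxdet m.+1 (qfam d F)).

(** The determinant of the values of the q_g is Q_m times the Vandermonde determinant, and the
    Leibniz formula bounds it through [qfam_bounded]. *)
Lemma fekete_upper : exists2 B : R, 1 <= B & forall m (zeta : bmultinom N m.+1 -> 'I_N -> C R),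
  (forall h, K (zeta h)) ->
  modulus (Q m) * modulus (vdm zeta) <=
    (num_monomials N m)`!%:R * (B ^+ up_log 2 m.+1) ^+ num_monomials N m.
Proof.
have [B B1 HB] := qfam_bounded; exists B => // m zeta Kz.
rewrite -modulusM -(vdm_change _ (qfam_homog d_gt1 hF)); apply: modulus_fdet_le.
  by rewrite exprn_ge0 // (le_trans ler01).
move=> g h; apply: le_trans (HB _ _ (Kz h)) _.
by rewrite ler_weXn2l // leq_up_log // bmdeg.
Qed.

Lemma iterate_K n z : K (fun i => meval z (iterate F n i)) -> K z.
Proof.
by rewrite meval_iterate; elim: n z => [|n IH] z //=; move/KF/IH.
Qed.

(** The points are found among the preimages under F^n of [num_monomials N k] points of the torus of
    radius r. For the products of a basis element and q_a o F^n with |a| <= k, the determinant at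
    all these preimages splits by [fdet_fibres]. As m <= d^n k, the q_g with |g| <= m are among
    these products, and [laplace_select] picks points suited to them. B and c depend on n but not on
    m and k. *)
Lemma fekete_lower n : exists B c : R, [/\ 1 <= B, 0 < c, c <= 1 &
  forall m k, (m <= d ^ n * k)%N -> exists2 zeta : bmultinom N m.+1 -> 'I_N -> C R,
    (forall h, K (zeta h)) &
    c ^+ (k.+1 ^ N) * (modulus (Q k) * r ^+ fekete_degree N k / ((k.+1 ^ N)`!)%:R) ^+ ((d ^ N) ^ n)
    <= ((d ^ N) ^ n * num_monomials N k)`!%:R *
       (B * B ^+ up_log 2 k.+1) ^+ ((d ^ N) ^ n * num_monomials N k) *
       (modulus (Q m) * modulus (vdm zeta))].
Proof.
have rho0 : 0 <= rho by apply: le_trans ler01 rho_ge1.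
have [I [beta [cI [sp fr] tow]]] := qfam_tower d_gt1 hF A_neq0 n.
set G := iterate F n in sp fr tow.
have [||D D0 HD] := @fibre_discriminant R N #|I| G (fun i => beta (enum_val i)).
- move=> p; have [u ->] := sp p; exists (\row_i u (enum_val i)); rewrite /lincomb.
  rewrite (reindex _ (onW_bij _ (enum_val_bij I))) /=.
  by apply: eq_bigr => i _; rewrite mxE.
- move=> u u0; have := fr (fun i => u 0 (enum_rank i)).
  move=> H; apply/rowP => i; rewrite mxE -(H _ (enum_val i)) ?enum_valK //.
  rewrite -[RHS]u0 /lincomb (reindex _ (onW_bij _ (enum_val_bij I))) /=.
  by apply: eq_bigr => j _; rewrite enum_valK.
have rc0 : (r%:C%C : C R) != 0.
  by rewrite -modulus_eq0 modulus_real normr_eq0 gt_eqF.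
have rr : modulus (r%:C%C : C R) = r by rewrite modulus_real ger0_norm // ltW.
have [c c0 Hc] := torus_grid_lower D0 rc0.
have [BD BD1 HBD] := poly_bounded D (ltW r_gt0).
have [Bq Bq1 HBq] := qfam_bounded.
have [Bb Bb1 HBb] : exists2 B : R, 1 <= B & forall i z, K z -> modulus (meval z (beta i)) <= B.
  have /choice[B HB] : forall i, exists B : R, 1 <= B /\ forall z, (forall i, modulus (z i) <= rho) ->
      modulus (meval z (beta i)) <= B.
    by move=> i; have [B B1 HB] := @poly_bounded R N (beta i) rho rho0; exists B.
  exists (1 + \sum_i B i).
    by rewrite lerDl sumr_ge0 // => i _; apply: le_trans ler01 (HB i).1.
  move=> i z Kz; apply: le_trans ((HB i).2 z (K_bounded Kz)) _.
  rewrite (bigD1 i) //= addrCA lerDl addr_ge0 // sumr_ge0 // => j _.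
  by apply: le_trans ler01 (HB j).1.
pose B := Num.max Bq Bb; have B1 : 1 <= B by rewrite le_max Bq1.
have BD0 : 0 < BD by apply: lt_le_trans BD1.
(* [c] controls the discriminant over the whole grid; dividing by [BD] pays for the grid points that
   are not selected. The minimum with 1 gives c1^2 <= c / BD, which matters because the discriminant
   is the square of the fibre determinant. *)
pose c1 := Num.min 1 (c / BD).
have c10 : 0 < c1 by rewrite lt_min ltr01 divr_gt0.
exists B, c1; split=> //; first by rewrite ge_min lexx.
move=> m k mk; set A := bmultinom N k.+1.
have [w pw] := prim_root_exists (C R) (ltn0Sn k).
have w1 j : modulus (w ^+ j) = 1 by rewrite modulusX (modulus_prim_root pw) expr1n.
pose J := {ffun 'I_N -> 'I_k.+1}; pose om (j : J) i := w ^+ j i.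
pose T (a j : J) := \prod_i (w ^+ j i) ^+ a i.
pose phi (a : A) : J := [ffun i => inord (bmnm a i)].
have phiE a i : phi a i = bmnm a i :> nat.
  by rewrite ffunE inordK // (leq_ltn_trans (mnm_le_mdeg _ _)) // bmdeg.
have inj_phi : injective phi.
  by move=> a b E; apply: val_inj; apply/mnmP => i; rewrite -!phiE E.
have T1 a j : modulus (T a j) <= 1.
  by rewrite modulus_prod big1 // => i _; rewrite modulusX w1 expr1n.
(* The Fourier matrix has all exponents at most k in each variable, whereas only those of total
   degree at most k are wanted: [f] selects as many grid points, with a minor that is not too
   small. *)
have [f Hf] := laplace_select inj_phi (lexx 1) T1.
rewrite expr1n mulr1 in Hf; have cJ : #|{: J}| = (k.+1 ^ N)%N by rewrite card_ffun !card_ord.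
have {}Hf := le_trans (dft_lower N pw) Hf; rewrite cJ in Hf.
have inj_f : injective f.
  apply: (@fdet_neq0_inj R A J (fun s => T (phi s))).
  rewrite -modulus_gt0; have P0 : 0 < ((k.+1 ^ N)`!)%:R :> R by rewrite ltr0n fact_gt0.
  by rewrite -(pmulr_rgt0 _ P0); apply: lt_le_trans Hf.
(* The grid is rotated away from the zeros of the discriminant. *)
have [th [th1 Hth]] := Hc J om (fun j i => w1 _); rewrite cJ in Hth.
pose pt j i := r%:C%C * (om j i * th i).
have ptr j i : modulus (pt j i) = r by rewrite !modulusM rr w1 th1 !mulr1.
have Kpt j : K (pt j) by apply: K_ball => i; rewrite ptr.
have Emono : modulus (fdet (fun s t : A => meval (pt (f t)) (mpolyX (C R) (bmnm s)))) =
    r ^+ fekete_degree N k * modulus (fdet (fun s t => T (phi s) (f t))).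
  rewrite (eq_fdet (g := fun s t : A => (\prod_i (r%:C%C * th i) ^+ bmnm s i) * T (phi s) (f t))).
    rewrite fdet_scale_row modulusM modulus_prod; congr (_ * _).
    rewrite /fekete_degree -degree_sum -prodrXr; apply: eq_bigr => s _.
    rewrite modulus_prod mdegE -prodrXr; apply: eq_bigr => i _.
    by rewrite modulusX modulusM rr th1 mulr1.
  move=> s t; rewrite mevalX -big_split; apply: eq_bigr => i _ /=.
  by rewrite phiE -exprMn /pt mulrCA mulrC.
have [z Hz] := choice HD.
pose Z (y : I * A) := z (pt (f y.2)) (enum_rank y.1).
have GZ y : (fun i => meval (Z y) (G i)) = pt (f y.2).
  by apply/funext => i; rewrite (Hz _).1.
have KZ y : K (Z y) by apply: (@iterate_K n); rewrite -/G GZ.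
pose M (x y : I * A) := meval (Z y) (beta x.1) * meval (pt (f y.2)) (qfam d F (bmnm x.2)).
have detM : fdet M = (famdet k (qfam d F) *
    fdet (fun s t : A => meval (pt (f t)) (mpolyX (C R) (bmnm s)))) ^+ ((d ^ N) ^ n) *
    \prod_(e : A) fdet (fun i l => meval (z (pt (f e)) (enum_rank l)) (beta i)).
  rewrite -[_ * fdet _](@vdm_change _ _ k (qfam d F) (fun e => pt (f e))); last exact: qfam_homog.
  by rewrite -cI; exact: (fdet_fibres (fun a e => meval (pt (f e)) (qfam d F (bmnm a)))
       (fun e i l => meval (z (pt (f e)) (enum_rank l)) (beta i))).
have detb e : fdet (fun i l => meval (z (pt (f e)) (enum_rank l)) (beta i)) ^+ 2 = meval (pt (f e)) D.
  rewrite -(Hz _).2; congr (\det _ ^+ 2); apply/matrixP => i l.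
  by rewrite !mxE enum_valK.
have detb_low : c1 ^+ (k.+1 ^ N) <=
    modulus (\prod_(e : A) fdet (fun i l => meval (z (pt (f e)) (enum_rank l)) (beta i))).
  rewrite -(@ler_pXn2r _ 2) ?nnegrE ?modulus_ge0 ?exprn_ge0 ?(ltW c10) //.
  rewrite -modulusX -prodrXl (eq_bigr _ (fun e _ => detb e)).
  apply: (@le_trans _ _ ((c / BD) ^+ (k.+1 ^ N))).
    have cc : c1 * c1 <= c / BD.
      apply: (@le_trans _ _ (1 * (c / BD))); last by rewrite mul1r.
      by apply: ler_pM; rewrite ?(ltW c10) // ge_min lexx ?orbT.
    have n1 : c1 * c1 \is Num.nneg by rewrite nnegrE mulr_ge0 ?(ltW c10).
    have n2 : c / BD \is Num.nneg by rewrite nnegrE divr_ge0 ?(ltW c0) ?(ltW BD0).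
    by rewrite expr2 -exprMn lerXn2r.
  rewrite expr_div_n ler_pdivrMr ?exprn_gt0 //; apply: le_trans Hth _.
  rewrite (bigID (mem (codom f))) /= modulus_prod ler_pM ?prodr_ge0 // => [*|*||]; rewrite ?modulus_ge0 //.
    have U : uniq (codom f) by rewrite codomE map_inj_uniq ?enum_uniq.
    by rewrite -(big_uniq _ U) codomE big_map big_enum.
  apply: (@le_trans _ _ (\prod_(j | j \notin codom f) BD)).
    apply: ler_prod => j _; rewrite modulus_ge0 HBD // => i; rewrite -/(pt j i) ptr.
    exact: lexx.
  by rewrite prodr_const ler_weXn2l // -cJ max_card.
(* The row of [M] that carries q_g, for each g with |g| <= m. *)
have /choice[phi' Hphi'] : forall g : bmultinom N m.+1, exists x : I * A,
    qfam d F (bmnm g) = beta x.1 * mcomp G (qfam d F (bmnm x.2)).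
  move=> g; have [|i [a [ak E]]] := tow k (bmnm g).
    by apply: leq_trans mk; rewrite -ltnS bmdeg.
  have ak' : (mdeg a < k.+1)%N by [].
  by exists (i, BMultinom ak').
have inj_phi' : injective phi'.
  move=> g h E; apply: val_inj; apply: (qfam_inj d_gt1 hF A_neq0).
  by rewrite /= !Hphi' E.
have MB x y : modulus (M x y) <= B * B ^+ up_log 2 k.+1.
  rewrite modulusM ler_pM ?modulus_ge0 //.
    by apply: le_trans (HBb _ _ (KZ _)) _; rewrite le_max lexx orbT.
  apply: le_trans (HBq _ _ (Kpt _)) _; apply: (@le_trans _ _ (Bq ^+ up_log 2 k.+1)).
    by rewrite ler_weXn2l // leq_up_log // bmdeg.
  by rewrite lerXn2r ?nnegrE ?(le_trans ler01) // le_max lexx.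
have BB1 : 1 <= B * B ^+ up_log 2 k.+1 by rewrite -exprS exprn_ege1.
have [f' Hf'] := laplace_select inj_phi' BB1 MB.
exists (fun h => Z (f' h)) => //.
have Ev : fdet (fun s t => M (phi' s) (f' t)) = Q m * vdm (fun h => Z (f' h)).
  rewrite -(vdm_change _ (qfam_homog d_gt1 hF)); apply: eq_fdet => g h.
  by rewrite Hphi' rmorphM /= meval_mcomp GZ.
rewrite Ev modulusM detM card_prod cI -/(num_monomials N k) in Hf'.
apply: le_trans Hf'; rewrite modulusM mulrC ler_pM ?exprn_ge0 ?(ltW c10) //.
  by rewrite !mulr_ge0 ?modulus_ge0 ?invr_ge0 ?exprn_ge0 // ltW.
rewrite modulusX lerXn2r ?nnegrE ?modulus_ge0 //.
  by rewrite !mulr_ge0 ?modulus_ge0 ?invr_ge0 ?exprn_ge0 // ltW.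
rewrite modulusM -mulrA ler_wpM2l ?modulus_ge0 // Emono ler_wpM2l ?exprn_ge0 ?(ltW r_gt0) //.
by rewrite -[X in X <= _]mul1r ler_pdivrMr ?ltr0n ?fact_gt0 // mulrC.
Qed.

End FeketeBounds.

(** * Growth rates of the degrees and of the error terms *)

Section Asymptotics.
Variable R : realType.

Lemma num_monomials_le N m : (num_monomials N m <= m.+1 ^ N)%N.
Proof.
pose phi (a : bmultinom N m.+1) : {ffun 'I_N -> 'I_m.+1} := [ffun i => inord (bmnm a i)].
have phiE a i : phi a i = bmnm a i :> nat.
  by rewrite ffunE inordK // (leq_ltn_trans (mnm_le_mdeg _ _)) // bmdeg.
have inj_phi : injective phi.
  by move=> a b E; apply: val_inj; apply/mnmP => i; rewrite -!phiE E.
by have := leq_card _ inj_phi; rewrite card_ffun !card_ord.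
Qed.

Lemma ffact_ge m j : (m ^ j.+1 <= (m + j) ^_ j.+1)%N.
Proof.
elim: j => [|j IH]; first by rewrite addn0 ffactn1 expn1.
by rewrite ffactnS expnS addnS /= leq_mul // leqW ?leq_addr.
Qed.

Lemma ffact_le n j : (n ^_ j <= n ^ j)%N.
Proof.
elim: j n => [|j IH] n; first by rewrite ffactn0.
rewrite ffactnS expnS leq_mul2l; apply/orP; right; apply: leq_trans (IH _) _.
by rewrite leq_exp2r_pred // || (case: j {IH} => // j; rewrite leq_exp2r // leq_pred).
Qed.

Lemma fekete_degree_ge N m : (0 < N)%N -> (m ^ N.+1 <= N.+1`! * fekete_degree N m)%N.
Proof.
move=> N0; apply: leq_trans (ffact_ge m N) _; rewrite -bin_ffact [(m + N)%N]addnC.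
rewrite /fekete_degree mulnC leq_mul2l; apply/orP; right.
by rewrite leq_pmull.
Qed.

Lemma fekete_degree_le N m : (fekete_degree N m <= N * (N + m) ^ N.+1)%N.
Proof.
rewrite /fekete_degree leq_mul2l; apply/orP; right; apply: leq_trans (ffact_le _ _).
by rewrite -bin_ffact leq_pmulr // fact_gt0.
Qed.

(** D(m) has order m^(N+1), so d^(N n) copies of D(m / d^n) amount to O(D(m) / d^n). This bounds the
    share of the torus and of the q_a at the top of the tower, which fades as n grows. *)
Lemma fekete_degree_blocks N d n m : (0 < N)%N -> (0 < d)%N -> (d ^ n <= m)%N ->
  (d ^ n * ((d ^ N) ^ n * fekete_degree N (m %/ d ^ n).+1) <=
   N * (N.+1 * 2) ^ N.+1 * N.+1`! * fekete_degree N m)%N.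
Proof.
move=> N0 d0 dm; set e := (d ^ n)%N in dm *; have e0 : (0 < e)%N by rewrite expn_gt0 d0.
have -> : ((d ^ N) ^ n = e ^ N)%N by rewrite -!expnM mulnC.
set k := (m %/ e)%N.+1; rewrite mulnA -expnS.
have ek : (e * k <= 2 * m)%N.
  rewrite /k mulnS mulnC; have := leq_trunc_div m e; lia.
apply: leq_trans (leq_mul (leqnn _) (fekete_degree_le N k)) _.
have Nk : (N + k <= N.+1 * k)%N by rewrite mulSn addnC leq_add2l leq_pmulr.
rewrite mulnCA -!mulnA leq_mul2l; apply/orP; right; rewrite -expnMn.
apply: (@leq_trans ((N.+1 * 2 * m) ^ N.+1)); last first.
  rewrite [((_ * m) ^ _)%N]expnMn -?mulnA leq_mul2l; apply/orP; right.
  by have := fekete_degree_ge m N0; rewrite factS -mulnA.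
rewrite leq_exp2r // -mulnA; apply: (@leq_trans (N.+1 * (e * k))); last by rewrite leq_mul2l ek orbT.
by rewrite mulnCA leq_mul2l Nk orbT.
Qed.

Lemma sqr_up_log m : (0 < m)%N -> (up_log 2 m.+1 ^ 2 <= 4 * m)%N.
Proof.
move=> m0; have H := @up_log_gtn 2 m.+1 isT m0.
have u0 : (0 < up_log 2 m.+1)%N by rewrite up_log_gt0.
have S u : (u ^ 2 <= 2 * 2 ^ u)%N.
  elim: u => [//|[|[|[|u]]] IH] //; move: IH; rewrite !expnS => IH.
  by move: (2 ^ u)%N IH => x; nia.
apply: leq_trans (S _) _; rewrite -(prednK u0) expnS mulnA leq_mul2l /=.
exact: H.
Qed.

(** The logarithm is at most 2 sqrt m by [sqr_up_log], while D(m) exceeds (m+1)^N by a factor of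
    order m; solving for m gives the threshold 4 (Cn / eps)^2. *)
Lemma monomials_log_small N (eps : R) : (0 < N)%N -> 0 < eps -> exists m0, forall m, (m0 <= m)%N ->
  (up_log 2 m.+1 * m.+1 ^ N)%:R <= eps * (fekete_degree N m)%:R.
Proof.
move=> N0 e0; pose Cn := (2 ^ N * N.+1`!)%N; pose m0 := (Num.truncn (4%:R * (Cn%:R / eps) ^+ 2)).+1.
exists m0 => m mm.
have m_gt0 : (0 < m)%N by apply: leq_trans mm.
have H1 : (m.+1 ^ N * m <= Cn * fekete_degree N m)%N.
  rewrite /Cn -mulnA; apply: leq_trans (leq_mul (leqnn _) (fekete_degree_ge m N0)).
  rewrite expnSr mulnA leq_mul2r; apply/orP; right; rewrite -expnMn.
  by rewrite leq_exp2r // mul2n -addnn -addn1 leq_add2l.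
have H2 := sqr_up_log m_gt0.
set u := up_log 2 m.+1 in H2 *; set P := (m.+1 ^ N)%N in H1 *; set D := fekete_degree N m in H1 *.
have mR : 0 < m%:R :> R by rewrite ltr0n.
have uC : u%:R * Cn%:R <= eps * m%:R :> R.
  rewrite -(@ler_pXn2r _ 2) ?nnegrE ?mulr_ge0 ?(ltW e0) // !exprMn.
  apply: (@le_trans _ _ (4%:R * m%:R * Cn%:R ^+ 2)).
    by rewrite ler_wpM2r ?exprn_ge0 // -natrX -natrM ler_nat.
  have h : 4%:R * Cn%:R ^+ 2 <= m%:R * eps ^+ 2.
    rewrite -ler_pdivrMr ?exprn_gt0 //; apply: ltW.
    have : (4%:R * (Cn%:R / eps) ^+ 2) < m%:R :> R.
      by apply: lt_le_trans (truncnS_gt _) _; rewrite ler_nat.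
    by rewrite expr_div_n mulrA.
  have -> : 4%:R * m%:R * Cn%:R ^+ 2 = 4%:R * Cn%:R ^+ 2 * m%:R :> R by ring.
  have -> : eps ^+ 2 * m%:R ^+ 2 = m%:R * eps ^+ 2 * m%:R :> R by ring.
  by rewrite ler_pM2r.
rewrite -(ler_pM2r mR) natrM -mulrA -natrM; apply: (@le_trans _ _ (u%:R * (Cn * D)%:R)).
  by rewrite ler_wpM2l // ler_nat.
rewrite natrM mulrA [eps * _ * _]mulrAC.
by rewrite ler_wpM2r.
Qed.

Lemma ln_fact_le n (x : R) : 0 <= x -> ln (n%:R : R) <= x -> ln (n`!%:R : R) <= n%:R * x.
Proof.
move=> x0 nx; case: n nx => [|n] nx; first by rewrite fact0 ln1 mul0r.
have F (j : nat) : (j`! <= j ^ j)%N.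
  elim: j => // j IH; rewrite factS expnS leq_mul2l; apply/orP; right.
  by apply: leq_trans IH _; case: j => // j; rewrite leq_exp2r.
apply: (@le_trans _ _ (ln ((n.+1 ^ n.+1)%:R : R))).
  by rewrite ler_ln ?posrE ?ltr0n ?fact_gt0 ?expn_gt0 // ler_nat.
by rewrite natrX lnXn ?ltr0n // mulr_natl lerMn2r nx orbT.
Qed.

Lemma ln_pow2_le m N : ln ((m.+1 ^ N)%:R : R) <= (N * up_log 2 m.+1)%:R.
Proof.
have l2 : ln (2%:R : R) <= 1.
  rewrite -[X in _ <= X]expRK ler_ln ?posrE ?ltr0n ?expR_gt0 //.
  by apply: le_trans (expR_ge1Dx _); rewrite -(natrD _ 1 1).
have H := up_logP m.+1 (ltnSn 1).
apply: (@le_trans _ _ (ln ((2 ^ (N * up_log 2 m.+1))%:R : R))).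
  rewrite ler_ln ?posrE ?ltr0n ?expn_gt0 // ler_nat mulnC expnM.
  by case: N => // N; rewrite leq_exp2r.
by rewrite natrX lnXn ?ltr0n // lerMn2r l2 orbT.
Qed.

End Asymptotics.

Lemma level_estimate (R : realFieldType) (s c n e D q l f : R) :
  - (c * e) <= q - D * s -> f <= n * e -> D * s + D * l - (c + n) * e <= q + l * D - f.
Proof. by move=> h1 h2; lra. Qed.

Lemma upper_estimate (R : realFieldType) (s c n b e D q v x1 x2 : R) :
  q + v <= x2 + x1 -> x1 <= b * e -> - (c * e) <= q - D * s -> x2 <= n * e ->
  v <= - s * D + (c + n + b) * e.
Proof. by move=> h1 h2 h3 h4; lra. Qed.

(** Linear arithmetic behind [good_lower]: the t's are logarithms of the factors in [fekete_lower],
    the a's are rates with respect to the error size [ek], and w D is the loss at the top of the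
    tower. *)
Lemma lower_estimate (R : realFieldType)
    (s c lc a2 a4 a5 ek em D q v t1 t4 t5 t10 x y z w : R) :
  t1 + t10 <= t4 + t5 + (q + v) -> q - D * s <= c * em -> t4 <= a4 * ek -> t5 <= a5 * ek ->
  lc * ek <= t1 -> x - a2 * ek <= t10 -> - y * z <= x -> y * z <= w * D ->
  0 <= - lc + a2 + a4 + a5 -> ek <= em ->
  - s * D - (w * D + (c + - lc + a2 + a4 + a5) * em) <= v.
Proof.
move=> h1 h2 h4 h5 h6 h10 h8 h9 h0 he.
have : (- lc + a2 + a4 + a5) * ek <= (- lc + a2 + a4 + a5) * em by rewrite ler_wpM2l.
by lra.
Qed.

Section GoodLimit.
Variables (R : realType) (N d : nat).
Hypotheses (N_gt0 : (0 < N)%N) (d_gt1 : (1 < d)%N).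
Let d_gt0 : (0 < d)%N := ltnW d_gt1.
Variable F : 'I_N -> {mpoly (C R)[N]}.
Hypothesis hF : forall i, homog d (F i).
Hypothesis A_neq0 : forall m, famdet m (bfam d F) != 0.
Variable K : ('I_N -> C R) -> Prop.
Variables rho r : R.
Hypothesis FK : forall z, K z -> K (fun i => meval z (F i)).
Hypothesis KF : forall z, K (fun i => meval z (F i)) -> K z.
Hypothesis rho_ge1 : 1 <= rho.
Hypothesis K_bounded : forall z, K z -> forall i, modulus (z i) <= rho.
Hypothesis r_gt0 : 0 < r.
Hypothesis K_ball : forall z, (forall i, modulus (z i) <= r) -> K z.
Variables s c' : R.
Hypothesis c'_ge0 : 0 <= c'.
Hypothesis Q_est : forall k,
  `|ln (modulus (boxdet k (qfam d F))) - (boxdeg N k)%:R * s|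
     <= c' * (up_log 2 k)%:R * (boxcard N k)%:R.
Local Notation lnQ m := (ln (modulus (boxdet m.+1 (qfam d F)))).
Local Notation D m := ((fekete_degree N m)%:R : R).
Local Notation E m := ((up_log 2 m.+1 * m.+1 ^ N)%:R : R).

Lemma lnQ_est m : `|lnQ m - D m * s| <= c' * E m.
Proof.
have := Q_est m.+1; rewrite /boxdeg degree_sum => /le_trans; apply.
rewrite natrM -mulrA ler_wpM2l // ler_wpM2l // ler_nat.
exact: num_monomials_le.
Qed.

Lemma ln_fact_num m : ln (((num_monomials N m)`!)%:R : R) <= N%:R * E m.
Proof.
have P0 : (0 < m.+1 ^ N)%N by rewrite expn_gt0.
apply: (@le_trans _ _ (ln (((m.+1 ^ N)`!)%:R : R))).
  by rewrite ler_ln ?posrE ?ltr0n ?fact_gt0 // ler_nat leq_fact // num_monomials_le.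
apply: le_trans (ln_fact_le _ (ln_pow2_le R m N)) _ => //.
by rewrite -!natrM ler_nat [(_ ^ _ * _)%N]mulnC -mulnA.
Qed.

Lemma boxQ_gt0 m : 0 < modulus (boxdet m.+1 (qfam d F)).
Proof. by rewrite modulus_gt0 boxdet_neq0. Qed.

Lemma good_upper : exists2 c : R, 0 <= c &
  forall m (zeta : bmultinom N m.+1 -> 'I_N -> C R), (forall h, K (zeta h)) ->
    vdm zeta != 0 -> ln (modulus (vdm zeta)) <= - s * D m + c * E m.
Proof.
have [B B1 HB] := fekete_upper d_gt1 hF FK rho_ge1 K_bounded.
have lB : 0 <= ln B by rewrite ln_ge0.
have B0 : 0 < B by apply: lt_le_trans B1.
exists (c' + N%:R + ln B); first by rewrite !addr_ge0.
move=> m zeta Kz; rewrite -modulus_gt0 => v0.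
have := HB m zeta Kz; rewrite -ler_ln ?posrE ?mulr_gt0 ?boxQ_gt0 ?ltr0n ?fact_gt0 ?exprn_gt0 //.
rewrite !lnM ?posrE ?boxQ_gt0 ?ltr0n ?fact_gt0 ?exprn_gt0 // -exprM lnXn // => H.
have H1 : ln B *+ (up_log 2 m.+1 * num_monomials N m) <= ln B * E m.
  by rewrite -[ln B *+ _]mulr_natr ler_wpM2l // ler_nat leq_mul2l num_monomials_le orbT.
have H2 := lnQ_est m; rewrite ler_norml in H2; case/andP: H2 => H2 _.
exact: upper_estimate H H1 H2 (ln_fact_num m).
Qed.

(** There are two kinds of loss: c D(m) / d^(n+1) at the top of the tower, with c independent of n,
    and a multiple of E(m) whose constant may grow with n, but which is negligible as m tends to
    infinity. *)
Lemma good_lower : exists2 c : R, 0 <= c & forall n, exists2 cn : R, 0 <= cn &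
  forall m, (d ^ n.+1 < m)%N -> exists2 zeta : bmultinom N m.+1 -> 'I_N -> C R,
    (forall h, K (zeta h)) & vdm zeta != 0 /\
    - s * D m - (c / (d ^ n.+1)%:R * D m + cn * E m) <= ln (modulus (vdm zeta)).
Proof.
pose c3 : R := (N * (N.+1 * 2) ^ N.+1 * N.+1`!)%:R.
have a0 : 0 <= `|s| + `|ln r| by rewrite addr_ge0.
exists ((`|s| + `|ln r|) * c3); first by rewrite mulr_ge0.
move=> n; have [B [c0 [B1 c0p c01 H]]] :=
  fekete_lower d_gt1 hF A_neq0 FK KF rho_ge1 K_bounded r_gt0 K_ball n.+1.
set I := ((d ^ N) ^ n.+1)%N in H *; set e := (d ^ n.+1)%N in H *.
have I0 : (0 < I)%N by rewrite !expn_gt0 d_gt0.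
have e2 : (2 <= e)%N by rewrite /e expnS; apply: leq_trans d_gt1 _; rewrite leq_pmulr // expn_gt0 d_gt0.
have lB : 0 <= ln B by rewrite ln_ge0.
have lI : 0 <= ln (I%:R : R) by rewrite ln_ge0 // ler1n.
have lc : ln c0 <= 0 by rewrite ln_le0.
exists (c' + - ln c0 + I%:R * (c' + N%:R) + I%:R * (ln I%:R + N%:R) + I%:R * (2%:R * ln B)).
  by rewrite !addr_ge0 ?mulr_ge0 ?addr_ge0 ?oppr_ge0.
(* Rounding up ensures m < e k. Working with n.+1 makes e at least 2, whence k <= m. *)
move=> m em; set k := (m %/ e)%N.+1; have [|zeta Kz Hz] := H m k.
  by rewrite /k mulnC ltnW // ltn_ceil // (leq_trans _ e2).
have B0 : 0 < B by apply: lt_le_trans B1.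
have Qk := boxQ_gt0 k; have Qm := boxQ_gt0 m.
have Pk0 : (0 < k.+1 ^ N)%N by rewrite expn_gt0.
have Pk0' : 0 < ((k.+1 ^ N)`!)%:R :> R by rewrite ltr0n fact_gt0.
have X0 : 0 < modulus (boxdet k.+1 (qfam d F)) * r ^+ fekete_degree N k / ((k.+1 ^ N)`!)%:R.
  by rewrite divr_gt0 // mulr_gt0 // exprn_gt0.
have BB0 : 0 < B * B ^+ up_log 2 k.+1 by rewrite mulr_gt0 ?exprn_gt0.
have F0 : 0 < ((I * num_monomials N k)`!)%:R :> R by rewrite ltr0n fact_gt0.
have Y0 : 0 < ((I * num_monomials N k)`!)%:R * (B * B ^+ up_log 2 k.+1) ^+ (I * num_monomials N k).
  by rewrite mulr_gt0 ?exprn_gt0.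
have v0 : 0 < modulus (vdm zeta).
  have : 0 < c0 ^+ (k.+1 ^ N) * (modulus (boxdet k.+1 (qfam d F)) * r ^+ fekete_degree N k /
      ((k.+1 ^ N)`!)%:R) ^+ I by rewrite mulr_gt0 ?exprn_gt0.
  by move/lt_le_trans/(_ Hz); rewrite (pmulr_rgt0 _ Y0) (pmulr_rgt0 _ Qm).
exists zeta => //; split; first by rewrite -modulus_gt0.
have := Hz; rewrite -ler_ln ?posrE; first last.
- by rewrite mulr_gt0 // mulr_gt0.
- by rewrite mulr_gt0 ?exprn_gt0.
rewrite !lnM ?posrE ?mulr_gt0 ?exprn_gt0 // !lnXn // !lnM ?posrE ?mulr_gt0 ?exprn_gt0 ?invr_gt0 //.
rewrite lnV ?posrE // !lnXn //.
move=> {}Hz.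
have k0 : (0 < k)%N by [].
have km : (k <= m)%N.
  by apply: ltn_Pdiv => //; apply: leq_ltn_trans em.
have up1 : (1 <= up_log 2 k.+1)%N by rewrite up_log_gt0.
have Ekm : E k <= E m.
  rewrite ler_nat leq_mul ?leq_up_log ?ltnS //.
  by case: (N) => // N'; rewrite leq_exp2r.
have PE : (k.+1 ^ N)%:R <= E k by rewrite ler_nat leq_pmull.
have MP : ((num_monomials N k)%:R : R) <= (k.+1 ^ N)%:R by rewrite ler_nat num_monomials_le.
have L1 := lnQ_est m; rewrite ler_norml in L1; case/andP: L1 => _ L1.
have L2 := lnQ_est k; rewrite ler_norml in L2; case/andP: L2 => L2 _.
have L3 : ln (((k.+1 ^ N)`!)%:R : R) <= N%:R * E k.
  apply: le_trans (ln_fact_le _ (ln_pow2_le R k N)) _ => //.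
  by rewrite -!natrM ler_nat [(_ ^ _ * _)%N]mulnC -mulnA.
have L4 : ln (((I * num_monomials N k)`!)%:R : R) <= I%:R * (ln I%:R + N%:R) * E k.
  apply: (@le_trans _ _ (ln (((I * k.+1 ^ N)`!)%:R : R))).
    by rewrite ler_ln ?posrE ?ltr0n ?fact_gt0 // ler_nat leq_fact // leq_mul2l num_monomials_le orbT.
  have x0 : 0 <= ln (I%:R : R) + (N * up_log 2 k.+1)%:R by rewrite addr_ge0.
  apply: le_trans (ln_fact_le x0 _) _.
    by rewrite natrM lnM ?posrE ?ltr0n // lerD2l ln_pow2_le.
  rewrite natrM -!mulrA ler_wpM2l // mulrDr mulrDl lerD //.
    by rewrite mulrC ler_wpM2l.
  by rewrite -!natrM ler_nat [(_ ^ _ * _)%N]mulnC -mulnA.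
have L5 : (ln B + ln B *+ up_log 2 k.+1) *+ (I * num_monomials N k) <= I%:R * (2%:R * ln B) * E k.
  rewrite -mulrS -[_ *+ _.+1]mulr_natr -[_ *+ (_ * _)]mulr_natr natrM.
  have -> : ln B * (up_log 2 k.+1).+1%:R * (I%:R * (num_monomials N k)%:R) =
     I%:R * ln B * ((up_log 2 k.+1).+1%:R * (num_monomials N k)%:R) by ring.
  have -> : I%:R * (2%:R * ln B) * E k = I%:R * ln B * (2%:R * E k) by ring.
  rewrite ler_wpM2l ?mulr_ge0 // -!natrM ler_nat mulnA leq_mul ?num_monomials_le //.
  by rewrite mul2n -addnn -addn1 leq_add2l.
have L6 : ln c0 * E k <= ln c0 *+ (k.+1 ^ N) by rewrite -[ln c0 *+ _]mulr_natr ler_wnM2l.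
have L7 : I%:R * D k <= c3 / e%:R * D m.
  rewrite mulrAC ler_pdivlMr ?ltr0n ?(ltnW e2) // mulrC -!natrM ler_nat.
  by apply: fekete_degree_blocks => //; apply: ltnW.
have L8 : - (`|s| + `|ln r|) * (I%:R * D k) <= I%:R * (D k * s + D k * ln r).
  have Dk0 : 0 <= D k by [].
  have -> : I%:R * (D k * s + D k * ln r) = (s + ln r) * (I%:R * D k) by ring.
  rewrite ler_wpM2r ?mulr_ge0 // opprD lerD //; apply: lerNnormlW; exact: lexx.
have L9 : (`|s| + `|ln r|) * (I%:R * D k) <= (`|s| + `|ln r|) * c3 / e%:R * D m.
  by rewrite -!mulrA ler_wpM2l // !mulrA.
have L10 : (lnQ k + ln r *+ fekete_degree N k - ln ((k.+1 ^ N)`!)%:R) *+ I >=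
   I%:R * (D k * s + D k * ln r) - I%:R * (c' + N%:R) * E k.
  have -> : I%:R * (D k * s + D k * ln r) - I%:R * (c' + N%:R) * E k =
    (D k * s + D k * ln r - (c' + N%:R) * E k) * I%:R by ring.
  rewrite -[X in _ <= X]mulr_natr -[ln r *+ _]mulr_natr ler_wpM2r //.
  exact: level_estimate L2 L3.
apply: lower_estimate Hz L1 L4 L5 L6 L10 L8 L9 _ Ekm.
by rewrite !addr_ge0 ?mulr_ge0 ?addr_ge0 ?oppr_ge0.
Qed.

(* The bounds of [fekete_upper] and [fekete_lower] are of size [o (fekete_degree N m)],
   up to the contribution of the top level of the tower in the lower bound, which is
   [O (fekete_degree N m / d ^ n)]. *)
Lemma good_limit (eps : R) : 0 < eps -> exists m0, forall m, (m0 <= m)%N ->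
  (forall zeta : bmultinom N m.+1 -> 'I_N -> C R, (forall h, K (zeta h)) ->
    vdm zeta != 0 -> ln (modulus (vdm zeta)) <= (- s + eps) * D m) /\
  (exists2 zeta : bmultinom N m.+1 -> 'I_N -> C R, (forall h, K (zeta h)) &
    vdm zeta != 0 /\ (- s - eps) * D m <= ln (modulus (vdm zeta))).
Proof.
move=> e0; have [cu cu0 Hu] := good_upper; have [cl cl0 Hl] := good_lower.
have small (c del : R) : 0 <= c -> 0 < del -> exists m0, forall m, (m0 <= m)%N -> c * E m <= del * D m.
  move=> c0 del0; have c1 : 0 < c + 1 by rewrite ltr_wpDl.
  have [m0 Hm] := monomials_log_small N_gt0 (divr_gt0 del0 c1).
  exists m0 => m /Hm; rewrite mulrAC ler_pdivlMr //; apply: le_trans.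
  by rewrite mulrC ler_wpM2l // lerDl.
have e20 : 0 < eps / 2 by rewrite divr_gt0.
pose n := Num.truncn (cl / (eps / 2)); have [cn cn0 Hn] := Hl n.
have [m1 H1] := small _ _ cu0 e0; have [m2 H2] := small _ _ cn0 e20.
exists (maxn (maxn m1 m2) (d ^ n.+1).+1) => m; rewrite !geq_max => /andP[/andP[mm1 mm2] mm3].
split=> [zeta Kz v0|].
  apply: le_trans (Hu m zeta Kz v0) _; rewrite mulrDl lerD2l; exact: H1.
have [zeta Kz [v0 Hv]] := Hn m mm3; exists zeta => //; split=> //.
apply: le_trans Hv; rewrite mulrDl lerD2l mulNr lerN2.
have -> : eps = eps / 2 + eps / 2 by lra.
rewrite [X in _ <= X]mulrDl lerD ?H2 // ler_wpM2r //.
have nd : n.+1%:R <= (d ^ n.+1)%:R :> R by rewrite ler_nat ltnW // ltn_expl.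
rewrite ler_pdivrMr ?ltr0n ?expn_gt0 ?d_gt0 // mulrC -ler_pdivrMr //.
by apply: le_trans nd; apply: ltW; apply: truncnS_gt.
Qed.

End GoodLimit.

(** * Geometry of the filled Julia set *)

Lemma meval_scale (K : comNzRingType) N t (p : {mpoly K[N]}) v (a : K) : homog t p ->
  meval (fun i => a * v i) p = a ^+ t * meval v p.
Proof.
move=> hp; rewrite (deg_le_expand (homog_deg_le hp)) !raddf_sum mulr_sumr /=.
apply: eq_bigr => m _; rewrite !mevalZ !mevalX.
have [E|E] := eqVneq (mdeg (bmnm m)) t; last by rewrite hp // !mul0r mulr0.
rewrite mulrCA; congr (_ * _); under eq_bigr do rewrite exprMn.
by rewrite big_split /= prodrXr -mdegE E.
Qed.

Lemma eval_homog_scale (K : comNzRingType) N d (F : 'I_N -> {mpoly K[N]}) v (a : K) :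
  (forall i, homog d (F i)) -> (fun i => meval (fun j => a * v j) (F i)) =
    (fun i => a ^+ d * meval v (F i)).
Proof. by move=> hF; apply/funext => i; apply: meval_scale. Qed.

Section SumNorm.
Variables (R : realType) (N : nat).
Implicit Types (z w : 'I_N -> C R) (p : {mpoly (C R)[N]}).

(** The sum norm, equivalent to the Euclidean one by [enorm_bounds], so that it defines the same
    filled Julia set. *)
Definition nrm z : R := \sum_i modulus (z i).

Lemma nrm_ge0 z : 0 <= nrm z.
Proof. by apply: sumr_ge0 => i _; apply: modulus_ge0. Qed.

Lemma modulus_le_nrm z i : modulus (z i) <= nrm z.
Proof. by rewrite /nrm (bigD1 i) //= lerDl sumr_ge0 // => j _; apply: modulus_ge0. Qed.

Lemma nrm_le z (B : R) : (forall i, modulus (z i) <= B) -> nrm z <= N%:R * B.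
Proof.
move=> H; rewrite /nrm -[N in N%:R](card_ord N) mulr_natl -sumr_const.
by apply: ler_sum => i _; apply: H.
Qed.

Lemma nrmD z w : nrm (fun i => z i + w i) <= nrm z + nrm w.
Proof. by rewrite /nrm -big_split; apply: ler_sum => i _; apply: modulusD. Qed.

Lemma nrmZ (a : C R) z : nrm (fun i => a * z i) = modulus a * nrm z.
Proof. by rewrite mulr_sumr; apply: eq_bigr => i _; rewrite modulusM. Qed.

Lemma nrm_eq0 z : nrm z = 0 -> forall i, z i = 0.
Proof.
move=> E i; apply/eqP; rewrite -modulus_eq0 eq_le modulus_ge0 andbT.
by rewrite -[X in _ <= X]E modulus_le_nrm.
Qed.

Lemma poly_lipschitz p (B : R) : 0 <= B -> exists2 L : R, 0 <= L & forall z w,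
  nrm z <= B -> nrm w <= B -> modulus (meval z p - meval w p) <= L * nrm (fun i => z i - w i).
Proof.
move=> B0; pose Q p := exists2 L : R, 0 <= L & forall z w,
  nrm z <= B -> nrm w <= B -> modulus (meval z p - meval w p) <= L * nrm (fun i => z i - w i).
have QC a : Q (mpolyC N a).
  by exists 0 => // z w _ _; rewrite !mevalC subrr modulus0 mul0r.
have QD q q' : Q q -> Q q' -> Q (q + q').
  move=> [L L0 H] [L' L0' H']; exists (L + L'); first exact: addr_ge0.
  move=> z w zB wB; rewrite !mevalD opprD addrACA mulrDl.
  by apply: le_trans (modulusD _ _) _; apply: lerD; [exact: H|exact: H'].
have QM q q' : Q q -> Q q' -> Q (q * q').
  move=> [L L0 H] [L' L0' H'].
  have [M M1 HM] := poly_bounded q B0; have [M' M1' HM'] := poly_bounded q' B0.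
  have M0 : 0 <= M by apply: le_trans M1; apply: ler01.
  have M0' : 0 <= M' by apply: le_trans M1'; apply: ler01.
  exists (L * M' + M * L'); first by rewrite addr_ge0 ?mulr_ge0.
  move=> z w zB wB; rewrite !mevalM.
  have -> : meval z q * meval z q' - meval w q * meval w q' =
    (meval z q - meval w q) * meval z q' + meval w q * (meval z q' - meval w q').
    by rewrite mulrBl mulrBr addrA subrK.
  have bz i : modulus (z i) <= B by apply: le_trans (modulus_le_nrm _ _) zB.
  have bw i : modulus (w i) <= B by apply: le_trans (modulus_le_nrm _ _) wB.
  apply: le_trans (modulusD _ _) _; rewrite !modulusM mulrDl; apply: lerD.
    by rewrite mulrAC; apply: ler_pM (HM' z bz); rewrite ?modulus_ge0 ?H.
  by rewrite -mulrA; apply: ler_pM (HM w bw) _; rewrite ?modulus_ge0 ?H'.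
have QX k : Q (mpolyX (C R) (mnm1 k)).
  exists 1 => // z w _ _; rewrite !mevalXU mul1r.
  exact: (modulus_le_nrm (fun i => z i - w i)).
exact: (@mpoly_closure _ _ Q QC QD QM QX).
Qed.

Lemma polymap_lipschitz (F : 'I_N -> {mpoly (C R)[N]}) (B : R) : 0 <= B ->
  exists2 L : R, 0 <= L & forall z w, nrm z <= B -> nrm w <= B ->
    nrm (fun i => meval z (F i) - meval w (F i)) <= L * nrm (fun i => z i - w i).
Proof.
move=> B0; have /choice[L HL] : forall i, exists L : R, 0 <= L /\ forall z w,
    nrm z <= B -> nrm w <= B -> modulus (meval z (F i) - meval w (F i)) <= L * nrm (fun i => z i - w i).
  by move=> i; have [L L0 H] := poly_lipschitz (F i) B0; exists L.
exists (\sum_i L i); first by apply: sumr_ge0 => i _; apply: (HL i).1.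
move=> z w zB wB; rewrite mulr_suml; apply: ler_sum => i _.
exact: (HL i).2.
Qed.

Lemma polymap_bounded (F : 'I_N -> {mpoly (C R)[N]}) (B : R) : 0 <= B ->
  exists2 M : R, 1 <= M & forall z, nrm z <= B -> nrm (fun i => meval z (F i)) <= M.
Proof.
move=> B0; have /choice[b H] : forall i, exists b : R, 1 <= b /\
    forall z, (forall i, modulus (z i) <= B) -> modulus (meval z (F i)) <= b.
  by move=> i; have [b b1 Hb] := poly_bounded (F i) B0; exists b.
exists (1 + \sum_i b i).
  by rewrite lerDl sumr_ge0 // => i _; apply: le_trans ler01 (H i).1.
move=> z z1; apply: (@le_trans _ _ (\sum_i b i)); last by rewrite lerDr.
apply: ler_sum => i _; apply: (H i).2 => j.
exact: le_trans (modulus_le_nrm _ _) z1.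
Qed.

Variable d : nat.
Hypothesis d_gt0 : (0 < d)%N.
Hypothesis N_gt0 : (0 < N)%N.
Variable F : 'I_N -> {mpoly (C R)[N]}.
Hypothesis hF : forall i, homog d (F i).
Hypothesis F0 : forall z, (forall i, meval z (F i) = 0) -> forall i, z i = 0.

(** Real coordinates on C^N, in which the extreme value theorem is applied in [proper]. *)
Let cpl (x : 'rV[R]_(N + N)) : 'I_N -> C R := fun i => (x 0 (lshift N i) +i* x 0 (rshift N i))%C.

Lemma modulus_parts (a b : R) : [/\ modulus (a +i* b)%C <= `|a| + `|b|,
  `|a| <= modulus (a +i* b)%C & `|b| <= modulus (a +i* b)%C].
Proof.
rewrite /modulus /ComplexField.Normc.normc; split.
- rewrite -[X in _ <= X]ger0_norm ?addr_ge0 // -sqrtr_sqr ler_sqrt ?sqr_ge0 //.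
  rewrite sqrrD !real_normK ?num_real // lerD2r lerDl.
  by rewrite mulrn_wge0 // mulr_ge0.
- by rewrite -sqrtr_sqr ler_sqrt ?addr_ge0 ?sqr_ge0 // lerDl sqr_ge0.
- by rewrite -sqrtr_sqr ler_sqrt ?addr_ge0 ?sqr_ge0 // lerDr sqr_ge0.
Qed.

Lemma lipschitz_continuous (G : 'I_N -> {mpoly (C R)[N]}) :
  continuous (fun x => nrm (fun i => meval (cpl x) (G i))).
Proof.
move=> x; have B0 : 0 <= nrm (cpl x) + (N * 2)%:R by rewrite addr_ge0 ?nrm_ge0.
have [L L0 HL] := polymap_lipschitz G B0.
have close y : nrm (fun i => cpl y i - cpl x i) <= (N * 2)%:R * `|y - x|.
  rewrite natrM -mulrA; apply: nrm_le => i.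
  have -> : cpl y i - cpl x i = ((y - x) 0 (lshift N i) +i* (y - x) 0 (rshift N i))%C.
    by rewrite /cpl !mxE.
  have [H _ _] := modulus_parts ((y - x) 0 (lshift N i)) ((y - x) 0 (rshift N i)).
  apply: le_trans H _; rewrite mulr_natl mulr2n lerD //.
    by rewrite {2}/Num.norm /= mx_normrE; apply: (le_bigmax _ (fun ij => `|(y - x) ij.1 ij.2|) (0, lshift N i)).
  by rewrite {2}/Num.norm /= mx_normrE; apply: (le_bigmax _ (fun ij => `|(y - x) ij.1 ij.2|) (0, rshift N i)).
apply/(@cvgrPdist_le _ _ _ _ (nbhs_filter x)) => e e0.
pose del := Num.min 1 (e / (L * (N * 2)%:R + 1)).
have LN : 0 < L * (N * 2)%:R + 1 by rewrite ltr_wpDl // mulr_ge0.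
have del0 : 0 < del by rewrite lt_min ltr01 divr_gt0.
near=> y; have yx : `|y - x| <= del.
  near: y; have := @nbhsx_ballx _ _ x _ del0; apply: filterS => y.
  by rewrite -ball_normE /= distrC => /ltW.
have y1 : nrm (fun i => cpl y i - cpl x i) <= (N * 2)%:R.
  have yx1 : `|y - x| <= 1 by apply: (le_trans yx); rewrite ge_min lexx.
  by apply: le_trans (close y) _; rewrite -[X in _ <= X]mulr1 ler_wpM2l.
have yB : nrm (cpl y) <= nrm (cpl x) + (N * 2)%:R.
  have -> : cpl y = (fun i => cpl x i + (cpl y i - cpl x i)).
    by apply/funext => i; rewrite addrC subrK.
  by apply: le_trans (nrmD _ _) _; rewrite lerD2l.
have xB : nrm (cpl x) <= nrm (cpl x) + (N * 2)%:R by rewrite lerDl.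
have tri u v : nrm u - nrm v <= nrm (fun i => u i - v i).
  rewrite lerBlDr; apply: le_trans (nrmD _ _).
  by rewrite le_eqVlt; apply/orP; left; apply/eqP; apply: eq_bigr => i _; rewrite subrK.
have key u v : nrm u <= nrm (cpl x) + (N * 2)%:R -> nrm v <= nrm (cpl x) + (N * 2)%:R ->
   nrm (fun i => u i - v i) <= (N * 2)%:R * del ->
   nrm (fun i => meval u (G i)) - nrm (fun i => meval v (G i)) <= e.
  move=> uB vB uv; apply: le_trans (tri _ _) _; apply: le_trans (HL u v uB vB) _.
  apply: (@le_trans _ _ (L * ((N * 2)%:R * del))); first by rewrite ler_wpM2l.
  rewrite mulrA; apply: (@le_trans _ _ ((L * (N * 2)%:R + 1) * del)).
    by rewrite ler_wpM2r ?(ltW del0) // lerDl.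
  by rewrite -ler_pdivlMl // [_^-1 * _]mulrC /del ge_min lexx orbT.
have yx' : nrm (fun i => cpl y i - cpl x i) <= (N * 2)%:R * del.
  by apply: le_trans (close y) _; rewrite ler_wpM2l.
have xy' : nrm (fun i => cpl x i - cpl y i) <= (N * 2)%:R * del.
  rewrite (_ : nrm _ = nrm (fun i => cpl y i - cpl x i)) //.
  by apply: eq_bigr => i _; rewrite -modulusN opprB.
have h1 := key _ _ xB yB xy'; have h2 := key _ _ yB xB yx'.
by rewrite ler_norml h1 andbT lerNl opprB.
Unshelve. all: by end_near. Qed.

(** By homogeneity it suffices to bound the norm of F from below on the unit sphere, which is
    compact and contains no zero of F. *)
Lemma proper : exists2 c : R, 0 < c & forall z, c * nrm z ^+ d <= nrm (fun i => meval z (F i)).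
Proof.
pose A : set 'rV[R]_(N + N) := [set x | nrm (cpl x) = 1].
have nE : (fun x => nrm (cpl x)) = (fun x => nrm (fun i => meval (cpl x) (mpolyX (C R) (mnm1 i)))).
  by apply/funext => x; apply: eq_bigr => i _; rewrite mevalXU.
have cn : continuous (fun x => nrm (cpl x)) by rewrite nE; apply: lipschitz_continuous.
have clA : closed A.
  rewrite (_ : A = (fun x => nrm (cpl x)) @^-1` [set 1]) //.
  by apply: closed_comp; [move=> x _; apply: cn|exact: closed_eq].
have bA : bounded_set A.
  exists 1; split; first exact: num_real.
  move=> b b1 x; rewrite /A /= => Ax; rewrite /Num.norm /= mx_normrE.
  apply: bigmax_le => [|[a j] _ /=]; first by rewrite ltW // (lt_trans _ b1).
  rewrite (ord1 a); apply: le_trans (ltW b1); rewrite -Ax.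
  case: (fintype.splitP j) => k jk.
    rewrite (_ : j = lshift N k); last exact: val_inj.
    by have [_ H _] := modulus_parts (x 0 (lshift N k)) (x 0 (rshift N k)); apply: le_trans H (modulus_le_nrm (cpl x) k).
  rewrite (_ : j = rshift N k); last exact: val_inj.
  by have [_ _ H] := modulus_parts (x 0 (lshift N k)) (x 0 (rshift N k)); apply: le_trans H (modulus_le_nrm (cpl x) k).
pose unc z : 'rV[R]_(N + N) := row_mx (\row_i complex.Re (z i)) (\row_i complex.Im (z i)).
have uncK z : cpl (unc z) = z.
  apply/funext => i; rewrite /cpl /unc row_mxEl row_mxEr !mxE.
  by case: (z i).
have A0 : A !=set0.
  exists (unc (fun i => (i == Ordinal N_gt0)%:R : C R)); rewrite /A /= uncK /nrm (bigD1 (Ordinal N_gt0)) // eqxx modulus1.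
  by rewrite big1 => [|i /negbTE ->]; [exact: addr0|exact: modulus0].
have cF : {within A, continuous (fun x => nrm (fun i => meval (cpl x) (F i)))}.
  by apply: continuous_subspaceT; apply: lipschitz_continuous.
have [x Ax Hx] := EVT_min_rV A0 (bounded_closed_compact bA clA) cF.
exists (nrm (fun i => meval (cpl x) (F i))).
  rewrite lt_neqAle nrm_ge0 andbT eq_sym; apply/eqP => /nrm_eq0 /F0 E.
  move: Ax; rewrite inE /A /= /nrm big1 => [/eqP|i _]; first by rewrite eq_sym oner_eq0.
  by rewrite E modulus0.
move=> z; have [z0|z0] := eqVneq (nrm z) 0.
  by rewrite z0 expr0n gtn_eqF // mulr0 nrm_ge0.
have zp : 0 < nrm z by rewrite lt_neqAle eq_sym z0 nrm_ge0.
pose a : C R := ((nrm z)^-1)%:C%C.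
have ma : modulus a = (nrm z)^-1 by rewrite modulus_real ger0_norm // invr_ge0 nrm_ge0.
have := Hx (unc (fun i => a * z i)); rewrite uncK (eval_homog_scale _ _ hF) nrmZ modulusX ma exprVn.
rewrite ler_pdivlMl ?exprn_gt0 // mulrC; apply.
by rewrite inE /A /= uncK nrmZ ma mulVf.
Qed.

End SumNorm.

Section FilledJulia.
Variables (R : realType) (N d : nat).
Hypotheses (N_gt0 : (0 < N)%N) (d_gt1 : (1 < d)%N).
Let d_gt0 : (0 < d)%N := ltnW d_gt1.
Local Notation pt := ('I_N -> C R).
Local Notation ap F := (fun z i => meval z (F i)).

Definition julia (F : 'I_N -> {mpoly (C R)[N]}) (z : pt) : Prop :=
  exists B : R, forall n, nrm (iter n (ap F) z) <= B.

Lemma pow_small (q eps : R) : 0 <= q -> q < 1 -> 0 < eps -> exists n, q ^+ n <= eps.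
Proof.
move=> q0 q1 e0; have : (fun n => q ^+ n) @ \oo --> (0 : R).
  by apply: cvg_expr; rewrite ger0_norm.
move/cvgrPdist_le/(_ _ e0) => [n _ /(_ n (leqnn n))] /=.
by rewrite sub0r normrN ger0_norm ?exprn_ge0 // => H; exists n.
Qed.

Section OneMap.
Variable F : 'I_N -> {mpoly (C R)[N]}.
Hypothesis hF : forall i, homog d (F i).
Hypothesis F0 : forall z, (forall i, meval z (F i) = 0) -> forall i, z i = 0.
Local Notation K := (julia F).

Lemma julia_fwd z : K z -> K (ap F z).
Proof. by move=> [B H]; exists B => n; rewrite -iterSr. Qed.

Lemma julia_bwd z : K (ap F z) -> K z.
Proof.
move=> [B H]; exists (Num.max B (nrm z)) => -[|n]; first by rewrite le_max lexx orbT.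
by rewrite iterSr le_max H.
Qed.

Lemma iter_scale n (a : C R) z :
  iter n (ap F) (fun i => a * z i) = (fun i => a ^+ (d ^ n) * iter n (ap F) z i).
Proof.
elim: n => [|n IH] /=; first by rewrite expn0 expr1.
by rewrite IH (eval_homog_scale _ _ hF) expnSr exprM.
Qed.

Lemma julia_scale (a : C R) z : modulus a <= 1 -> K z -> K (fun i => a * z i).
Proof.
move=> a1 [B H]; exists B => n; rewrite iter_scale nrmZ modulusX.
apply: le_trans (H n); rewrite ler_piMl ?nrm_ge0 // exprn_ile1 ?modulus_ge0 //.
Qed.

(** Beyond norm max(1, 2/c), [proper] and d >= 2 give |F(z)| >= c |z|^d >= 2 |z|, so the orbit
    escapes. *)
Lemma julia_bounded : exists2 rho : R, 1 <= rho & forall z, K z -> nrm z <= rho.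
Proof.
have [c c0 Hc] := proper d_gt0 N_gt0 hF F0.
exists (Num.max 1 (2 / c)); first by rewrite le_max lexx.
move=> z [B H]; rewrite leNgt; apply/negP; rewrite gt_max => /andP[z1 zc].
have grow w : 1 < nrm w -> 2 / c < nrm w -> 2 * nrm w <= nrm (ap F w).
  move=> w1 wc; apply: le_trans (Hc w).
  rewrite -(prednK d_gt0) exprS mulrA; apply: ler_pM; rewrite ?nrm_ge0 //.
    by rewrite mulrC -ler_pdivrMr // ltW.
  by apply: ler_eXnr; [case: (d) d_gt1 => [|[]]|exact: ltW].
have G n : 1 < nrm (iter n (ap F) z) /\ 2 / c < nrm (iter n (ap F) z) /\ 2 ^+ n <= nrm (iter n (ap F) z).
  elim: n => [|n [IH1 [IH2 IH3]]] /=; first by rewrite expr0 (ltW z1).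
  have g := grow _ IH1 IH2; split; [|split].
  - by apply: lt_le_trans IH1 (le_trans _ g); rewrite ler_peMl ?nrm_ge0 // ler1n.
  - by apply: lt_le_trans IH2 (le_trans _ g); rewrite ler_peMl ?nrm_ge0 // ler1n.
  - by apply: le_trans g; rewrite exprS ler_wpM2l.
have B0 : 0 < `|B| + 1 by rewrite ltr_wpDl.
have h20 : (0 : R) <= 2^-1 by rewrite invr_ge0.
have h21 : (2^-1 : R) < 1 by rewrite invf_lt1 ?ltr1n.
have [n Hn] := pow_small h20 h21 (divr_gt0 ltr01 B0).
have {Hn} : `|B| + 1 <= 2 ^+ n :> R by move: Hn; rewrite exprVn div1r lef_pV2 ?posrE ?exprn_gt0.
have [_ [_ h]] := G n; move=> h'; have := le_trans h' (le_trans h (H n)).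
by rewrite leNgt (le_lt_trans (ler_norm B)) // ltrDl.
Qed.

(** If B >= 1 bounds F on the unit ball, the ball of radius 1/B is mapped into itself, since (1/B)^d
    B <= 1/B for d >= 2. *)
Lemma julia_ball : exists2 r : R, 0 < r & forall z, nrm z <= r -> K z.
Proof.
have [B B1 HB] := polymap_bounded F (@ler01 R).
have Bp : 0 < B by apply: lt_le_trans B1.
exists B^-1; first by rewrite invr_gt0.
move=> z zr; exists B^-1; elim=> [|n IH] //=; set w := iter n _ z in IH *.
have mB : modulus (B%:C%C : C R) = B by rewrite modulus_real ger0_norm // ltW.
have mBV : modulus ((B^-1)%:C%C : C R) = B^-1 by rewrite modulus_real ger0_norm // invr_ge0 ltW.
pose u i := B%:C%C * w i; have u1 : nrm u <= 1 by rewrite nrmZ mB -ler_pdivlMl // mulr1.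
have -> : w = (fun i => (B^-1)%:C%C * u i).
  apply/funext => i; rewrite /u mulrA -rmorphM /= mulVf ?gt_eqF // rmorph1 mul1r //.
rewrite (eval_homog_scale _ _ hF) nrmZ modulusX mBV.
apply: (@le_trans _ _ (B^-1 ^+ d * B)); first by rewrite ler_wpM2l ?exprn_ge0 ?invr_ge0 ?(ltW Bp) ?HB.
case: (d) d_gt1 => [|[|e]] // _; rewrite exprSr -mulrA mulVf ?gt_eqF // mulr1.
by rewrite exprS ler_piMr ?invr_ge0 ?(ltW Bp) // exprn_ile1 ?invr_ge0 ?(ltW Bp) // invf_le1.
Qed.

(** For n large, F^n(th u) = th^(d^n) F^n(u) lies in half the ball of [julia_ball], uniformly in u;
    as F^n is Lipschitz on bounded sets, F^n(w) is still in that ball. *)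
Lemma julia_interior (th : R) : 0 < th -> th < 1 -> exists2 eps : R, 0 < eps &
  forall u w, K u -> nrm (fun i => w i - th%:C%C * u i) <= eps -> K w.
Proof.
move=> t0 t1; have [rho rho1 Hrho] := julia_bounded; have [r r0 Hr] := julia_ball.
have rho0 : 0 < rho by apply: lt_le_trans rho1.
have mt : modulus (th%:C%C : C R) = th by rewrite modulus_real ger0_norm // ltW.
have [n Hn] := pow_small (ltW t0) t1 (divr_gt0 (divr_gt0 r0 (ltr0Sn R 1)) rho0).
have [L L0 HL] := polymap_lipschitz (iterate F n) (B := rho + 1) (addr_ge0 (ltW rho0) ler01).
have L1 : 0 < L + 1 by rewrite ltr_wpDl.
exists (Num.min 1 (r / 2 / (L + 1))); first by rewrite lt_min ltr01 !divr_gt0.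
move=> u w Ku; rewrite le_min => /andP[w1 wL].
have Kn m : K (iter m (ap F) u) by elim: m => //= m; apply: julia_fwd.
set v := (fun i => th%:C%C * u i) in w1 wL *.
have nv : nrm v <= rho.
  by rewrite nrmZ mt; apply: le_trans (Hrho _ Ku); rewrite ler_piMl ?nrm_ge0 // ltW.
have nw : nrm w <= rho + 1.
  have -> : w = (fun i => v i + (w i - v i)) by apply/funext => i; rewrite addrC subrK.
  by apply: le_trans (nrmD _ _) _; apply: lerD.
have itE z : (fun i => meval z (iterate F n i)) = iter n (ap F) z by apply: meval_iterate.
have nFv : nrm (iter n (ap F) v) <= r / 2.
  rewrite iter_scale nrmZ modulusX mt.
  apply: (@le_trans _ _ (th ^+ n * rho)).
    apply: ler_pM; rewrite ?exprn_ge0 ?nrm_ge0 ?(ltW t0) ?Hrho //.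
    by rewrite ler_wiXn2l ?(ltW t0) ?(ltW t1) // ltnW // ltn_expl.
  by rewrite -ler_pdivlMr.
have nFw : nrm (iter n (ap F) w) <= r.
  have -> : iter n (ap F) w = (fun i => iter n (ap F) v i +
      (meval w (iterate F n i) - meval v (iterate F n i))).
    by apply/funext => i; rewrite -!itE /= addrC subrK.
  apply: le_trans (nrmD _ _) _; rewrite [r]splitr; apply: lerD => //.
  apply: le_trans (HL w v nw _) _; first by apply: le_trans nv _; rewrite lerDl.
  apply: le_trans (ler_wpM2l L0 wL) _; apply: (@le_trans _ _ ((L + 1) * (r / 2 / (L + 1)))).
    by rewrite ler_wpM2r ?divr_ge0 ?(ltW r0) ?(ltW L1) // lerDl.
  by rewrite mulrC divfK // gt_eqF.
have := Hr _ nFw; elim: (n) => //= m IH; move/julia_bwd; exact: IH.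
Qed.

End OneMap.

Variables F G : 'I_N -> {mpoly (C R)[N]}.
Hypothesis hF : forall i, homog d (F i).
Hypothesis F0 : forall z, (forall i, meval z (F i) = 0) -> forall i, z i = 0.
Hypothesis hG : forall i, homog d (G i).

(** G maps th K_F into itself: G(th z) = th^d G(z), and th G(z), being close to th F(z), is in K_F
    by the interior estimate. *)
Lemma julia_inner (th rho eps : R) : 0 < th -> th < 1 ->
  (forall z, julia F z -> nrm z <= rho) ->
  (forall u w, julia F u -> nrm (fun i => w i - th%:C%C * u i) <= eps -> julia F w) ->
  (forall z, nrm z <= rho -> nrm (fun i => meval z (G i) - meval z (F i)) <= eps) ->
  forall z, julia F z -> julia G (fun i => th%:C%C * z i).
Proof.
move=> t0 t1 Hrho Hin close; have mt : modulus (th%:C%C : C R) = th by rewrite modulus_real ger0_norm // ltW.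
have step z : julia F z -> exists2 w, julia F w & ap G (fun i => th%:C%C * z i) = (fun i => th%:C%C * w i).
  move=> Kz; exists (fun i => th%:C%C ^+ d.-1 * meval z (G i)).
    rewrite -(prednK (_ : 0 < d.-1)%N); last by case: (d) d_gt1 => [|[]].
    have -> : (fun i => th%:C%C ^+ d.-1.-1.+1 * meval z (G i)) =
        (fun i => th%:C%C ^+ d.-1.-1 * (th%:C%C * meval z (G i))).
      by apply/funext => i; rewrite exprSr mulrA.
    apply: (julia_scale hF); first by rewrite modulusX mt exprn_ile1 // ltW.
    apply: (Hin _ _ (julia_fwd Kz)).
    have -> : (fun i => th%:C%C * meval z (G i) - th%:C%C * meval z (F i)) =
      (fun i => th%:C%C * (meval z (G i) - meval z (F i))) by apply/funext => i; rewrite mulrBr.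
    rewrite nrmZ mt; apply: le_trans (close z (Hrho _ Kz)).
    by rewrite ler_piMl ?nrm_ge0 // ltW.
  rewrite (eval_homog_scale _ _ hG); apply/funext => i.
  by rewrite mulrA -exprS prednK.
move=> z Kz; exists rho => n.
suff [w Kw ->] : exists2 w, julia F w & iter n (ap G) (fun i => th%:C%C * z i) = (fun i => th%:C%C * w i).
  by rewrite nrmZ mt; apply: le_trans (Hrho _ Kw); rewrite ler_piMl ?nrm_ge0 // ltW.
elim: n => [|n [w Kw E]] /=; first by exists z.
by have [w' Kw' E'] := step w Kw; exists w' => //; rewrite E.
Qed.

(* [z] is followed through the shells [th ^- j K \ th ^- j.+1 K]: once [j] is large,
   it increases under [G]. *)
Lemma julia_outer (th rho eps r : R) : 0 < th -> th < 1 -> 0 < r ->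
  (forall z, nrm z <= r -> julia F z) ->
  (forall z, julia F z -> nrm z <= rho) ->
  (forall u w, julia F u -> nrm (fun i => w i - th%:C%C * u i) <= eps -> julia F w) ->
  (forall z, nrm z <= rho -> nrm (fun i => meval z (G i) - meval z (F i)) <= th ^+ d * eps) ->
  forall z, julia G z -> julia F (fun i => th%:C%C ^+ 3 * z i).
Proof.
move=> t0 t1 r0 Hr Hrho Hin close; set t : C R := th%:C%C in Hin *.
have mt : modulus t = th by rewrite modulus_real ger0_norm // ltW.
have tn0 : t != 0 by rewrite -modulus_eq0 mt gt_eqF.
pose S j (z : pt) := julia F (fun i => t ^+ j * z i).
have Smono j k z : (j <= k)%N -> S j z -> S k z.
  move=> jk Sj; rewrite /S -(subnK jk).
  have -> : (fun i => t ^+ (k - j + j) * z i) = (fun i => t ^+ (k - j) * (t ^+ j * z i)).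
    by apply/funext => i; rewrite exprD mulrA.
  by apply: (julia_scale hF) => //; rewrite modulusX mt exprn_ile1 // ltW.
have absorb (B : R) : exists j, forall z, nrm z <= B -> S j z.
  have B0 : 0 < `|B| + 1 by rewrite ltr_wpDl.
  have [j Hj] := pow_small (ltW t0) t1 (divr_gt0 r0 B0); exists j => z zB.
  apply: Hr; rewrite nrmZ modulusX mt.
  apply: (@le_trans _ _ (th ^+ j * (`|B| + 1))).
    rewrite ler_wpM2l ?exprn_ge0 ?(ltW t0) //; apply: le_trans zB _.
    by apply: le_trans (ler_norm B) _; rewrite lerDl.
  by rewrite -ler_pdivlMr.
(* Let j be least with [S j z], so that j > m. If [S m.+1] held at G(z), then, as m + 1 <= d (j-1) -
   1, the point F(t^(j-1) z) would be close to t times a point of K, hence in K; this gives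
   [S j.-1 z], against minimality. *)
have step z m : (3 <= m)%N -> ~ S m z -> ~ S m.+1 (ap G z).
  move=> m3 nS; have [j0 Hj0] := absorb (nrm z).
  have ex : exists j, `[< S j z >] by exists j0; apply/asboolP; apply: Hj0.
  have [j /asboolP Sj minj] := ex_minnP ex.
  have jm : (m < j)%N by rewrite ltnNge; apply/negP => jm; apply: nS; apply: Smono Sj.
  have nSj : ~ S j.-1 z by move=> /asboolP /minj; rewrite leqNgt prednK ?leqnn // (leq_ltn_trans _ jm).
  move=> SG; have SG' : S (d * j.-1).-1 (ap G z).
    by apply: Smono SG; move: jm m3 d_gt1; case: j {Sj minj nSj} => // j; case: (d) => [|[|e]] //= ; rewrite !mulSn; lia.
  apply: nSj; apply: (@julia_bwd F).
  rewrite (eval_homog_scale _ _ hF).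
  have dj0 : (0 < d * j.-1)%N by rewrite muln_gt0 d_gt0; case: j jm {Sj minj SG'} => [|[|j]] //; case: (m) m3.
  apply: (Hin _ _ SG').
  pose u i := t ^+ j * z i.
  have nu : nrm u <= rho by apply: Hrho.
  have jj : j = j.-1.+1 by rewrite prednK // (leq_ltn_trans _ jm).
  (* Passing from t^j z to t^(j-1) z multiplies forms of degree d by t^(-d); this is why closeness
     is assumed with the factor th^d. *)
  have Eu (H : 'I_N -> {mpoly (C R)[N]}) i : homog d (H i) ->
      t ^+ j.-1 ^+ d * meval z (H i) = t ^- d * meval u (H i).
    move=> hH; rewrite (meval_scale _ _ hH) mulrA {2}jj exprS exprMn mulKf ?expf_neq0 //.
  have -> : (fun i => t ^+ j.-1 ^+ d * meval z (F i) - t * (t ^+ (d * j.-1).-1 * meval z (G i))) =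
      (fun i => - t ^- d * (meval u (G i) - meval u (F i))).
    apply/funext => i; rewrite mulrA -exprS prednK // mulnC exprM !Eu // -mulrBr.
    by rewrite mulNr -mulrN opprB.
  rewrite nrmZ modulusN modulusV modulusX mt -ler_pdivlMl ?invr_gt0 ?exprn_gt0 // invrK.
  exact: close.
move=> z [B HB]; apply: contrapT => nS.
have {step} grow n : ~ S (n + 3)%N (iter n (ap G) z).
  elim: n => [|n IH]; first by [].
  by rewrite addSn iterS; apply: step => //; rewrite leq_addl.
have [j Hj] := absorb B; apply: (grow j); apply: Smono (Hj _ (HB j)).
by rewrite leq_addr.
Qed.

End FilledJulia.

(** * Regular maps and nondegenerate maps *)

Section Regularity.
Variables (R : realType) (N d : nat).
Hypotheses (N_gt0 : (0 < N)%N) (d_gt0 : (0 < d)%N).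
Implicit Types (F : polymap R N).

Definition on_line (w v : 'I_N -> C R) (p : {mpoly (C R)[N]}) : {poly C R} :=
  mmap (@polyC (C R)) (fun i => (w i)%:P + 'X * (v i)%:P) p.

Lemma on_lineE w v p t : (on_line w v p).[t] = meval (fun i => w i + t * v i) p.
Proof.
apply: (@eq_rmorph_mpoly _ _ _ (horner_eval t \o mmap (@polyC (C R)) (fun i => (w i)%:P + 'X * (v i)%:P))
  (meval (fun i => w i + t * v i))) => [a|k] /=.
  by rewrite mmapC mevalC /horner_eval hornerC.
by rewrite mmapX mmap1U mevalXU /horner_eval !hornerE.
Qed.

Lemma punctured_zero (f : C R -> C R) : f @ (0 : C R) --> f 0 ->
  (\forall t \near (0 : C R), t != 0 -> f t = 0) -> f 0 = 0.
Proof.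
move=> fc fz; apply/eqP; apply/negPn/negP => f0.
have f0' : 0 < `|f 0| by rewrite normr_gt0.
have /cvgr_dist_lt/(_ _ f0') near_f := fc.
have : \forall t \near (0 : C R)^', False.
  rewrite near_withinE; near=> t => t0.
  have ft0 : t != 0 -> f t = 0 by near: t.
  have ft := ft0 t0.
  have : `|f 0 - f t| < `|f 0| by near: t.
  by rewrite ft subr0 ltxx.
by move/filter_ex => [].
Unshelve. all: by end_near. Qed.

Lemma near_small (e : C R) : 0 < e -> \forall t \near (0 : C R), `|t| < e.
Proof.
move=> e0; have := @cvgr_dist_lt _ _ _ (nbhs (0 : C R)) (nbhs_filter (0 : C R)) id 0 (@cvg_id _ _) _ e0.
by apply: filterS => t; rewrite sub0r normrN.
Qed.

Lemma poly_nonzero_near (p : {poly C R}) : p != 0 ->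
  \forall t \near (0 : C R), t != 0 -> p.[t] != 0.
Proof.
move=> p0; have [rs Ers] := closed_field_poly_normal p.
have lc : lead_coef p != 0 by rewrite lead_coef_eq0.
suff : \forall t \near (0 : C R), t != 0 -> forall r, r \in rs -> t != r.
  apply: filterS => t H t0; have {}H := H t0.
  rewrite Ers hornerZ mulf_neq0 // horner_prod prodf_seq_neq0.
  by apply/allP => r rr /=; rewrite hornerXsubC subr_eq0 H.
elim: rs {Ers} => [|r rs IH]; first by apply: filterE.
have [r0|r0] := eqVneq r 0.
  apply: filterS IH => t H t0 r'; rewrite inE => /predU1P[->|]; first by rewrite r0.
  exact: H.
have rp : 0 < `|r| by rewrite normr_gt0.
apply: filterS2 (near_small rp) IH => t tr H t0 r'; rewrite inE => /predU1P[->|]; last exact: H.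
by apply/eqP => E; rewrite E ltxx in tr.
Qed.

Definition proj_pt (t : C R) (q : 'I_N -> C R) : 'rV[C R]_N.+1 :=
  row_mx (const_mx t : 'rV_1) (\row_i q i).

Lemma proj_ptE0 t q : proj_pt t q 0 0 = t.
Proof.
have E : (0 : 'I_N.+1) = lshift N (0 : 'I_1) by apply: val_inj.
by rewrite /proj_pt E (@row_mxEl _ 1 1 N) mxE.
Qed.

Lemma proj_ptES t q i : proj_pt t q 0 (lift ord0 i) = q i.
Proof.
have E : lift ord0 i = rshift 1 i by apply: val_inj.
by rewrite /proj_pt E (@row_mxEr _ 1 1 N) mxE.
Qed.

Lemma affine_chartE (z : 'rV[C R]_N) : affine_chart z = proj_pt 1 (fun i => z 0 i).
Proof.
have E : z = \row_i z 0 i by apply/rowP => i; rewrite mxE.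
by rewrite {1}E.
Qed.

Lemma row_scaleE (a : C R) (u : 'rV[C R]_N.+1) j : (a *: u) 0 j = a * u 0 j.
Proof. by rewrite [LHS]mxE. Qed.

Lemma proj_row_ext (u v : 'rV[C R]_N.+1) : u 0 0 = v 0 0 ->
  (forall i, u 0 (lift ord0 i) = v 0 (lift ord0 i)) -> u = v.
Proof. by move=> E0 E1; apply/rowP => j; case: (unliftP ord0 j) => [k ->|->]. Qed.

Lemma proj_pt_affine t q : t != 0 ->
  <[proj_pt t q]>%VS = <[affine_chart (\row_i (t^-1 * q i))]>%VS.
Proof.
move=> t0; have -> : proj_pt t q = t *: affine_chart (\row_i (t^-1 * q i)).
  rewrite affine_chartE; apply: proj_row_ext => [|k]; rewrite row_scaleE.
    by rewrite !proj_ptE0 mulr1.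
  by rewrite !proj_ptES mxE mulrA mulfV ?mul1r.
apply/eqP; rewrite eqEdim -!memvE memvZ ?memv_line //= !dim_vline scaler_eq0 (negbTE t0).
by [].
Qed.

(* If [F p = 0] with [p != 0], the points [0 : q] with [q] close to [p] are mapped to
   the hyperplane at infinity and [t : p] to [1 : 0]: a lift of the extension would
   vanish at [0 : p]. *)
Lemma regular_nondegenerate F : homogeneous_map d F -> regular d F ->
  forall p, (forall i, meval p (F i) = 0) -> forall i, p i = 0.
Proof.
move=> hF0 [degF [g [holg extg]]] p Fp.
have hF i : homog d (F i) by apply/homogP; apply: hF0.
apply: contrapT => /existsNP[i0 /eqP pi0].
have F_neq0 : F i0 != 0.
  by apply/eqP => E; have := degF i0; rewrite E mmeasure0.
pose v0 := proj_pt 0 p.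
have v00 : v0 != 0.
  by apply/eqP => /rowP/(_ (lift ord0 i0)); rewrite proj_ptES mxE => /eqP; rewrite (negbTE pi0).
have [h Hh] := holg v0 v00.
pose Q u := differentiable h u /\ (forall L : proj_space R N, val L = <[u]>%VS -> val (g L) = <[h u]>%VS).
have Hint : \forall u \near v0, nbhs u Q by exact: (nbhs_interior Hh).
have mkL u : u != 0 -> exists L : proj_space R N, val L = <[u]>%VS.
  move=> u0; have E : \dim <[u]>%VS == 1%N by rewrite dim_vline u0.
  by exists (exist (fun L : {vspace 'rV[C R]_N.+1} => \dim L == 1%N) _ E).
(* [t : q] = [1 : q/t] is sent to [1 : F(q) / t^d], so the lift [h] is proportional to (t^d,
   F(q)). *)
have rel t q : t != 0 -> Q (proj_pt t q) -> forall i,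
    h (proj_pt t q) 0 (lift ord0 i) * t ^+ d = h (proj_pt t q) 0 0 * meval q (F i).
  move=> t0 [_ HL] i; have u0 : proj_pt t q != 0.
    by apply/eqP => /rowP/(_ 0); rewrite proj_ptE0 mxE => /eqP; rewrite (negbTE t0).
  have [L EL] := mkL _ u0; have E1 := HL L EL.
  have E2 := extg (\row_i (t^-1 * q i)) L; rewrite EL proj_pt_affine // in E2.
  have {}E2 := E2 erefl; rewrite E1 in E2.
  have : h (proj_pt t q) \in <[h (proj_pt t q)]>%VS by apply: memv_line.
  rewrite E2 => /vlineP[c ->].
  rewrite affine_chartE !row_scaleE proj_ptE0 proj_ptES mulr1 mxE -mulrA; congr (_ * _).
  have -> : meval (fun j => (\row_i (t^-1 * q i)) 0 j) (F i) = t^-1 ^+ d * meval q (F i).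
    rewrite -(meval_scale _ _ (hF i)); apply: meval_eq => j.
    by rewrite mxE.
  by rewrite exprVn mulrC mulrA mulfV ?mul1r // expf_neq0.
have curve (a b : 'rV[C R]_N.+1) : (fun t : C R => a + t *: b) @ (0 : C R) --> a.
  apply/(@cvgrPdist_lt _ _ _ _ (nbhs_filter (0 : C R))) => e e0.
  have b1 : 0 < `|b| + 1 by rewrite ltr_wpDl.
  apply: filterS (near_small (divr_gt0 e0 b1)) => t; rewrite ltr_pdivlMr // opprD addNKr normrN normrZ.
  by apply: le_lt_trans; rewrite ler_wpM2l // lerDl.
have hcurve (a b : 'rV[C R]_N.+1) j : nbhs a Q -> (fun t : C R => h (a + t *: b) 0 j) @ (0 : C R) --> h a 0 j.
  move=> /nbhs_singleton[/differentiable_continuous ch _].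
  have c1 := cvg_comp _ _ ch (@coord_continuous _ _ _ 0 j (h a)).
  move=> A /c1 Aa; exact: (curve a b _ Aa).
have rowD (a b : 'rV[C R]_N.+1) j : (a + b) 0 j = a 0 j + b 0 j by rewrite [LHS]mxE.
have ptD t q : proj_pt t q = proj_pt 0 q + t *: proj_pt 1 (fun=> 0).
  apply: proj_row_ext => [|k]; rewrite rowD row_scaleE.
    by rewrite !proj_ptE0 add0r mulr1.
  by rewrite !proj_ptES mulr0 addr0.
(* In this relation t tends to 0 while q is fixed. *)
have at_infty q : nbhs (proj_pt 0 q) Q -> meval q (F i0) != 0 -> h (proj_pt 0 q) 0 0 = 0.
  move=> Qq Fq; pose b := proj_pt 1 (fun=> 0); pose c := meval q (F i0).
  pose f t := h (proj_pt 0 q + t *: b) 0 0 * c - h (proj_pt 0 q + t *: b) 0 (lift ord0 i0) * t ^+ d.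
  have f0 : f 0 = h (proj_pt 0 q) 0 0 * c.
    by rewrite /f scale0r addr0 expr0n gtn_eqF // mulr0 subr0.
  have : f 0 = 0.
    apply: punctured_zero.
      rewrite /f; apply: (cvgB (FF := nbhs_filter (0 : C R))); apply: (cvgM (FF := nbhs_filter (0 : C R))).
      - by rewrite scale0r addr0; apply: hcurve.
      - exact: (@cvg_cst _ c _ (nbhs (0 : C R)) (nbhs_filter (0 : C R))).
      - by rewrite scale0r addr0; apply: hcurve.
      - elim: (d) => [|k IH].
          by move=> A /nbhs_singleton A1; exact: (@filterE _ (nbhs (0 : C R)) (nbhs_filter (0 : C R)) (fun=> A 1) (fun=> A1)).
        rewrite exprS; under eq_fun do rewrite exprS.
        by apply: (cvgM (FF := nbhs_filter (0 : C R))); first exact: cvg_id.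
    have H : \forall t \near (0 : C R), Q (proj_pt 0 q + t *: b) := curve _ _ _ Qq.
    apply: (@filterS _ (nbhs (0 : C R)) (nbhs_filter (0 : C R)) _ _ _ H) => t Qt t0.
    by rewrite /f; apply/eqP; rewrite subr_eq0 -ptD; apply/eqP; rewrite rel // ptD.
  by rewrite f0 => /eqP; rewrite mulf_eq0 (negbTE Fq) orbF => /eqP.
have [x Fx] := mpoly_nonroot F_neq0.
(* A line through p on which F_i0 does not vanish identically; [at_infty] applies at its points near
   p other than p. *)
pose e i := x i - p i; pose pi := on_line p e (F i0).
have pi_neq0 : pi != 0.
  apply: contraNneq Fx => E; have := on_lineE p e (F i0) 1; rewrite -/pi E horner0 => ->.
  by apply/eqP; apply: meval_eq => j; rewrite mul1r /e addrC subrK.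
have h0 : h v0 0 0 = 0.
  pose b := proj_pt 0 e.
  have ptE s : v0 + s *: b = proj_pt 0 (fun i => p i + s * e i).
    apply: proj_row_ext => [|k]; rewrite rowD row_scaleE.
      by rewrite !proj_ptE0 mulr0 addr0.
    by rewrite !proj_ptES.
  rewrite -[v0](addr0 v0) -(scale0r b).
  apply: (@punctured_zero (fun s => h (v0 + s *: b) 0 0)).
    by rewrite scale0r addr0; apply: hcurve; exact: Hh.
  have H : \forall t \near (0 : C R), nbhs (v0 + t *: b) Q := curve _ _ _ Hint.
  apply: (@filterS2 _ (nbhs (0 : C R)) (nbhs_filter (0 : C R)) _ _ _ _
    (poly_nonzero_near pi_neq0) H) => s Fs Qs s0; rewrite /= ptE in Qs *.
  by apply: at_infty => //; rewrite -on_lineE; apply: Fs.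
(* Along [t : p] the right-hand side of [rel] is zero because F(p) = 0. *)
have hi i : h v0 0 (lift ord0 i) = 0.
  pose b := proj_pt 1 (fun=> 0); rewrite -[v0](addr0 v0) -(scale0r b).
  apply: (@punctured_zero (fun t => h (v0 + t *: b) 0 (lift ord0 i))).
    by rewrite scale0r addr0; apply: hcurve; exact: Hh.
  have H : \forall t \near (0 : C R), Q (v0 + t *: b) := curve _ _ _ Hh.
  apply: (@filterS _ (nbhs (0 : C R)) (nbhs_filter (0 : C R)) _ _ _ H) => t Qt t0; rewrite -ptD in Qt *.
  have := rel _ _ t0 Qt i; rewrite Fp mulr0 => /eqP.
  by rewrite mulf_eq0 expf_eq0 (negbTE t0) andbF orbF => /eqP.
have hv : h v0 = 0.
  by apply: proj_row_ext => [|k]; rewrite mxE ?hi.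
have [L EL] := mkL _ v00; have [_ /(_ L EL) E] := nbhs_singleton Hh.
by have := valP (g L); rewrite /= E hv dim_vline eqxx.
Qed.

(** The map (t, q) -> (t^d, F(q)) is homogeneous and vanishes only at 0, so it induces a map of
    lines. [g] is computed from a chosen vector of each line, and [gE] shows that the choice does
    not matter. *)
Lemma nondegenerate_regular F : homogeneous_map d F -> (forall i, F i != 0) ->
  (forall p, (forall i, meval p (F i) = 0) -> forall i, p i = 0) -> regular d F.
Proof.
move=> hF0 Fn0 nd; have hF i : homog d (F i) by apply/homogP; apply: hF0.
split=> [i|].
  have Fi := Fn0 i; rewrite -mlead_deg //; congr _.+1; apply/eqP; apply: contraTT (mlead_supp Fi).
  by move=> /hF E; rewrite mcoeff_msupp E eqxx.
pose hh (u : 'rV[C R]_N.+1) := proj_pt (u 0 0 ^+ d) (fun i => meval (fun j => u 0 (lift ord0 j)) (F i)).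
have hh0 u : u != 0 -> hh u != 0.
  move=> u0; apply: contraNneq u0 => E.
  have E0 : u 0 0 = 0.
    by have /rowP/(_ 0) := E; rewrite proj_ptE0 mxE => /eqP; rewrite expf_eq0 d_gt0 => /eqP.
  have E1 := nd (fun j => u 0 (lift ord0 j)) (fun i => etrans (esym (proj_ptES _ _ i)) (etrans (congr1 (fun A : 'rV_N.+1 => A 0 (lift ord0 i)) E) (mxE _ _ _ _))).
  by apply/eqP/proj_row_ext => [|k]; rewrite mxE ?E1.
have hhZ a u : hh (a *: u) = a ^+ d *: hh u.
  apply: proj_row_ext => [|k]; rewrite row_scaleE; first by rewrite !proj_ptE0 row_scaleE exprMn.
  rewrite !proj_ptES -(meval_scale _ _ (hF k)); apply: meval_eq => i.
  by rewrite mxE.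
have pick0 (L : proj_space R N) : vpick (val L) != 0.
  by rewrite vpick0 -dimv_eq0 (eqP (valP L)).
have dimh (L : proj_space R N) : \dim <[hh (vpick (val L))]>%VS == 1%N.
  by rewrite dim_vline hh0 ?pick0.
pose g (L : proj_space R N) : proj_space R N := exist (fun L : {vspace 'rV[C R]_N.+1} => \dim L == 1%N) _ (dimh L).
have gE (L : proj_space R N) u : val L = <[u]>%VS -> val (g L) = <[hh u]>%VS.
  move=> EL; have u0 : u != 0.
    by apply/eqP => E; have := valP L; rewrite /= EL E dim_vline eqxx.
  have : vpick (val L) \in <[u]>%VS by rewrite -EL memv_pick.
  move=> /vlineP[c Ec]; rewrite /= Ec hhZ.
  have c0 : c != 0 by apply/eqP => E; have := pick0 L; rewrite Ec E scale0r eqxx.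
  apply/eqP; rewrite eqEdim -!memvE memvZ ?memv_line //= !dim_vline scaler_eq0 (negbTE (hh0 u u0)) expf_eq0 (negbTE c0) andbF.
  by [].
exists g; split=> [v v0|z L EL].
  exists hh; near=> u; split; last by move=> L; apply: gE.
  have dpoly (p : {mpoly (C R)[N]}) : differentiable (fun u : 'rV[C R]_N.+1 => meval (fun j => u 0 (lift ord0 j)) p) u.
    pose Qp (p : {mpoly (C R)[N]}) := differentiable (fun u : 'rV[C R]_N.+1 => meval (fun j => u 0 (lift ord0 j)) p) u.
    have QC a : Qp (mpolyC N a).
      rewrite /Qp (_ : (fun _ => _) = cst a); first exact: differentiable_cst.
      by apply/funext => w; rewrite mevalC.
    have QD q q' : Qp q -> Qp q' -> Qp (q + q').
      move=> H H'; rewrite /Qp (_ : (fun _ => _) = (fun u : 'rV[C R]_N.+1 => meval (fun j => u 0 (lift ord0 j)) q) \+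
        (fun u : 'rV[C R]_N.+1 => meval (fun j => u 0 (lift ord0 j)) q')); first exact: differentiableD.
      by apply/funext => w; rewrite mevalD.
    have QM q q' : Qp q -> Qp q' -> Qp (q * q').
      move=> H H'; rewrite /Qp (_ : (fun _ => _) = (fun u : 'rV[C R]_N.+1 => meval (fun j => u 0 (lift ord0 j)) q) *
        (fun u : 'rV[C R]_N.+1 => meval (fun j => u 0 (lift ord0 j)) q')); first exact: differentiableM.
      by apply/funext => w; rewrite mevalM.
    have QX k : Qp (mpolyX (C R) (mnm1 k)).
      rewrite /Qp (_ : (fun _ => _) = (fun u : 'rV[C R]_N.+1 => u 0 (lift ord0 k))); first exact: differentiable_coord.
      by apply/funext => w; rewrite mevalXU.
    exact: (@mpoly_closure _ _ Qp QC QD QM QX).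
  pose f (j : 'I_N.+1) (u : 'rV[C R]_N.+1) : 'rV[C R]_N.+1 := hh u 0 j *: delta_mx 0 j.
  rewrite (_ : hh = \sum_(j < N.+1) f j); last first.
    by apply/funext => w; rewrite fct_sumE [LHS]row_sum_delta.
  apply: differentiable_sum => j; apply: differentiableZl.
  case: (unliftP ord0 j) => [k ->|->].
    rewrite (_ : (fun _ => _) = (fun u : 'rV[C R]_N.+1 => meval (fun j => u 0 (lift ord0 j)) (F k))); first exact: dpoly.
    by apply/funext => w; rewrite /hh proj_ptES.
  rewrite (_ : (fun _ => _) = (fun u : 'rV[C R]_N.+1 => u 0 0) ^+ d.-1.+1).
    by apply: differentiableX; exact: differentiable_coord.
  by apply/funext => w; rewrite /hh proj_ptE0 prednK // exprfctE.
rewrite (gE _ _ EL) !affine_chartE; congr <[_]>%VS; apply: proj_row_ext => [|k].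
  by rewrite !proj_ptE0 expr1n.
rewrite !proj_ptES mxE; apply: meval_eq => i.
by rewrite proj_ptES.
Unshelve. all: by end_near. Qed.

End Regularity.

(** * Perturbation and conclusion *)

Lemma upper_shift (R : realFieldType) (sG sF e eps D v : R) : 0 <= D -> eps = e * 5%:R ->
  - e <= sG - sF -> 0 < e -> - e * 1%:R * D + v <= (- sG + e) * D -> v <= (- sF + eps) * D.
Proof.
move=> D0 -> h e0 H; have : (- sG + e + e) * D <= (- sF + e * 5%:R) * D by rewrite ler_wpM2r //; lra.
by lra.
Qed.

Lemma lower_shift (R : realFieldType) (sG sF e eps D v : R) : 0 <= D -> eps = e * 5%:R ->
  sG - sF <= e -> (- sG - e) * D <= v -> (- sF - eps) * D <= - e * 3%:R * D + v.
Proof.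
move=> D0 -> h H.
have : (- sF - e * 5%:R) * D <= (- sG - e - e * 3%:R) * D by rewrite ler_wpM2r //; lra.
by lra.
Qed.

Section Assembly.
Variables (R : realType) (N d : nat).
Hypotheses (N_gt0 : (0 < N)%N) (d_gt1 : (1 < d)%N).
Let d_gt0 : (0 < d)%N := ltnW d_gt1.
Local Notation n := #|coef_index N d|.
Local Notation pt := ('I_N -> C R).
Local Notation ap F := (fun (z : pt) i => meval z (F i)).
Variable Res : {mpoly int[n]}.
Hypothesis hRes : is_resultant R Res.
Let P : {mpoly (C R)[n]} := map_mpoly intr Res.
Local Notation pw := (fun i : 'I_N => mpolyX (C R) (mnm1 i) ^+ d).
Local Notation kap := ((N * d ^ N.-1 * d.-1)%:R^-1 : R).

Lemma res_irreducible : irreducible_elt P.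
Proof. by case: hRes => [[]]. Qed.

Lemma res_power : meval (gcoefs (d := d) pw) P = 1.
Proof. by case: hRes. Qed.

Lemma res_regular (H : polymap R N) : (forall i, homog d (H i)) ->
  (meval (gcoefs (d := d) H) P != 0 <-> regular d H).
Proof. by move=> hH; case: hRes => _ /(_ H) + _; apply => i; apply/homogP. Qed.

Lemma res_nondegenerate (H : polymap R N) : (forall i, homog d (H i)) ->
  meval (gcoefs (d := d) H) P != 0 -> forall z, (forall i, meval z (H i) = 0) -> forall i, z i = 0.
Proof.
move=> hH /(res_regular hH) reg; apply: (regular_nondegenerate d_gt0 _ reg) => i.
exact/homogP.
Qed.

Lemma res_common_zero (H : 'I_N -> {mpoly (C R)[N]}) : (forall i, homog d (H i)) ->
  (exists p, (exists i, p i != 0) /\ forall i, meval p (H i) = 0) -> meval (gcoefs (d := d) H) P = 0.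
Proof.
move=> hH [p [[i pi] Hp]]; apply: contrapT => /eqP /(res_nondegenerate hH)/(_ p Hp i).
by move/eqP; rewrite (negbTE pi).
Qed.

Lemma res_degenerate x : meval x P = 0 -> degenerate (@ofcoefs N d (C R) x).
Proof.
move=> Px; apply: contrapT => nd.
have : meval (gcoefs (d := d) (ofcoefs x)) P != 0.
  apply/(res_regular (ofcoefs_homog x)); apply: (nondegenerate_regular d_gt0).
  - by move=> i; apply/homogP; apply: ofcoefs_homog.
  - by move=> i; apply/negP => /eqP E; apply: nd; left; exists i.
  - move=> p Hp i; apply: contrapT => /eqP pi; apply: nd; right; exists p; split=> //.
    by exists i.
have -> : meval (gcoefs (d := d) (ofcoefs x)) P = meval x P by apply: meval_eq => k; apply: ofcoefsK.
by rewrite Px eqxx.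
Qed.

Lemma good_case (F : 'I_N -> {mpoly (C R)[N]}) : (forall i, homog d (F i)) ->
  meval (gcoefs (d := d) F) P != 0 -> famdet (N * d.-1).+1 (bfam d F) != 0 ->
  forall eps : R, 0 < eps -> exists m0, forall m, (m0 <= m)%N ->
  (forall zeta : bmultinom N m.+1 -> pt, (forall h, julia F (zeta h)) ->
    vdm zeta != 0 -> ln (modulus (vdm zeta)) <=
      (- (ln (modulus (meval (gcoefs (d := d) F) P)) * kap) + eps) * (fekete_degree N m)%:R) /\
  (exists2 zeta : bmultinom N m.+1 -> pt, (forall h, julia F (zeta h)) &
    vdm zeta != 0 /\ (- (ln (modulus (meval (gcoefs (d := d) F) P)) * kap) - eps) *
      (fekete_degree N m)%:R <= ln (modulus (vdm zeta))).
Proof.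
move=> hF PF gF; have A m : famdet m (bfam d F) != 0 by apply: famdet_all.
have F0 := res_nondegenerate hF PF.
have [c [c0 Ac]] := famdet_log_estimate N_gt0 d_gt0 res_irreducible res_power
  res_degenerate res_common_zero hF PF gF.
have [c' [c'0 Qc]] := qdet_estimate N_gt0 d_gt1 hF A c0 Ac.
have [rho rho1 Hrho] := julia_bounded N_gt0 d_gt1 hF F0.
have [r r0 Hr] := julia_ball d_gt1 hF.
have Nr : 0 < r / N%:R by rewrite divr_gt0 // ltr0n.
apply: (@good_limit R N d N_gt0 d_gt1 F hF A (julia F) rho (r / N%:R) _ _ rho1 _ Nr _ _ c' c'0).
- by move=> z; apply: julia_fwd.
- by move=> z; apply: julia_bwd.
- by move=> z Kz i; apply: le_trans (modulus_le_nrm z i) (Hrho z Kz).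
- move=> z zr; apply: Hr; apply: le_trans (nrm_le zr) _.
  by rewrite mulrC divfK // pnatr_eq0 -lt0n.
- by move=> k; rewrite mulrA; apply: Qc.
Qed.

Lemma vdm_scale m (a : C R) (zeta : bmultinom N m.+1 -> pt) :
  vdm (fun h i => a * zeta h i) = a ^+ fekete_degree N m * vdm zeta.
Proof.
rewrite /vdm (eq_fdet (g := fun g h : bmultinom N m.+1 =>
  a ^+ mdeg (bmnm g) * meval (zeta h) (mpolyX (C R) (bmnm g)))).
  by rewrite fdet_scale_row /fekete_degree -degree_sum prodrXr.
by move=> g h; apply: meval_scale; apply: homogX.
Qed.

(** On the line F + t (F - (z_i^d)) the determinant in degree N (d-1) + 1 is a polynomial in t equal
    to 1 at t = -1; its zeros are therefore finite in number, and arbitrarily small t avoid them. *)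
Lemma good_perturbation (F : 'I_N -> {mpoly (C R)[N]}) (rho del eta : R) : (forall i, homog d (F i)) ->
  meval (gcoefs (d := d) F) P != 0 -> 0 <= rho -> 0 < del -> 0 < eta ->
  exists G : 'I_N -> {mpoly (C R)[N]}, [/\ forall i, homog d (G i),
    meval (gcoefs (d := d) G) P != 0, famdet (N * d.-1).+1 (bfam d G) != 0,
    forall z, nrm z <= rho -> nrm (fun i => meval z (G i) - meval z (F i)) <= del &
    `|ln (modulus (meval (gcoefs (d := d) G) P)) - ln (modulus (meval (gcoefs (d := d) F) P))| <= eta].
Proof.
move=> hF PF rho0 del0 eta0; pose m1 := (N * d.-1).+1.
have hpw := @power_homog R N d.
pose E i := F i - pw i; pose G (t : C R) i := F i + t *: E i.
have hE i : homog d (E i) by rewrite /E -scaleN1r; apply: homogD => //; apply: homogZ; apply: hpw.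
have hG t i : homog d (G t i) by apply: homogD => //; apply: homogZ; apply: hE.
have cG t k : gcoefs (d := d) (G t) k = gcoefs (d := d) F k + t * gcoefs (d := d) E k.
  by rewrite /gcoefs /G mcoeffD mcoeffZ.
pose a := on_line (gcoefs (d := d) F) (gcoefs (d := d) E) (macaulay N d (C R) m1).
have aE t : a.[t] = famdet m1 (bfam d (G t)).
  rewrite on_lineE -(@mmap_macaulay_homog N d (C R) (C R) idfun _ m1 (hG t)).
  by apply: meval_eq => k; rewrite -cG.
have a0 : a != 0.
  have : a.[-1] = 1.
    rewrite aE; have Epw i : G (-1) i = pw i by rewrite /G /E scaleN1r opprB addrC subrK.
    have -> : bfam d (G (-1)) = bfam d pw by congr (bfam d _); apply/funext.
    by rewrite (eq_famdet _ (@bfam_power _ _ d)) famdet_X.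
  by move=> E1; apply/eqP => a0; move: E1; rewrite a0 horner0 => /eqP; rewrite eq_sym oner_eq0.
have PF0 : 0 < modulus (meval (gcoefs (d := d) F) P) by rewrite modulus_gt0.
have [k1 k10 Hk1] : exists2 k1 : R, 0 < k1 & forall x,
    `|modulus (meval (gcoefs (d := d) F) P) - x| < k1 -> 0 < x /\
    `|ln x - ln (modulus (meval (gcoefs (d := d) F) P))| <= eta.
  have [e1 /= e10 He1] := @continuous_ln R _ PF0 _ (@nbhsx_ballx R R^o _ _ eta0).
  exists (Num.min e1 (modulus (meval (gcoefs (d := d) F) P))); first by rewrite lt_min e10.
  move=> x; rewrite lt_min => /andP[x1 x2]; split.
    by move: x2; rewrite ltr_distlCDr || (rewrite ltr_norml => /andP[_]; rewrite ltrBlDr ltrDl).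
  have := He1 x x1; rewrite /= -ball_normE /= distrC => /ltW.
  by [].
have BF0 := nrm_ge0 (gcoefs (d := d) F); have BE0 := nrm_ge0 (gcoefs (d := d) E).
have [L L0 HL] := poly_lipschitz P (addr_ge0 BF0 BE0).
have [M M1 HM] := polymap_bounded E rho0.
have M0 : 0 < M by apply: lt_le_trans M1.
have C0 : 0 < L * nrm (gcoefs (d := d) E) + 1 by rewrite ltr_wpDl // mulr_ge0.
(* Three demands on t: the coefficients stay where P is Lipschitz, G stays within [del] of F, and
   the value of P moves by less than [k1]. *)
pose e := Num.min 1 (Num.min (del / M) (k1 / (L * nrm (gcoefs (d := d) E) + 1))).
have e0 : 0 < e by rewrite !lt_min ltr01 !divr_gt0.
have [t [te ta]] : exists t : C R, modulus t < e /\ a.[t] != 0.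
  have e0' : (0 : C R) < e%:C%C by rewrite ltcR.
  have H : \forall t \near (0 : C R)^', `|t| < e%:C%C /\ a.[t] != 0.
    rewrite near_withinE; apply: filterS2 (near_small e0') (poly_nonzero_near a0) => t t1 t2 t0.
    by split=> //; apply: t2.
  have [t [t1 t2]] := filter_ex H; exists t; split=> //.
  by move: t1; rewrite modulus_norm ltcR.
move: te; rewrite !lt_min => /and3P[t1 tM tk].
have close : modulus (meval (gcoefs (d := d) (G t)) P - meval (gcoefs (d := d) F) P) < k1.
  have nE : nrm (fun k => gcoefs (d := d) (G t) k - gcoefs (d := d) F k) = modulus t * nrm (gcoefs (d := d) E).
    by rewrite -nrmZ; apply: eq_bigr => k _; rewrite cG addrC addKr.
  have b1 : nrm (gcoefs (d := d) (G t)) <= nrm (gcoefs (d := d) F) + nrm (gcoefs (d := d) E).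
    have -> : gcoefs (d := d) (G t) = (fun k => gcoefs (d := d) F k + t * gcoefs (d := d) E k).
      by apply/funext => k; rewrite cG.
    apply: le_trans (nrmD _ _) _; rewrite lerD2l nrmZ.
    by rewrite ler_piMl ?nrm_ge0 // ltW.
  have b2 : nrm (gcoefs (d := d) F) <= nrm (gcoefs (d := d) F) + nrm (gcoefs (d := d) E) by rewrite lerDl.
  apply: le_lt_trans (HL _ _ b1 b2) _; rewrite nE mulrCA.
  apply: (@le_lt_trans _ _ (modulus t * (L * nrm (gcoefs (d := d) E) + 1))).
    by rewrite ler_wpM2l ?modulus_ge0 // lerDl.
  by rewrite -ltr_pdivlMr.
have tri : `|modulus (meval (gcoefs (d := d) F) P) - modulus (meval (gcoefs (d := d) (G t)) P)| < k1.
  apply: le_lt_trans close.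
  have T (x y : C R) : modulus x - modulus y <= modulus (x - y).
    by rewrite lerBlDr; apply: le_trans (modulusD _ _); rewrite subrK.
  rewrite ler_norml; apply/andP; split; first by rewrite lerNl opprB T.
  by apply: le_trans (T _ _) _; rewrite -modulusN opprB.
have [Pt lnt] := Hk1 _ tri.
exists (G t); split=> //; first by rewrite -modulus_gt0.
  by rewrite -aE.
move=> z z1; have -> : (fun i => meval z (G t i) - meval z (F i)) = (fun i => t * meval z (E i)).
  by apply/funext => i; rewrite /G mevalD mevalZ addrC addKr.
rewrite nrmZ; apply: (@le_trans _ _ (modulus t * M)); first by rewrite ler_wpM2l ?modulus_ge0 ?HM.
by rewrite -ler_pdivlMr // ltW.
Qed.

(** For a good map G near F, th K_F lies in K_G and th^3 K_G in K_F. Dilation by th^j multiplies the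
    Vandermonde determinant by th^(j D(m)); with th = exp(-e) its logarithm divided by D(m) moves by
    -j e. *)
Lemma general_case (F : 'I_N -> {mpoly (C R)[N]}) : (forall i, homog d (F i)) ->
  meval (gcoefs (d := d) F) P != 0 ->
  forall eps : R, 0 < eps -> exists m0, forall m, (m0 <= m)%N ->
  (forall zeta : bmultinom N m.+1 -> pt, (forall h, julia F (zeta h)) ->
    vdm zeta != 0 -> ln (modulus (vdm zeta)) <=
      (- (ln (modulus (meval (gcoefs (d := d) F) P)) * kap) + eps) * (fekete_degree N m)%:R) /\
  (exists2 zeta : bmultinom N m.+1 -> pt, (forall h, julia F (zeta h)) &
    vdm zeta != 0 /\ (- (ln (modulus (meval (gcoefs (d := d) F) P)) * kap) - eps) *
      (fekete_degree N m)%:R <= ln (modulus (vdm zeta))).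
Proof.
move=> hF PF eps eps0; have F0 := res_nondegenerate hF PF.
have kap0 : 0 <= kap by rewrite invr_ge0.
(* The lower bound loses e in [good_case], e between the two resultants and 3 e from the dilation by
   th^3. *)
pose e := eps / 5; have e0 : 0 < e by rewrite divr_gt0.
have lnth : ln (expR (- e)) = - e by rewrite expRK.
have t0 := expR_gt0 (- e); have t1 : expR (- e) < 1 by rewrite expR_lt1 oppr_lt0.
set th := expR (- e) in lnth t0 t1.
have [rho rho1 Hrho] := julia_bounded N_gt0 d_gt1 hF F0.
have [r r0 Hr] := julia_ball d_gt1 hF.
have [ep ep0 Hep] := julia_interior N_gt0 d_gt1 hF F0 t0 t1.
have k1 : 0 < kap + 1 by rewrite ltr_wpDl.
have [G [hG PG gG close lnG]] := good_perturbation hF PF (le_trans ler01 rho1)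
  (mulr_gt0 (exprn_gt0 d t0) ep0) (divr_gt0 e0 k1).
have close' z : nrm z <= rho -> nrm (fun i => meval z (G i) - meval z (F i)) <= ep.
  by move/close/le_trans; apply; rewrite ler_piMl ?(ltW ep0) // exprn_ile1 ?(ltW t0) ?(ltW t1).
have inn := julia_inner d_gt1 hF hG t0 t1 Hrho Hep close'.
have out := julia_outer N_gt0 d_gt1 hF hG t0 t1 r0 Hr Hrho Hep close.
have lnk : `|ln (modulus (meval (gcoefs (d := d) G) P)) * kap - ln (modulus (meval (gcoefs (d := d) F) P)) * kap| <= e.
  rewrite -mulrBl normrM [`|kap|]ger0_norm //; apply: le_trans (ler_wpM2r kap0 lnG) _.
  rewrite -mulrA ler_piMr ?(ltW e0) // mulrC ler_pdivrMr // mul1r lerDl.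
  exact: ler01.
set sF := ln (modulus (meval (gcoefs (d := d) F) P)) * kap in lnk *.
set sG := ln (modulus (meval (gcoefs (d := d) G) P)) * kap in lnk.
have [m0 Hm] := good_case hG PG gG e0; rewrite -/sG in Hm.
move: lnk; rewrite ler_norml => /andP[lnk1 lnk2].
have mth : modulus (th%:C%C : C R) = th by rewrite modulus_real ger0_norm // ltW.
have thn0 : (th%:C%C : C R) != 0 by rewrite -modulus_eq0 mth gt_eqF.
have lnscale m (zeta : bmultinom N m.+1 -> pt) j : vdm zeta != 0 ->
    vdm (fun h i => th%:C%C ^+ j * zeta h i) != 0 /\
    ln (modulus (vdm (fun h i => th%:C%C ^+ j * zeta h i))) =
    - e * j%:R * (fekete_degree N m)%:R + ln (modulus (vdm zeta)).
  move=> v0; rewrite vdm_scale -exprM; split; first by rewrite mulf_neq0 // expf_neq0.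
  rewrite modulusM lnM ?posrE ?modulus_gt0 ?expf_neq0 // modulusX mth lnXn // lnth.
  by rewrite -[- e *+ _]mulr_natr natrM mulrA.
exists m0 => m /Hm[up [zeta Kz [v0 lo]]]; set D := (fekete_degree N m)%:R : R in up lo *.
have D0 : 0 <= D by [].
have Ee : eps = e * 5%:R by rewrite /e divfK // pnatr_eq0.
split=> [xi Kxi xi0|].
  have [w0 Ew] := lnscale m xi 1%N xi0.
  have H := up _ (fun h => inn _ (Kxi h)) w0; rewrite Ew in H.
  exact: upper_shift D0 Ee lnk1 e0 H.
have [w0 Ew] := lnscale m zeta 3%N v0.
exists (fun h i => th%:C%C ^+ 3 * zeta h i); first by move=> h; apply: out.
split; first exact: w0.
by rewrite Ew; apply: lower_shift D0 Ee lnk2 lo.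
Qed.

End Assembly.

(** * From Vandermonde determinants to the transfinite diameter *)

Section Diameter.
Variables (R : realType) (N : nat).
Hypothesis N_gt0 : (0 < N)%N.
Implicit Types (E : set 'rV[C R]_N) (F : polymap R N).

Lemma iter_pmeval F n (z : 'rV[C R]_N) :
  (fun i => iter n (pmeval F) z 0 i) = iter n (fun z i => meval z (F i)) (fun i => z 0 i).
Proof.
by elim: n => //= n IH; apply/funext => i; rewrite mxE -IH.
Qed.

Lemma enorm_bounds (z : 'rV[C R]_N) :
  enorm z <= nrm (fun i => z 0 i) /\ nrm (fun i => z 0 i) <= N%:R * enorm z.
Proof.
have S0 : 0 <= \sum_(i < N) modulus (z 0 i) ^+ 2.
  by apply: sumr_ge0 => i _; rewrite exprn_ge0 ?modulus_ge0.
split; last first.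
  apply: nrm_le => i; rewrite -[X in X <= _]ger0_norm ?modulus_ge0 // -sqrtr_sqr ler_sqrt //.
  rewrite (bigD1 i) //= lerDl; apply: sumr_ge0 => j _; rewrite exprn_ge0 //.
  exact: modulus_ge0.
rewrite -[X in _ <= X]ger0_norm ?nrm_ge0 // -sqrtr_sqr ler_sqrt ?sqr_ge0 //.
rewrite expr2 {1}/nrm mulr_suml; apply: ler_sum => i _; rewrite expr2.
by rewrite ler_wpM2l ?modulus_ge0 // (modulus_le_nrm (fun i => z 0 i)).
Qed.

Lemma filled_juliaP F (z : 'rV[C R]_N) :
  filled_julia F z <-> julia F (fun i => z 0 i).
Proof.
rewrite /filled_julia /=; set S := (X in ereal_sup X); split=> [lt|[B HB]].
  have le0 n : ((enorm (iter n (pmeval F) z))%:E <= ereal_sup S)%E.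
    by apply: ereal_sup_ubound; exists n.
  case E : (ereal_sup S) lt le0 => [B| |] // _ le0; last by have := le0 0%N.
  exists (N%:R * B) => n; rewrite -iter_pmeval.
  apply: le_trans (enorm_bounds _).2 _; rewrite ler_wpM2l //.
  by have := le0 n; rewrite lee_fin.
apply: (@le_lt_trans _ _ B%:E); last exact: ltry.
apply: ge_ereal_sup => _ [n _ <-]; rewrite lee_fin.
by apply: le_trans (enorm_bounds _).1 _; rewrite iter_pmeval.
Qed.

Lemma fekete_detE n (zeta : 'I_#|{: bmultinom N n.+1}| -> 'rV[C R]_N) :
  fekete_det zeta = vdm (fun h i => zeta (enum_rank h) 0 i).
Proof.
congr (\det _); apply/matrixP => i j; rewrite !mxE; apply: meval_eq => k.
by rewrite enum_valK.
Qed.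

(** The two hypotheses also show that the set of moduli is nonempty and bounded above, so that its
    [sup] is a true supremum and not a default value. *)
Lemma diameter_bounds E m (a b : R) : (0 < m)%N ->
  (forall zeta : bmultinom N m.+1 -> 'I_N -> C R, (forall h, E (\row_i zeta h i)) ->
    vdm zeta != 0 -> ln (modulus (vdm zeta)) <= a * (fekete_degree N m)%:R) ->
  (exists2 zeta : bmultinom N m.+1 -> 'I_N -> C R, (forall h, E (\row_i zeta h i)) &
    vdm zeta != 0 /\ b * (fekete_degree N m)%:R <= ln (modulus (vdm zeta))) ->
  expR b <= diameter E m <= expR a.
Proof.
move=> m0 up [zeta Kz [v0 lo]]; rewrite /diameter; set D := (fekete_degree N m)%:R : R in up lo *.
have D0 : 0 < D.
  rewrite ltr0n; have := fekete_degree_ge m N_gt0; case: (fekete_degree N m) => //.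
  by rewrite muln0 leqn0 expn_eq0 (gtn_eqF m0).
set S := (X in sup X).
have ubS : ubound S (expR (a * D)).
  move=> _ [xi Kxi <-]; rewrite fekete_detE.
  (* A vanishing determinant is treated apart, as its logarithm carries no information. *)
  set w := vdm _; have [->|w0] := eqVneq w 0; first by rewrite modulus0 expR_ge0.
  rewrite -(lnK (_ : modulus w \is Num.pos)) ?posrE ?modulus_gt0 // ler_expR.
  apply: up => // h; rewrite (_ : \row_i _ = xi (enum_rank h)) //.
  by apply/rowP => i; rewrite mxE.
have Sz : S (modulus (vdm zeta)).
  exists (fun j => \row_i zeta (enum_val j) i) => //; rewrite fekete_detE.
  congr modulus; apply: eq_fdet => g h; apply: meval_eq => i.
  by rewrite mxE enum_rankK.
have lowS : expR (b * D) <= sup S.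
  apply: le_trans (ub_le_sup _ Sz); last by exists (expR (a * D)).
  by rewrite -[X in _ <= X](lnK (_ : modulus (vdm zeta) \is Num.pos)) ?posrE ?modulus_gt0 // ler_expR.
have upS : sup S <= expR (a * D) by apply: ge_sup => //; exists (modulus (vdm zeta)).
have pw (x : R) : (expR (x * D)) `^ (D^-1) = expR x.
  by rewrite /powR gt_eqF ?expR_gt0 // expRK mulrCA mulVf ?mulr1 // gt_eqF.
have S0 : 0 <= sup S by apply: le_trans lowS; apply: expR_ge0.
have Di : 0 <= D^-1 by rewrite invr_ge0 ltW.
by rewrite -[X in X <= _]pw -[X in _ && (_ <= X)]pw !ge0_ler_powR ?nnegrE ?expR_ge0.
Qed.

Lemma diameter_limit E (s : R) :
  (forall eps : R, 0 < eps -> exists m0, forall m, (m0 <= m)%N ->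
    (forall zeta : bmultinom N m.+1 -> 'I_N -> C R, (forall h, E (\row_i zeta h i)) ->
      vdm zeta != 0 -> ln (modulus (vdm zeta)) <= (s + eps) * (fekete_degree N m)%:R) /\
    (exists2 zeta : bmultinom N m.+1 -> 'I_N -> C R, (forall h, E (\row_i zeta h i)) &
      vdm zeta != 0 /\ (s - eps) * (fekete_degree N m)%:R <= ln (modulus (vdm zeta)))) ->
  diameter E @ \oo --> expR s.
Proof.
move=> H; apply/cvgrPdist_le => e e0.
have [del /= del0 Hdel] := @continuous_expR R s _ (@nbhsx_ballx R R^o _ _ e0).
have d2 : 0 < del / 2 by rewrite divr_gt0.
have [m0 Hm] := H _ d2; exists (maxn m0 1) => // m; rewrite /= geq_max => /andP[/Hm[up lo] m1].
have /andP[h1 h2] := diameter_bounds m1 up lo.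
have near_s x : `|s - x| <= del / 2 -> `|expR s - expR x| <= e.
  move=> sx; have := Hdel x; rewrite /= -ball_normE /=.
  move=> /(_ (le_lt_trans sx _)) h; apply: ltW; apply: h.
  by rewrite ltr_pdivrMr // ltr_pMr // ltr1n.
have e1 : `|expR s - expR (s - del / 2)| <= e.
  by apply: near_s; rewrite opprB addrCA subrr addr0 ger0_norm // ltW.
have e2 : `|expR s - expR (s + del / 2)| <= e.
  by apply: near_s; rewrite opprD addNKr normrN ger0_norm // ltW.
move: e1 e2; rewrite !ler_norml => /andP[_ e1] /andP[e2 _]; apply/andP; split.
  by apply: le_trans e2 _; rewrite lerB.
by apply: le_trans e1; rewrite lerB.
Qed.

End Diameter.

(** Convergence is part of the conclusion because [limn] of a divergent sequence is only a default
    value. *)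
Theorem theorem4p1 (R : realType) (N d : nat) (hN : (1 <= N)%N) (hd : (2 <= d)%N)
    (Res : {mpoly int[#|coef_index N d|]}) (hRes : is_resultant R Res)
    (F : polymap R N) (hom : homogeneous_map d F) (reg : regular d F) :
  cvgn (diameter (filled_julia F)) /\
  transfinite_diameter (filled_julia F) =
    modulus (eval_coefs Res F) `^ (- (N * d ^ (N - 1) * (d - 1))%N%:R^-1).
Proof.
have hF i : homog d (F i) by apply/homogP; apply: hom.
have PF : eval_coefs Res F != 0 by case: hRes => _ H _; apply/H.
have lim : diameter (filled_julia F) @ \oo -->
    expR (- (ln (modulus (eval_coefs Res F)) * (N * d ^ N.-1 * d.-1)%:R^-1)).
  apply: diameter_limit => // eps e0; have [m0 Hm] := general_case hN hd hRes hF PF e0.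
  have toE (zeta : 'I_N -> C R) : filled_julia F (\row_i zeta i) <-> julia F zeta.
    rewrite filled_juliaP (_ : (fun i => _) = zeta) //.
    by apply/funext => i; rewrite mxE.
  exists m0 => m /Hm[up [zeta Kz lo]]; split=> [xi Kxi|].
    by apply: up => h; apply/toE.
  by exists zeta => // h; apply/toE.
split; first by apply/cvg_ex; exists (expR (- (ln (modulus (eval_coefs Res F)) * (N * d ^ N.-1 * d.-1)%:R^-1))).
rewrite /transfinite_diameter (cvg_lim _ lim) //.
by rewrite /powR gt_eqF ?modulus_gt0 // !subn1 mulNr mulrC.
Qed.
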